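(* Let $a>0$, $x>0$, $0<\theta<1$, let $k\geq 0$ be an even integer, and let $\nu\in\mathbb{C}$ with $\Re(\nu)>0$. Then \begin{align*} &\left(\frac{a^2x}{4}\right)^{\frac{\nu}{2}+k+1}\sum_{n=1}^{\infty} n^{\nu/2}K_{\nu}(a\sqrt{nx})\sum_{d\mid n}d^k\sin(2\pi d\theta)\\ &= -\frac{(-1)^{k/2}a^{2k+2}k!}{2^{2k+4}(2\pi)^{k+1}}\Gamma(\nu)\bigl(\zeta(1+k,\theta)-\zeta(1+k,1-\theta)\bigr)x^{k+1} +\delta_k\,\frac{\pi\Gamma(1+\nu)}{4}\bigl(\zeta(0,\theta)-\zeta(0,1-\theta)\bigr)\\ &\quad+\frac{(-1)^{k/2}}{4}(2\pi)^{k+1}\sum_{d=1}^{\infty}d^k\sum_{m=0}^{\infty}\left\{\frac{\Gamma(\nu+k+1)}{\left(1+\frac{16\pi^2d}{a^2x}(m+\theta)\right)^{1+\nu+k}}-\frac{\Gamma(\nu+k+1)}{\left(1+\frac{16\pi^2d}{a^2x}(m+1-\theta)\right)^{1+\nu+k}}\right\}, \end{align*} where $\delta_k=1$ if $k=0$ and $\delta_k=0$ otherwise.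
   Context: $K_\nu$ denotes the modified Bessel function of the second kind of order $\nu$. $\zeta(s,\alpha)=\sum_{n=0}^\infty (n+\alpha)^{-s}$ (for $\Re s>1$, $0<\alpha\le 1$) is the Hurwitz zeta function, meromorphically continued to $\mathbb{C}$ with its only pole at $s=1$. When $k=0$ the expression $\zeta(1,\theta)-\zeta(1,1-\theta)$ is understood as $\lim_{s\to 1}(\zeta(s,\theta)-\zeta(s,1-\theta))$. *)

(* Defs.v *)
From Stdlib Require Import Reals.
From Coquelicot Require Import Coquelicot.
Open Scope R_scope.

Definition cexp (z : C) : C :=
  (exp (Re z) * cos (Im z), exp (Re z) * sin (Im z)).

Definition cpow (b : R) (w : C) : C := cexp (Cmult w (RtoC (ln b))).

Definition CInt0inf (f : R -> C) : C :=
  (RInt_gen (fun t => Re (f t)) (at_right 0) (Rbar_locally p_infty),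
   RInt_gen (fun t => Im (f t)) (at_right 0) (Rbar_locally p_infty)).

Definition CSeries (u : nat -> C) : C :=
  (Series (fun n => Re (u n)), Series (fun n => Im (u n))).

Definition CGamma (s : C) : C :=
  CInt0inf (fun t => Cmult (cpow t (Cminus s (RtoC 1))) (RtoC (exp (- t)))).

Definition ccosh (z : C) : C :=
  Cmult (RtoC (/ 2)) (Cplus (cexp z) (cexp (Copp z))).

(* Modified Bessel function of the second kind, x > 0, nu complex:
   K_nu(x) = int_0^oo exp(-x cosh t) cosh(nu t) dt  (DLMF 10.32.9) *)
Definition BesselK (nu : C) (x : R) : C :=
  CInt0inf (fun t => Cmult (RtoC (exp (- x * cosh t))) (ccosh (Cmult nu (RtoC t)))).

Definition sum_lt (f : nat -> R) (N : nat) : R :=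
  match N with O => 0 | S M => sum_f_R0 f M end.

(* Hurwitz zeta function zeta(s, alpha) for real s > -1, s <> 1, 0 < alpha <= 1,
   via the Euler-Maclaurin form of the analytic continuation:
   zeta(s,a) = lim_N ( sum_{n<N} (n+a)^(-s) + (N+a)^(1-s)/(s-1) + (N+a)^(-s)/2 ).
   For s > 1 this equals sum_{n>=0} (n+a)^(-s). *)
Definition HurwitzZeta (s alpha : R) : R :=
  real (Lim_seq (fun N =>
    sum_lt (fun n => Rpower (INR n + alpha) (- s)) N
    + Rpower (INR N + alpha) (1 - s) / (s - 1)
    + Rpower (INR N + alpha) (- s) / 2)).

(* zeta(1+k, theta) - zeta(1+k, 1-theta); for k = 0 this is understood as
   lim_{s -> 1} (zeta(s, theta) - zeta(s, 1-theta)) *)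
Definition HurwitzDiff (k : nat) (theta : R) : R :=
  match k with
  | O => real (Lim (fun s => HurwitzZeta s theta - HurwitzZeta s (1 - theta)) 1)
  | _ => HurwitzZeta (1 + INR k) theta - HurwitzZeta (1 + INR k) (1 - theta)
  end.

Definition divsum_sin (k : nat) (theta : R) (n : nat) : R :=
  sum_f_R0 (fun i => if Nat.eqb (n mod (S i)) 0
                     then INR (S i) ^ k * sin (2 * PI * INR (S i) * theta)
                     else 0) (pred n).

(* Main.v *)
(* Put [lam = a^2 x / 4]. The Bessel terms are integrals against [t^(nu-1) e^(-t)]:
   [2 Y^(nu/2) K_nu (2 sqrt Y) = int t^(nu-1) e^(-t-Y/t) dt], and
   [Gamma w (1+c)^(-w) = int t^(w-1) e^(-t) e^(-ct) dt]. Interchanging sums and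
   integrals reduces the claim to an identity of integrands, a transformation, with
   [u = lam/t], of the Lambert series [sum_j j^k sin(2 pi j th) / (e^(ju) - 1)].
   For [k = 0] it follows from the partial fractions of [cot], used once in the sum
   over [j] and once in the sum over the multiples of [u]; general [k] is obtained by
   differentiating [k] times in [th]. The double series met on the way converges only
   conditionally, and exchanging its sums produces the [delta_k] term. *)
Require Import Defs.
From Stdlib Require Import Reals Arith Lra Lia Psatz.
From Coquelicot Require Import Coquelicot.
Open Scope R_scope.

(** * Dominated series *)

(** Every interchange rests on dominated convergence along an arbitrary filter, with majorants in
    product form: one summable factor per index and, under an integral, one integrable factor in
    [t]. This form shapes the estimates. Let [mu] run through the multiples of [u / (2 * PI)]. In
    the double series over [n] and [mu], the terms paired at [th] and [1 - th] have size about
    1/(n^2 + mu^2), whose double sum diverges logarithmically, so no product majorant exists.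
    Removing the linear interpolation of the kernel between [n] and [n + 1] improves the decay to
    1/(mu^2 (n + 1)^2). The partial fractions come from the doubling formula of cot, written in real
    coordinates, so that no complex analysis enters. Under the integrals, exponential factors are
    traded for powers of [t] times powers of the summation index. On the right-hand side only half
    of [Re nu] is spent in this way, and the other half keeps the remaining Gamma density integrable
    at 0. *)

Lemma Series_tail_bound (a M : nat -> R) (N : nat) :
  (forall n, Rabs (a n) <= M n) -> ex_series M ->
  Rabs (Series (fun k => a (N + k)%nat)) <= Series (fun k => M (N + k)%nat).
Proof.
  intros H HM.
  assert (HM' : ex_series (fun k => M (N + k)%nat)) by (apply ex_series_incr_n; exact HM).
  eapply Rle_trans.
  - apply Series_Rabs. apply (@ex_series_le R_AbsRing R_CompleteNormedModule) with (fun k => M (N + k)%nat); auto.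
    intros n. change (Rabs (Rabs (a (N + n)%nat)) <= M (N + n)%nat). rewrite Rabs_Rabsolu. apply H.
  - apply Series_le; auto. intros n. split; [apply Rabs_pos | apply H].
Qed.

Lemma ex_series_dom (a M : nat -> R) :
  (forall n, Rabs (a n) <= M n) -> ex_series M -> ex_series a.
Proof.
  intros H HM. apply (@ex_series_le R_AbsRing R_CompleteNormedModule) with M; auto.
Qed.

Lemma is_series_extR (a b : nat -> R) (l : R) :
  (forall n, a n = b n) -> is_series a l -> is_series b l.
Proof. apply (is_series_ext a b l). Qed.

Lemma is_series_plusR (a b : nat -> R) (la lb : R) :
  is_series a la -> is_series b lb -> is_series (fun n => a n + b n) (la + lb).
Proof. apply (is_series_plus a b la lb). Qed.

Lemma is_series_scalR (c : R) (a : nat -> R) (l : R) :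
  is_series a l -> is_series (fun n => c * a n) (c * l).
Proof. apply (is_series_scal_l c a l). Qed.

Lemma is_series_minusR (a b : nat -> R) (la lb : R) :
  is_series a la -> is_series b lb -> is_series (fun n => a n - b n) (la - lb).
Proof. apply (is_series_minus a b la lb). Qed.

Lemma ex_series_extR (a b : nat -> R) : (forall n, a n = b n) -> ex_series a -> ex_series b.
Proof. apply (ex_series_ext a b). Qed.

Lemma ex_series_scalR (c : R) (a : nat -> R) : ex_series a -> ex_series (fun n => c * a n).
Proof. intros [l H]. exists (c * l). apply (is_series_scal_l c a l H). Qed.

Lemma Series_tail_lim (M : nat -> R) : ex_series M ->
  is_lim_seq (fun N => Series (fun k => M (N + k)%nat)) 0.
Proof.
  intros HM.
  apply is_lim_seq_incr_1.
  apply is_lim_seq_ext with (fun N => Series M - sum_n M N).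
  - intros N. rewrite (Series_incr_n M (S N)); [| lia | auto].
    rewrite sum_n_Reals. simpl. lra.
  - replace (Finite 0) with (Finite (Series M - Series M)) by (f_equal; ring).
    apply is_lim_seq_minus'; [apply is_lim_seq_const|].
    apply Series_correct in HM. exact HM.
Qed.

Lemma filterlim_sum_f_R0 {T} (F : (T -> Prop) -> Prop) (FF : Filter F)
  (f : T -> nat -> R) (g : nat -> R) (N : nat) :
  (forall n, filterlim (fun t => f t n) F (locally (g n))) ->
  filterlim (fun t => sum_f_R0 (f t) N) F (locally (sum_f_R0 g N)).
Proof.
  intros H. induction N as [|N IH]; simpl; auto.
  exact (filterlim_comp_2 _ _ _ IH (H (S N)) (@filterlim_plus R_AbsRing R_NormedModule _ _)).
Qed.

(** The filter is left general because the parameter varies: a truncation index for double series,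
    an increment tending to 0 for derivatives, a pair of integration bounds for improper
    integrals. *)
Lemma dominated_series {T} (F : (T -> Prop) -> Prop) (FF : ProperFilter F)
  (f : T -> nat -> R) (g M : nat -> R) :
  (forall n, filterlim (fun t => f t n) F (locally (g n))) ->
  F (fun t => forall n, Rabs (f t n) <= M n) -> ex_series M ->
  filterlim (fun t => Series (f t)) F (locally (Series g)).
Proof.
  intros Hl Hd HM.
  (* A proper filter lets the majorant pass to the limit: if it failed for [g n], some [t] would
     have [f t n] both bounded by [M n] and too close to [g n]. *)
  assert (Hg : forall n, Rabs (g n) <= M n).
  { intros n. apply Rnot_lt_le. intros Hn.
    assert (He : 0 < Rabs (g n) - M n) by lra.
    destruct (filter_ex (F := F) _ (filter_and _ _ Hd (proj1 (filterlim_locally _ _) (Hl n) (mkposreal _ He)))) as [t [H1 H2]].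
    specialize (H1 n). change (Rabs (f t n - g n) < Rabs (g n) - M n) in H2.
    pose proof (Rabs_triang_inv (g n) (f t n)). rewrite Rabs_minus_sym in H2. lra. }
  apply filterlim_locally. intros eps.
  (* The tail of [M] is made smaller than [eps / 4]; it is used once for [f t] and once for [g], and
     the finite head receives the remaining [eps / 2]. *)
  destruct (proj1 (filterlim_locally _ _) (Series_tail_lim M HM) (pos_div_2 (pos_div_2 eps))) as [N HN].
  specialize (HN (S N) (Nat.le_succ_diag_r N)).
  change (Rabs (Series (fun k => M (S N + k)%nat) - 0) < eps / 2 / 2) in HN.
  rewrite Rminus_0_r in HN. apply Rabs_def2 in HN. destruct HN as [HN _].
  pose proof (proj1 (filterlim_locally _ _) (filterlim_sum_f_R0 F _ f g N Hl) (pos_div_2 eps)) as HS.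
  generalize (filter_and _ _ Hd HS). apply filter_imp. intros t [H1 H2].
  change (Rabs (sum_f_R0 (f t) N - sum_f_R0 g N) < eps / 2) in H2.
  change (Rabs (Series (f t) - Series g) < eps).
  rewrite (Series_incr_n (f t) (S N)); [| lia | apply ex_series_dom with M; auto].
  rewrite (Series_incr_n g (S N)); [| lia | apply ex_series_dom with M; auto].
  change (Init.Nat.pred (S N)) with N.
  pose proof (Series_tail_bound (f t) M (S N) H1 HM).
  pose proof (Series_tail_bound g M (S N) Hg HM).
  set (A := Series (fun k => f t (S N + k)%nat)) in *.
  set (B := Series (fun k => g (S N + k)%nat)) in *.
  replace (sum_f_R0 (f t) N + A - (sum_f_R0 g N + B)) with
    ((sum_f_R0 (f t) N - sum_f_R0 g N) + (A - B)) by ring.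
  pose proof (Rabs_triang (sum_f_R0 (f t) N - sum_f_R0 g N) (A - B)).
  pose proof (Rabs_triang A (- B)). rewrite Rabs_Ropp in *.
  unfold Rminus in *. lra.
Qed.

Lemma Series_sum_f_R0 (a : nat -> nat -> R) (N : nat) :
  (forall m, ex_series (a m)) ->
  is_series (fun n => sum_f_R0 (fun m => a m n) N) (sum_f_R0 (fun m => Series (a m)) N).
Proof.
  intros H. induction N as [|N IH]; simpl.
  - apply Series_correct, H.
  - apply (is_series_plus _ _ _ _ IH (Series_correct _ (H (S N)))).
Qed.

Lemma sum_f_R0_Series_bound (b : nat -> R) N :
  (forall n, 0 <= b n) -> ex_series b -> sum_f_R0 b N <= Series b.
Proof.
  intros Hb Hs. rewrite (Series_incr_n b (S N)) by (auto; lia). simpl Init.Nat.pred.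
  assert (0 <= Series (fun k => b (S N + k)%nat)).
  { rewrite <- (Rmult_0_l (Series (fun _ => 0))). rewrite <- Series_scal_l.
    apply Series_le. intros; split; [lra|]. rewrite Rmult_0_l; auto.
    apply ex_series_incr_n with (a:=b); auto. }
  lra.
Qed.

(** Partial sums over [m] are themselves series in [n], dominated by [Series b * c n]. Since
    [Series] is a total function, the conclusion takes the form [is_series], which includes
    convergence of the outer series. *)
Lemma is_series_fubini (a : nat -> nat -> R) (b c : nat -> R) :
  (forall m n, Rabs (a m n) <= b m * c n) ->
  (forall m, 0 <= b m) -> (forall n, 0 <= c n) -> ex_series b -> ex_series c ->
  is_series (fun m => Series (a m)) (Series (fun n => Series (fun m => a m n))).
Proof.
  intros H Hb Hc Eb Ec.
  assert (Ea : forall m, ex_series (a m)).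
  { intros m. apply ex_series_dom with (fun n => b m * c n); auto.
    apply ex_series_scalR, Ec. }
  assert (Ea' : forall n, ex_series (fun m => a m n)).
  { intros n. apply ex_series_dom with (fun m => c n * b m); [intros m; rewrite Rmult_comm; auto|].
    apply ex_series_scalR, Eb. }
  unfold is_series.
  apply filterlim_ext with (fun M => Series (fun n => sum_f_R0 (fun m => a m n) M)).
  { intros M. rewrite sum_n_Reals. apply is_series_unique. apply Series_sum_f_R0; auto. }
  apply dominated_series with (fun n => Series b * c n).
  - apply eventually_filter.
  - intros n. pose proof (Series_correct _ (Ea' n)) as Hn. unfold is_series in Hn.
    revert Hn. apply filterlim_ext. intros M. apply sum_n_Reals.
  - apply filter_forall. intros M n.
    eapply Rle_trans; [apply Rsum_abs|].
    apply Rle_trans with (sum_f_R0 (fun m => b m * c n) M).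
    + apply sum_Rle. intros; auto.
    + rewrite <- scal_sum. rewrite Rmult_comm. apply Rmult_le_compat_r; auto.
      apply sum_f_R0_Series_bound; auto.
  - apply ex_series_scalR, Ec.
Qed.

Lemma ex_series_fubini (a : nat -> nat -> R) (b c : nat -> R) :
  (forall m n, Rabs (a m n) <= b m * c n) ->
  (forall m, 0 <= b m) -> (forall n, 0 <= c n) -> ex_series b -> ex_series c ->
  ex_series (fun m => Series (a m)).
Proof. intros. eexists. eapply is_series_fubini; eauto. Qed.

Lemma Series_fubini (a : nat -> nat -> R) (b c : nat -> R) :
  (forall m n, Rabs (a m n) <= b m * c n) ->
  (forall m, 0 <= b m) -> (forall n, 0 <= c n) -> ex_series b -> ex_series c ->
  Series (fun m => Series (a m)) = Series (fun n => Series (fun m => a m n)).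
Proof. intros. apply is_series_unique. eapply is_series_fubini; eauto. Qed.

(* Mean value theorem dominates the difference quotients by [M]. *)
Lemma is_derive_Series (f f' : nat -> R -> R) (M : nat -> R) (p q x : R) :
  p < x < q ->
  (forall n y, p <= y <= q -> is_derive (f n) y (f' n y)) ->
  (forall n y, p <= y <= q -> Rabs (f' n y) <= M n) ->
  ex_series M ->
  (forall y, p < y < q -> ex_series (fun n => f n y)) ->
  is_derive (fun y => Series (fun n => f n y)) x (Series (fun n => f' n x)).
Proof.
  intros Hx Hd Hb HM Hs.
  apply is_derive_Reals. intros eps Heps.
  set (D := fun (h : R) (n : nat) => (f n (x + h) - f n x) / h).
  assert (HL : filterlim (fun h => Series (D h)) (locally' 0) (locally (Series (fun n => f' n x)))).
  { apply dominated_series with M; auto.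
    - apply (Rbar_locally'_filter 0).
    - intros n. apply filterlim_locally. intros e.
      assert (Hn : is_derive (f n) x (f' n x)) by (apply Hd; lra).
      apply is_derive_Reals in Hn. destruct (Hn e (cond_pos e)) as [d Hd'].
      exists d. intros h Hh Hh0. change (Rabs (h - 0) < d) in Hh. rewrite Rminus_0_r in Hh.
      apply (Hd' h Hh0 Hh).
    - assert (Hr : 0 < Rmin (x - p) (q - x)) by (apply Rmin_pos; lra).
      exists (mkposreal _ Hr). intros h Hh Hh0 n.
      change (Rabs (h - 0) < Rmin (x - p) (q - x)) in Hh. rewrite Rminus_0_r in Hh.
      pose proof (Rmin_l (x - p) (q - x)). pose proof (Rmin_r (x - p) (q - x)).
      apply Rabs_def2 in Hh.
      assert (Hin : forall c, Rmin x (x + h) <= c <= Rmax x (x + h) -> p <= c <= q).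
      { intros c. unfold Rmin, Rmax; destruct (Rle_dec x (x + h)); lra. }
      destruct (MVT_gen (f n) x (x + h) (f' n)) as [c [Hc E]].
      + intros c Hc. apply Hd, Hin. lra.
      + intros c Hc. apply derivable_continuous_pt. exists (f' n c). apply is_derive_Reals. apply Hd, Hin, Hc.
      + unfold D. rewrite E. replace (f' n c * (x + h - x) / h) with (f' n c) by (field; auto).
        apply Hb, Hin, Hc. }
  pose proof (proj1 (filterlim_locally _ _) HL (mkposreal _ Heps)) as [d Hd'].
  assert (Hr : 0 < Rmin d (Rmin (x - p) (q - x))) by (apply Rmin_pos; [apply cond_pos | apply Rmin_pos; lra]).
  exists (mkposreal _ Hr). intros h Hh0 Hh. simpl in Hh.
  pose proof (Rmin_l d (Rmin (x - p) (q - x))). pose proof (Rmin_r d (Rmin (x - p) (q - x))).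
  pose proof (Rmin_l (x - p) (q - x)). pose proof (Rmin_r (x - p) (q - x)).
  assert (Hh' : ball 0 d h). { change (Rabs (h - 0) < d). rewrite Rminus_0_r. lra. }
  specialize (Hd' h Hh' Hh0). apply Rabs_def2 in Hh.
  change (Rabs (Series (D h) - Series (fun n => f' n x)) < eps) in Hd'.
  replace ((Series (fun n => f n (x + h)) - Series (fun n => f n x)) / h) with (Series (D h)); auto.
  unfold D, Rdiv. rewrite (Rmult_comm _ (/ h)).
  rewrite <- Series_minus by (apply Hs; lra).
  rewrite <- Series_scal_l. apply Series_ext. intros n. ring.
Qed.

(** * Telescoping, sums of powers and finite sums *)

Lemma is_series_telescope (a : nat -> R) (l : R) :
  is_lim_seq a l -> is_series (fun n => a n - a (S n)) (a O - l).
Proof.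
  intros H. unfold is_series.
  apply filterlim_ext with (fun N => a O - a (S N)).
  { intros N. rewrite sum_n_Reals. induction N as [|N IH]; simpl; [ring | rewrite <- IH; ring]. }
  apply (is_lim_seq_minus' (fun _ => a O) (fun N => a (S N)) (a O) l).
  - apply is_lim_seq_const.
  - apply is_lim_seq_incr_1 in H. exact H.
Qed.

Lemma is_lim_seq_Rpower_neg (s al : R) : 0 < s -> is_lim_seq (fun n => Rpower (INR n + al) (- s)) 0.
Proof.
  intros Hs.
  apply is_lim_seq_ext with (fun n => exp (- s * ln (INR n + al))); [reflexivity|].
  apply (is_lim_comp_seq exp (fun n => - s * ln (INR n + al)) m_infty 0).
  - apply is_lim_exp_m.
  - exists O. intros n _ E; discriminate E.
  - replace m_infty with (Rbar_mult (- s) p_infty).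
    + apply is_lim_seq_scal_l.
      apply (is_lim_comp_seq ln (fun n => INR n + al) p_infty p_infty).
      * apply is_lim_ln_p.
      * exists O. intros n _ E; discriminate E.
      * eapply is_lim_seq_plus; [apply is_lim_seq_INR | apply is_lim_seq_const | reflexivity].
    + simpl. destruct (Rle_dec 0 (- s)); [exfalso; lra | reflexivity].
Qed.

Lemma is_derive_Rpower (s y : R) : 0 < y -> is_derive (fun t => Rpower t s) y (s * Rpower y (s - 1)).
Proof.
  intros Hy. apply is_derive_Reals, derivable_pt_lim_power, Hy.
Qed.

Lemma Rpower_pos (x s : R) : 0 < Rpower x s.
Proof. apply exp_pos. Qed.

Lemma Rpower_le_neg (x y s : R) : 0 < x <= y -> 0 <= s -> Rpower y (- s) <= Rpower x (- s).
Proof.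
  intros Hx Hs. rewrite !Rpower_Ropp. apply Rinv_le_contravar; [apply Rpower_pos|].
  apply Rle_Rpower_l; lra.
Qed.

(** The integral test in telescoped form: by the mean value theorem a difference of consecutive
    values of the power [1 - s], divided by [s - 1], is the power [- s] at an intermediate point,
    hence at least the later term. For this reason the first term is split off. *)
Lemma ex_series_Rpower (s al : R) : 1 < s -> 0 < al -> ex_series (fun n => Rpower (INR n + al) (- s)).
Proof.
  intros Hs Hal.
  apply (ex_series_incr_1 (fun n => Rpower (INR n + al) (- s))).
  apply ex_series_dom with
    (fun n => / (s - 1) * (Rpower (INR n + al) (- (s - 1)) - Rpower (INR (S n) + al) (- (s - 1)))).
  - intros n. rewrite Rabs_pos_eq by (left; apply Rpower_pos).
    rewrite S_INR. pose proof (pos_INR n) as Hn.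
    destruct (MVT_gen (fun t => Rpower t (- (s - 1))) (INR n + al) (INR n + 1 + al)
       (fun t => - (s - 1) * Rpower t (- (s - 1) - 1))) as [c [Hc E]].
    + intros y Hy. rewrite Rmin_left in Hy by lra. apply is_derive_Rpower; lra.
    + intros y Hy. rewrite Rmin_left in Hy by lra. apply derivable_continuous_pt.
      exists (- (s - 1) * Rpower y (- (s - 1) - 1)). apply is_derive_Reals, is_derive_Rpower; lra.
    + rewrite Rmin_left, Rmax_right in Hc by lra.
      replace (- (s - 1) - 1) with (- s) in E by ring.
      replace (/ (s - 1) * (Rpower (INR n + al) (- (s - 1)) - Rpower (INR n + 1 + al) (- (s - 1))))
        with (Rpower c (- s)).
      * apply Rpower_le_neg; lra.
      * apply Rmult_eq_reg_l with (s - 1); [|lra]. rewrite <- Rmult_assoc, Rinv_r by lra. lra.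
  - apply ex_series_scalR.
    eexists. apply (is_series_telescope (fun n => Rpower (INR n + al) (- (s - 1)))).
    apply is_lim_seq_Rpower_neg; lra.
Qed.

Lemma ex_series_inv_sqr : ex_series (fun n => / (INR n + 1) ^ 2).
Proof.
  eapply ex_series_extR; [|apply (ex_series_Rpower 2 1); lra].
  intros n. simpl. rewrite Rpower_Ropp. f_equal.
  pose proof (pos_INR n). change 2 with (INR 2). rewrite Rpower_pow by lra. simpl; ring.
Qed.

Lemma sum_lt_S (f : nat -> R) N : sum_lt f (S N) = sum_lt f N + f N.
Proof. destruct N; simpl; ring. Qed.

Lemma sum_lt_ext (f g : nat -> R) N : (forall n, (n < N)%nat -> f n = g n) -> sum_lt f N = sum_lt g N.
Proof.
  intros H. induction N as [|N IH]; auto. rewrite !sum_lt_S, IH, H; auto.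
Qed.

Lemma sum_lt_plus (f g : nat -> R) N : sum_lt (fun n => f n + g n) N = sum_lt f N + sum_lt g N.
Proof. induction N as [|N IH]; [simpl; ring|]. rewrite !sum_lt_S, IH; ring. Qed.

Lemma sum_lt_scal (c : R) (f : nat -> R) N : sum_lt (fun n => c * f n) N = c * sum_lt f N.
Proof. induction N as [|N IH]; [simpl; ring|]. rewrite !sum_lt_S, IH; ring. Qed.

Lemma sum_lt_add (f : nat -> R) M N : sum_lt f (M + N) = sum_lt f M + sum_lt (fun n => f (M + n)%nat) N.
Proof.
  induction N as [|N IH]; [rewrite Nat.add_0_r; simpl; ring|].
  rewrite Nat.add_succ_r, !sum_lt_S, IH; ring.
Qed.

Lemma sum_lt_rev (f : nat -> R) N : sum_lt (fun n => f (N - 1 - n)%nat) N = sum_lt f N.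
Proof.
  revert f. induction N as [|N IH]; intros f; auto.
  rewrite (sum_lt_S f). rewrite <- (IH f).
  change (S N) with (1 + N)%nat. rewrite sum_lt_add. simpl sum_lt at 1.
  replace (N - 0 - 0)%nat with N by lia. rewrite Rplus_comm. f_equal.
  apply sum_lt_ext. intros n Hn. f_equal. lia.
Qed.

(** Each index is paired with its mirror image in a range of even length; the reflection in the
    doubling formula produces exactly such pairs. *)
Lemma sum_lt_fold (f : nat -> R) M : sum_lt (fun n => f n + f (2 * M - 1 - n)%nat) M = sum_lt f (2 * M).
Proof.
  rewrite sum_lt_plus. replace (2 * M)%nat with (M + M)%nat by lia. rewrite sum_lt_add. f_equal.
  rewrite <- (sum_lt_rev (fun n => f (M + n)%nat)). apply sum_lt_ext. intros n Hn. f_equal. lia.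
Qed.

(** Padding with zeros brings finite sums of growing length under dominated convergence, and turns
    divisor sums into full series. *)
Lemma is_series_finite (f : nat -> R) N : is_series (fun n => if Nat.ltb n N then f n else 0) (sum_lt f N).
Proof.
  unfold is_series. apply filterlim_ext_loc with (fun _ => sum_lt f N).
  - exists N. intros M HM. rewrite sum_n_Reals.
    change (sum_lt f N = sum_lt (fun n => if Nat.ltb n N then f n else 0) (S M)).
    replace (S M) with (N + (S M - N))%nat by lia. rewrite sum_lt_add.
    replace (sum_lt (fun n => if (N + n <? N)%nat then f (N + n)%nat else 0) (S M - N)) with 0.
    + rewrite Rplus_0_r. apply sum_lt_ext. intros n Hn. apply Nat.ltb_lt in Hn. now rewrite Hn.
    + rewrite (sum_lt_ext _ (fun _ => 0 * 0)). rewrite sum_lt_scal; ring.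
      intros n Hn. replace (N + n <? N)%nat with false; [ring|]. symmetry; apply Nat.ltb_ge; lia.
  - apply filterlim_const.
Qed.

(** * Partial fractions of the cotangent *)

(* Halving [X] and [Y] repeatedly turns the doubling formula into a Riemann-type
   sum whose termwise limit is the partial fraction expansion. *)
Lemma iterated_doubling (f : R -> R -> R) (sigma : R)
  (sigma2 : sigma * sigma = 1)
  (doubling : forall X Y, 0 < Y ->
    f X Y = / 2 * (f (X / 2) (Y / 2) + sigma * f ((PI - X) / 2) (Y / 2)))
  X Y p : 0 < Y ->
  f X Y = / 2 ^ (S p) * sum_lt (fun n => f ((PI * INR n + X) / 2 ^ (S p)) (Y / 2 ^ (S p))
      + sigma * f ((PI * INR n + PI - X) / 2 ^ (S p)) (Y / 2 ^ (S p))) (2 ^ p).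
Proof.
  intros HY. induction p as [|p IH].
  - simpl. rewrite doubling by auto. rewrite Rmult_1_r, Rmult_0_r. rewrite !Rplus_0_l. reflexivity.
  (* The reflection [X -> PI - X] followed by halving exchanges the two kinds of sample points and
     sends the index [n] to [2 ^ S p - 1 - n], the mirror image in the doubled range. Reflecting
     twice restores the sign because [sigma * sigma = 1]. *)
  - rewrite IH. rewrite Nat.pow_succ_r' with (b := p). rewrite <- sum_lt_fold.
    assert (H2 : 0 < 2 ^ S p) by (apply pow_lt; lra).
    replace (/ 2 ^ S (S p)) with (/ 2 ^ S p * / 2) by (simpl; field; apply pow_nonzero; lra).
    rewrite Rmult_assoc. f_equal. rewrite <- sum_lt_scal. apply sum_lt_ext. intros n Hn.
    assert (HI : INR (2 * 2 ^ p - 1 - n) = 2 ^ S p - 1 - INR n).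
    { rewrite !minus_INR by (simpl; lia). rewrite mult_INR, pow_INR. change (INR 2) with 2. change (INR 1) with 1. simpl. ring. }
    rewrite HI.
    assert (HY' : 0 < Y / 2 ^ S p) by (apply Rdiv_lt_0_compat; auto).
    rewrite (doubling ((PI * INR n + X) / 2 ^ S p)) by auto.
    rewrite (doubling ((PI * INR n + PI - X) / 2 ^ S p)) by auto.
    replace (Y / 2 ^ S p / 2) with (Y / 2 ^ S (S p)) by (simpl; field; apply pow_nonzero; lra).
    replace ((PI * INR n + X) / 2 ^ S p / 2) with ((PI * INR n + X) / 2 ^ S (S p))
      by (simpl; field; apply pow_nonzero; lra).
    replace ((PI * INR n + PI - X) / 2 ^ S p / 2) with ((PI * INR n + PI - X) / 2 ^ S (S p))
      by (simpl; field; apply pow_nonzero; lra).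
    replace ((PI - (PI * INR n + X) / 2 ^ S p) / 2) with
      ((PI * (2 ^ S p - 1 - INR n) + PI - X) / 2 ^ S (S p)) by (simpl; field; apply pow_nonzero; lra).
    replace ((PI - (PI * INR n + PI - X) / 2 ^ S p) / 2) with
      ((PI * (2 ^ S p - 1 - INR n) + X) / 2 ^ S (S p)) by (simpl; field; apply pow_nonzero; lra).
    set (a1 := f _ _). set (a2 := f _ _). set (a3 := f _ _). set (a4 := f _ _).
    replace (a1 + sigma * a2 + sigma * (/ 2 * (a3 + sigma * a4))) with
     (a1 + sigma * a2 + / 2 * sigma * a3 + / 2 * (sigma * sigma) * a4) by ring.
    replace (/ 2 * (a1 + sigma * a2) + sigma * (/ 2 * (a3 + sigma * a4))) with
     (/ 2 * (a1 + sigma * a2) + / 2 * sigma * a3 + / 2 * (sigma * sigma) * a4) by ring.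
    rewrite sigma2. ring.
Qed.

(** Tannery's argument: the padded finite sums equal [f X Y] for every [p], while as [p] grows they
    tend to the series of the termwise limits. The bound is required only where [n < 2 ^ p], the
    terms actually present. *)
Lemma doubling_series (f : R -> R -> R) (sigma : R)
  (sigma2 : sigma * sigma = 1)
  (doubling : forall X Y, 0 < Y ->
    f X Y = / 2 * (f (X / 2) (Y / 2) + sigma * f ((PI - X) / 2) (Y / 2)))
  X Y (g M : nat -> R) : 0 < Y ->
  (forall n, is_lim_seq (fun p => / 2 ^ (S p) * (f ((PI * INR n + X) / 2 ^ (S p)) (Y / 2 ^ (S p))
      + sigma * f ((PI * INR n + PI - X) / 2 ^ (S p)) (Y / 2 ^ (S p)))) (g n)) ->
  (forall n p, (n < 2 ^ p)%nat -> Rabs (/ 2 ^ (S p) * (f ((PI * INR n + X) / 2 ^ (S p)) (Y / 2 ^ (S p))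
      + sigma * f ((PI * INR n + PI - X) / 2 ^ (S p)) (Y / 2 ^ (S p)))) <= M n) ->
  (forall n, Rabs (g n) <= M n) ->
  ex_series M -> is_series g (f X Y).
Proof.
  intros HY Hl Hb Hg HM.
  assert (HM0 : forall n, 0 <= M n) by (intros n; eapply Rle_trans; [apply Rabs_pos | apply Hg]).
  replace (f X Y) with (Series g); [apply Series_correct, ex_series_dom with M; auto|].
  set (u := fun p n => if Nat.ltb n (2 ^ p) then / 2 ^ (S p) * (f ((PI * INR n + X) / 2 ^ (S p)) (Y / 2 ^ (S p))
      + sigma * f ((PI * INR n + PI - X) / 2 ^ (S p)) (Y / 2 ^ (S p))) else 0).
  assert (Hlim : filterlim (fun p => Series (u p)) eventually (locally (Series g))).
  { apply dominated_series with M; auto.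
    - apply eventually_filter.
    - intros n. generalize (Hl n). apply filterlim_ext_loc. exists n. intros p Hp.
      unfold u. replace (n <? 2 ^ p)%nat with true; auto. symmetry. apply Nat.ltb_lt.
      pose proof (Nat.pow_gt_lin_r 2 p ltac:(lia)). lia.
    - apply filter_forall. intros p n. unfold u. destruct (Nat.ltb_spec n (2 ^ p)); auto.
      rewrite Rabs_R0; auto. }
  assert (Hc : filterlim (fun p => Series (u p)) eventually (locally (f X Y))).
  { apply filterlim_ext with (fun _ => f X Y); [|apply filterlim_const].
    intros p. rewrite (iterated_doubling f sigma sigma2 doubling X Y p HY). symmetry. rewrite <- sum_lt_scal.
    apply is_series_unique.
    apply (is_series_finite (fun n => / 2 ^ (S p) * (f ((PI * INR n + X) / 2 ^ (S p)) (Y / 2 ^ (S p))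
      + sigma * f ((PI * INR n + PI - X) / 2 ^ (S p)) (Y / 2 ^ (S p))))). }
  apply (filterlim_locally_unique (K := R_AbsRing) (V := R_NormedModule) _ _ _ Hlim Hc).
Qed.


(* Up to sign, the real and imaginary parts of [cot (x + i y)]. *)
Definition cotRe (x y : R) : R := sin x * cos x / (sinh y ^ 2 + sin x ^ 2).
Definition cotIm (x y : R) : R := sinh y * cosh y / (sinh y ^ 2 + sin x ^ 2).

Lemma sinh_cosh_double Y : sinh Y = 2 * sinh (Y / 2) * cosh (Y / 2)
  /\ cosh (Y / 2) ^ 2 = 1 + sinh (Y / 2) ^ 2 /\ cosh Y = 1 + 2 * sinh (Y / 2) ^ 2.
Proof.
  unfold sinh, cosh. set (e := exp (Y / 2)). set (e' := exp (- (Y / 2))).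
  assert (H : e * e' = 1).
  { unfold e, e'. rewrite <- exp_plus. replace (Y / 2 + - (Y / 2)) with 0 by ring. apply exp_0. }
  replace (exp Y) with (e * e) by (unfold e; rewrite <- exp_plus; f_equal; field).
  replace (exp (- Y)) with (e' * e') by (unfold e'; rewrite <- exp_plus; f_equal; field).
  repeat split; field_simplify; try lra; nra.
Qed.

Lemma sinh_MVT z : 0 <= z -> z <= sinh z <= z * exp z.
Proof.
  intros Hz. destruct (MVT_gen sinh 0 z cosh) as [c [Hc E]].
  - intros y _. apply is_derive_Reals, derivable_pt_lim_sinh.
  - intros y _. apply derivable_continuous_pt, derivable_pt_sinh.
  - rewrite Rmin_left, Rmax_right in Hc by auto. rewrite sinh_0 in E.
    assert (H1 : exp c * exp (- c) = 1) by (rewrite <- exp_plus, Rplus_opp_r; apply exp_0).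
    pose proof (exp_pos c). pose proof (exp_pos (- c)).
    assert (exp c <= exp z) by (destruct (proj2 Hc) as [h|h]; [left; apply exp_increasing, h | rewrite h; lra]).
    assert (1 <= exp c) by (rewrite <- exp_0; destruct (proj1 Hc) as [h|h]; [left; apply exp_increasing, h | rewrite h; lra]).
    assert (1 <= cosh c) by (unfold cosh; nra).
    assert (cosh c <= exp c) by (unfold cosh; nra).
    replace (sinh z) with (cosh c * z) by lra. nra.
Qed.

Lemma cosh_bounds z : 0 <= z -> 1 <= cosh z <= exp z.
Proof.
  intros Hz. assert (H1 : exp z * exp (- z) = 1) by (rewrite <- exp_plus, Rplus_opp_r; apply exp_0).
  pose proof (exp_pos z). pose proof (exp_pos (- z)).
  assert (1 <= exp z) by (rewrite <- exp_0; destruct Hz as [h|h]; [left; apply exp_increasing, h | rewrite <- h; lra]).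
  unfold cosh; nra.
Qed.

Lemma cot_den_pos x y : 0 < y -> 0 < sinh y ^ 2 + sin x ^ 2.
Proof. intros Hy. pose proof (proj1 (sinh_MVT y (Rlt_le _ _ Hy))). nra. Qed.

Lemma cot_doubling_trig X : sin X = 2 * sin (X / 2) * cos (X / 2) /\
  cos X = cos (X / 2) ^ 2 - sin (X / 2) ^ 2 /\ cos (X / 2) ^ 2 = 1 - sin (X / 2) ^ 2 /\
  sin ((PI - X) / 2) = cos (X / 2) /\ cos ((PI - X) / 2) = sin (X / 2).
Proof.
  pose proof (sin2_cos2 (X / 2)) as H. unfold Rsqr in H.
  replace ((PI - X) / 2) with (PI / 2 - X / 2) by field.
  rewrite sin_shift, cos_shift.
  assert (E : X = 2 * (X / 2)) by field.
  repeat split; try lra.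
  - rewrite E at 1. apply sin_2a.
  - rewrite E at 1. rewrite cos_2a. ring.
Qed.

(** This is cot z = (cot (z/2) + cot ((z - PI)/2)) / 2. The second argument is reflected to
    [(PI - X) / 2]; the real part is odd in [x], whence the sign -1. *)
Lemma cotRe_doubling X Y : 0 < Y ->
  cotRe X Y = / 2 * (cotRe (X / 2) (Y / 2) + - (1) * cotRe ((PI - X) / 2) (Y / 2)).
Proof.
  intros HY. unfold cotRe.
  pose proof (cot_den_pos X Y HY) as D0.
  pose proof (cot_den_pos (X / 2) (Y / 2) ltac:(lra)) as D1.
  pose proof (cot_den_pos ((PI - X) / 2) (Y / 2) ltac:(lra)) as D2.
  destruct (cot_doubling_trig X) as (E1 & E2 & E3 & E4 & E5).
  destruct (sinh_cosh_double Y) as (F1 & F2 & _).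
  rewrite E4, E5 in *.
  (* For z = X + i Y this says |sin z|^2 = 4 |sin (z/2)|^2 |cos (z/2)|^2. *)
  assert (ED : sinh Y ^ 2 + sin X ^ 2 = 4 * (sinh (Y / 2) ^ 2 + sin (X / 2) ^ 2) * (sinh (Y / 2) ^ 2 + cos (X / 2) ^ 2)).
  { rewrite F1, E1. rewrite !Rpow_mult_distr, F2, E3. ring. }
  rewrite ED, E1, E2. field. lra.
Qed.

(** The same doubling of cot; the imaginary part is even in [x], so the reflection costs no sign. *)
Lemma cotIm_doubling X Y : 0 < Y ->
  cotIm X Y = / 2 * (cotIm (X / 2) (Y / 2) + 1 * cotIm ((PI - X) / 2) (Y / 2)).
Proof.
  intros HY. unfold cotIm.
  pose proof (cot_den_pos X Y HY) as D0.
  pose proof (cot_den_pos (X / 2) (Y / 2) ltac:(lra)) as D1.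
  pose proof (cot_den_pos ((PI - X) / 2) (Y / 2) ltac:(lra)) as D2.
  destruct (cot_doubling_trig X) as (E1 & E2 & E3 & E4 & E5).
  destruct (sinh_cosh_double Y) as (F1 & F2 & F3).
  rewrite E4 in *.
  assert (ED : sinh Y ^ 2 + sin X ^ 2 = 4 * (sinh (Y / 2) ^ 2 + sin (X / 2) ^ 2) * (sinh (Y / 2) ^ 2 + cos (X / 2) ^ 2)).
  { rewrite F1, E1. rewrite !Rpow_mult_distr, F2, E3. ring. }
  rewrite ED, F1, F3.
  replace (1 + 2 * sinh (Y / 2) ^ 2) with
   ((sinh (Y / 2) ^ 2 + sin (X / 2) ^ 2) + (sinh (Y / 2) ^ 2 + cos (X / 2) ^ 2)) by (rewrite E3; ring).
  field. lra.
Qed.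

Lemma is_lim_seq_inv_pow2 : is_lim_seq (fun p => / 2 ^ (S p)) 0.
Proof.
  apply (is_lim_seq_ext (fun p => (/ 2) ^ (S p))); [intros p; apply pow_inv|].
  apply (is_lim_seq_incr_1 (fun p => (/ 2) ^ p)).
  apply is_lim_seq_geom. rewrite Rabs_pos_eq; lra.
Qed.

(** The difference quotient of [g] at 0 along the increments [X / 2 ^ S p]. These must be nonzero,
    hence the separate treatment of [X = 0], the value at which coth is obtained later. *)
Lemma is_lim_seq_blowup (g : R -> R) (l X : R) : is_derive g 0 l -> g 0 = 0 ->
  is_lim_seq (fun p => 2 ^ (S p) * g (X / 2 ^ (S p))) (l * X).
Proof.
  intros Hd H0.
  destruct (Req_dec X 0) as [->|HX].
  - apply is_lim_seq_ext with (fun _ => l * 0); [|apply is_lim_seq_const].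
    intros p. unfold Rdiv. rewrite Rmult_0_l, H0. ring.
  - apply is_derive_Reals in Hd.
    assert (HH : filterlim (fun h => (g (0 + h) - g 0) / h) (locally' 0) (locally l)).
    { apply filterlim_locally. intros e. destruct (Hd e (cond_pos e)) as [d Hd'].
      exists d. intros h Hh Hh0. change (Rabs (h - 0) < d) in Hh. rewrite Rminus_0_r in Hh. apply (Hd' h Hh0 Hh). }
    assert (HX' : filterlim (fun p => X / 2 ^ (S p)) eventually (locally' 0)).
    { intros P HP. destruct HP as [d HP].
      assert (Hl : is_lim_seq (fun p => X * / 2 ^ S p) (X * 0)) by (apply (is_lim_seq_scal_l _ X 0), is_lim_seq_inv_pow2).
      rewrite Rmult_0_r in Hl.
      apply filterlim_locally with (eps := d) in Hl.
      change (eventually (fun p => P (X / 2 ^ S p))). revert Hl. apply filter_imp. intros p Hp. apply HP; auto.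
      apply Rmult_integral_contrapositive_currified; auto. apply Rinv_neq_0_compat, pow_nonzero; lra. }
    apply is_lim_seq_ext with (fun p => X * ((g (0 + X / 2 ^ S p) - g 0) / (X / 2 ^ S p))).
    + intros p. rewrite H0, Rplus_0_l. simpl. field. split; auto. apply pow_nonzero; lra.
    + rewrite Rmult_comm. apply (is_lim_seq_scal_l _ X l).
      exact (filterlim_comp _ _ _ _ _ _ _ _ HX' HH).
Qed.

Lemma cot_den_lim X Y : is_lim_seq (fun p => (2 ^ S p * sinh (Y / 2 ^ S p)) ^ 2 + (2 ^ S p * sin (X / 2 ^ S p)) ^ 2) (X ^ 2 + Y ^ 2).
Proof.
  assert (HS : is_lim_seq (fun p => 2 ^ S p * sin (X / 2 ^ S p)) X).
  { replace X with (1 * X) at 1 by ring. apply is_lim_seq_blowup; [|apply sin_0].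
    rewrite <- cos_0. apply is_derive_Reals, derivable_pt_lim_sin. }
  assert (HH : is_lim_seq (fun p => 2 ^ S p * sinh (Y / 2 ^ S p)) Y).
  { replace Y with (1 * Y) at 1 by ring. apply is_lim_seq_blowup; [|apply sinh_0].
    rewrite <- cosh_0. apply is_derive_Reals, derivable_pt_lim_sinh. }
  rewrite Rplus_comm. simpl.
  apply is_lim_seq_plus'; (apply is_lim_seq_mult'; [|apply is_lim_seq_mult'; [|apply is_lim_seq_const]]); auto.
Qed.

Lemma is_lim_seq_inv_pow2_comp (g : R -> R) X : continuous g 0 ->
  is_lim_seq (fun p => g (X / 2 ^ S p)) (g 0).
Proof.
  intros Hg. apply (filterlim_comp _ _ _ (fun p => X / 2 ^ S p) g eventually (locally 0) (locally (g 0))); auto.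
  replace 0 with (X * 0) by ring. apply (is_lim_seq_scal_l _ X 0), is_lim_seq_inv_pow2.
Qed.

Lemma cotRe_lim X Y : 0 < Y ->
  is_lim_seq (fun p => / 2 ^ S p * cotRe (X / 2 ^ S p) (Y / 2 ^ S p)) (X / (X ^ 2 + Y ^ 2)).
Proof.
  intros HY.
  apply is_lim_seq_ext with (fun p => (2 ^ S p * sin (X / 2 ^ S p)) * cos (X / 2 ^ S p) /
    ((2 ^ S p * sinh (Y / 2 ^ S p)) ^ 2 + (2 ^ S p * sin (X / 2 ^ S p)) ^ 2)).
  - intros p. unfold cotRe.
    assert (H2 : 0 < 2 ^ S p) by (apply pow_lt; lra).
    pose proof (cot_den_pos (X / 2 ^ S p) (Y / 2 ^ S p) ltac:(apply Rdiv_lt_0_compat; auto)).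
    rewrite !Rpow_mult_distr, <- Rmult_plus_distr_l. set (S' := 2 ^ S p) in *. field. lra.
  - apply is_lim_seq_div'.
    + assert (H1 : is_lim_seq (fun p => 2 ^ S p * sin (X / 2 ^ S p)) (1 * X)).
      { apply is_lim_seq_blowup; [|apply sin_0]. rewrite <- cos_0. apply is_derive_Reals, derivable_pt_lim_sin. }
      pose proof (is_lim_seq_mult' _ _ _ _ H1 (is_lim_seq_inv_pow2_comp cos X (continuous_cos 0))) as H.
      rewrite cos_0, Rmult_1_r, Rmult_1_l in H. exact H.
    + apply cot_den_lim.
    + nra.
Qed.

Lemma cotIm_lim X Y : 0 < Y ->
  is_lim_seq (fun p => / 2 ^ S p * cotIm (X / 2 ^ S p) (Y / 2 ^ S p)) (Y / (X ^ 2 + Y ^ 2)).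
Proof.
  intros HY.
  apply is_lim_seq_ext with (fun p => (2 ^ S p * sinh (Y / 2 ^ S p)) * cosh (Y / 2 ^ S p) /
    ((2 ^ S p * sinh (Y / 2 ^ S p)) ^ 2 + (2 ^ S p * sin (X / 2 ^ S p)) ^ 2)).
  - intros p. unfold cotIm.
    assert (H2 : 0 < 2 ^ S p) by (apply pow_lt; lra).
    pose proof (cot_den_pos (X / 2 ^ S p) (Y / 2 ^ S p) ltac:(apply Rdiv_lt_0_compat; auto)).
    rewrite !Rpow_mult_distr, <- Rmult_plus_distr_l. set (S' := 2 ^ S p) in *. field. lra.
  - apply is_lim_seq_div'.
    + assert (H1 : is_lim_seq (fun p => 2 ^ S p * sinh (Y / 2 ^ S p)) (1 * Y)).
      { apply is_lim_seq_blowup; [|apply sinh_0]. rewrite <- cosh_0. apply is_derive_Reals, derivable_pt_lim_sinh. }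
      assert (Hc : continuous cosh 0).
      { apply (ex_derive_continuous cosh). exists (sinh 0). apply is_derive_Reals, derivable_pt_lim_cosh. }
      pose proof (is_lim_seq_mult' _ _ _ _ H1 (is_lim_seq_inv_pow2_comp cosh Y Hc)) as H.
      rewrite cosh_0, Rmult_1_r, Rmult_1_l in H. exact H.
    + apply cot_den_lim.
    + nra.
Qed.

(** From sin z >= z - z^3/6 and z^2 <= 4. The sample points stay at or below [PI / 2], which the
    crude bound [PI <= 4] places in this range. *)
Lemma sin_ge_third z : 0 <= z <= 2 -> z / 3 <= sin z.
Proof.
  intros Hz. destruct (pre_sin_bound z 0) as [H _]; try lra.
  unfold sin_approx, sin_term in H. simpl in H.
  eapply Rle_trans; [|apply H]. assert (z * z <= 4) by nra.
  apply Rle_trans with (z - z * (z * z) / 6); [nra|]. apply Req_le. field.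
Qed.


(* Cauchy-Schwarz: [sh^2 + |s1 s2| <= sqrt (D1 D2)] for [D_i = sh^2 + s_i^2]. *)
Lemma cotRe_diff_bound x1 x2 y : 0 < y -> 0 < sin x1 -> 0 < sin x2 ->
  Rabs (cotRe x1 y - cotRe x2 y) <= Rabs (sin (x1 - x2)) / (sin x1 * sin x2).
Proof.
  intros Hy H1 H2. unfold cotRe.
  pose proof (cot_den_pos x1 y Hy) as D1. pose proof (cot_den_pos x2 y Hy) as D2.
  set (s := sinh y ^ 2) in *.
  assert (Hs : 0 <= s) by (unfold s; apply pow2_ge_0).
  assert (E : sin x1 * cos x1 / (s + sin x1 ^ 2) - sin x2 * cos x2 / (s + sin x2 ^ 2) =
     sin (x1 - x2) * ((s * cos (x1 + x2) - sin x1 * sin x2) / ((s + sin x1 ^ 2) * (s + sin x2 ^ 2)))).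
  { rewrite sin_minus, cos_plus.
    pose proof (sin2_cos2 x1) as F1. pose proof (sin2_cos2 x2) as F2. unfold Rsqr in *.
    set (a := sin x1) in *. set (b := cos x1) in *. set (c := sin x2) in *. set (d := cos x2) in *.
    apply Rminus_diag_uniq.
    replace (a * b / (s + a ^ 2) - c * d / (s + c ^ 2) -
      (a * d - b * c) * ((s * (b * d - a * c) - a * c) / ((s + a ^ 2) * (s + c ^ 2))))
    with (s * (a * b * (1 - (c * c + d * d)) - c * d * (1 - (a * a + b * b))) / ((s + a ^ 2) * (s + c ^ 2)))
    by (field; lra).
    rewrite F1, F2. field; lra. }
  rewrite E, Rabs_mult. unfold Rdiv at 2. apply Rmult_le_compat_l; [apply Rabs_pos|].
  unfold Rdiv. rewrite Rabs_mult, Rabs_inv, (Rabs_pos_eq ((s + _) * _)) by nra.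
  assert (Hc : Rabs (cos (x1 + x2)) <= 1) by (apply Rabs_le; apply COS_bound).
  apply Rabs_le_between in Hc.
  set (p := sin x1) in *. set (q := sin x2) in *.
  assert (Hpq : 0 < p * q) by nra.
  apply Rle_trans with ((s + p * q) * / ((s + p ^ 2) * (s + q ^ 2))).
  - apply Rmult_le_compat_r; [left; apply Rinv_0_lt_compat; nra|]. apply Rabs_le. nra.
  - apply Rmult_le_reg_r with ((s + p ^ 2) * (s + q ^ 2) * (p * q)); [repeat apply Rmult_lt_0_compat; lra|].
    replace ((s + p * q) * / ((s + p ^ 2) * (s + q ^ 2)) * ((s + p ^ 2) * (s + q ^ 2) * (p * q)))
      with ((s + p * q) * (p * q)) by (field; lra).
    replace (/ (p * q) * ((s + p ^ 2) * (s + q ^ 2) * (p * q))) with ((s + p ^ 2) * (s + q ^ 2)) by (field; lra).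
    assert (0 <= s * s) by nra. assert (0 <= s * (p - q) ^ 2) by (apply Rmult_le_pos; [auto|apply pow2_ge_0]).
    assert (0 <= s * (p * q)) by nra. nra.
Qed.

Lemma inv_pow2_range n p : (n < 2 ^ p)%nat -> (INR n + 1) / 2 ^ S p <= / 2.
Proof.
  intros H. assert (INR n + 1 <= 2 ^ p).
  { rewrite <- S_INR. change 2 with (INR 2). rewrite <- pow_INR. apply le_INR. lia. }
  assert (0 < 2 ^ p) by (apply pow_lt; lra).
  simpl. apply Rmult_le_reg_r with (2 * 2 ^ p); [lra|]. field_simplify; lra.
Qed.

Lemma Rabs_sin_le z : Rabs (sin z) <= Rabs z.
Proof.
  destruct (MVT_gen sin 0 z cos) as [c [_ E]].
  - intros y _. apply is_derive_Reals, derivable_pt_lim_sin.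
  - intros y _. apply derivable_continuous_pt, derivable_pt_sin.
  - rewrite sin_0, !Rminus_0_r in E. rewrite E, Rabs_mult.
    assert (Rabs (cos c) <= 1) by (apply Rabs_le, COS_bound). pose proof (Rabs_pos z). nra.
Qed.

(** Each fraction alone decays like 1/n; only the pair formed from [X] and [PI - X] has a summable
    majorant. In its constant, the 9 comes from two uses of [sin_ge_third], [PI] bounds the distance
    between the paired points, and [Rmin X (PI - X)] bounds both from below, up to the factor
    [INR n + 1]. *)
Lemma is_series_cotRe X Y : 0 < X < PI -> 0 < Y ->
  is_series (fun n => (PI * INR n + X) / ((PI * INR n + X) ^ 2 + Y ^ 2)
    - (PI * INR n + PI - X) / ((PI * INR n + PI - X) ^ 2 + Y ^ 2)) (cotRe X Y)
  /\ forall n, Rabs ((PI * INR n + X) / ((PI * INR n + X) ^ 2 + Y ^ 2)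
    - (PI * INR n + PI - X) / ((PI * INR n + PI - X) ^ 2 + Y ^ 2)) <=
     9 * PI / Rmin X (PI - X) ^ 2 * / (INR n + 1) ^ 2.
Proof.
  intros HX HY.
  set (m0 := Rmin X (PI - X)).
  assert (Hm : 0 < m0) by (apply Rmin_pos; lra).
  assert (Hm1 : m0 <= X) by apply Rmin_l. assert (Hm2 : m0 <= PI - X) by apply Rmin_r.
  pose proof PI_4 as P4.
  set (M := fun n => 9 * PI / m0 ^ 2 * / (INR n + 1) ^ 2).
  set (g := fun n => (PI * INR n + X) / ((PI * INR n + X) ^ 2 + Y ^ 2)
    - (PI * INR n + PI - X) / ((PI * INR n + PI - X) ^ 2 + Y ^ 2)).
  set (t := fun n p => / 2 ^ (S p) * (cotRe ((PI * INR n + X) / 2 ^ (S p)) (Y / 2 ^ (S p))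
      + - (1) * cotRe ((PI * INR n + PI - X) / 2 ^ (S p)) (Y / 2 ^ (S p)))).
  assert (Hlim : forall n, is_lim_seq (t n) (g n)).
  { intros n. unfold t, g.
    apply is_lim_seq_ext with (fun p => / 2 ^ (S p) * cotRe ((PI * INR n + X) / 2 ^ (S p)) (Y / 2 ^ (S p))
      - / 2 ^ (S p) * cotRe ((PI * INR n + PI - X) / 2 ^ (S p)) (Y / 2 ^ (S p))); [intros; ring|].
    apply is_lim_seq_minus'; apply cotRe_lim; auto. }
  assert (Hb : forall n p, (n < 2 ^ p)%nat -> Rabs (t n p) <= M n).
  { intros n p Hn. unfold t.
    pose proof (pos_INR n) as Hn0. pose proof (inv_pow2_range n p Hn) as Hr.
    assert (He : 0 < / 2 ^ S p) by (apply Rinv_0_lt_compat, pow_lt; lra).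
    set (e := / 2 ^ S p) in *. unfold Rdiv in *. fold e in Hr |- *.
    set (X1 := PI * INR n + X) in *. set (X2 := PI * INR n + PI - X) in *.
    assert (HX1 : m0 * (INR n + 1) <= X1) by (unfold X1; nra).
    assert (HX2 : m0 * (INR n + 1) <= X2) by (unfold X2; nra).
    assert (HX1' : X1 <= PI * (INR n + 1)) by (unfold X1; nra).
    assert (HX2' : X2 <= PI * (INR n + 1)) by (unfold X2; nra).
    assert (Hpos : 0 < m0 * (INR n + 1)) by nra.
    assert (He2 : PI * (INR n + 1) * e <= 2) by (rewrite Rmult_assoc; nra).
    assert (HS1 : X1 * e / 3 <= sin (X1 * e)) by (apply sin_ge_third; nra).
    assert (HS2 : X2 * e / 3 <= sin (X2 * e)) by (apply sin_ge_third; nra).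
    assert (HY' : 0 < Y * e) by nra.
    assert (HP1 : 0 < X1 * e) by nra. assert (HP2 : 0 < X2 * e) by nra.
    rewrite Rabs_mult, (Rabs_pos_eq e) by lra.
    replace (cotRe (X1 * e) (Y * e) + - (1) * cotRe (X2 * e) (Y * e)) with
       (cotRe (X1 * e) (Y * e) - cotRe (X2 * e) (Y * e)) by ring.
    apply Rle_trans with (e * (PI * e / ((X1 * e / 3) * (X2 * e / 3)))).
    - apply Rmult_le_compat_l; [lra|].
      eapply Rle_trans; [apply cotRe_diff_bound; lra|].
      unfold Rdiv. apply Rmult_le_compat.
      + apply Rabs_pos.
      + left. apply Rinv_0_lt_compat. nra.
      + eapply Rle_trans; [apply Rabs_sin_le|].
        replace (X1 * e - X2 * e) with ((2 * X - PI) * e) by (unfold X1, X2; ring).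
        rewrite Rabs_mult, (Rabs_pos_eq e) by lra. apply Rmult_le_compat_r; [lra|].
        apply Rabs_le; split; lra.
      + apply Rinv_le_contravar; [nra|]. apply Rmult_le_compat; lra.
    - replace (e * (PI * e / ((X1 * e / 3) * (X2 * e / 3)))) with (9 * PI * / (X1 * X2)).
      + unfold M. unfold Rdiv. rewrite (Rmult_assoc (9 * PI)). apply Rmult_le_compat_l; [lra|].
        rewrite <- Rinv_mult. apply Rinv_le_contravar; [nra|].
        replace (m0 ^ 2 * (INR n + 1) ^ 2) with ((m0 * (INR n + 1)) * (m0 * (INR n + 1))) by ring.
        apply Rmult_le_compat; lra.
      + field. repeat split; nra. }
  assert (Hg : forall n, Rabs (g n) <= M n).
  { intros n. pose proof (is_lim_seq_abs _ _ (Hlim n)) as Ha.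
    apply (is_lim_seq_le_loc (fun p => Rabs (t n p)) (fun _ => M n) (Rabs (g n)) (M n)); auto.
    - exists n. intros p Hp. apply Hb. pose proof (Nat.pow_gt_lin_r 2 p ltac:(lia)). lia.
    - apply is_lim_seq_const. }
  split; [|exact Hg].
  apply (doubling_series cotRe (- (1)) ltac:(ring) cotRe_doubling X Y g M); auto.
  unfold M. apply ex_series_scalR, ex_series_inv_sqr.
Qed.

(** The case [X = 0] of the imaginary part. All terms are positive, so the two sample points can be
    bounded separately; the second conclusion permits splitting the sum. *)
Lemma is_series_coth_aux Y : 0 < Y ->
  is_series (fun n => Y / ((PI * INR n) ^ 2 + Y ^ 2) + Y / ((PI * INR n + PI) ^ 2 + Y ^ 2)) (cosh Y / sinh Y)
  /\ ex_series (fun n => Y / ((PI * INR n) ^ 2 + Y ^ 2)).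
Proof.
  intros HY.
  pose proof PI2_3_2 as P3. pose proof PI_4 as P4. assert (HPI : 3 < PI) by (unfold PI2 in P3; lra).
  (* Chosen so that [K * (INR n + 1) ^ 2] lies below [Z ^ 2 / 9 + Y ^ 2]: here (n + 1)^2 <= 2 (1 +
     n^2), the 9 comes from squaring [sin_ge_third], and [3 < PI] gives n^2 <= Z^2 / 9. *)
  set (K := Rmin 1 (Y ^ 2) / 2).
  assert (HK0 : 0 < Rmin 1 (Y ^ 2)) by (apply Rmin_pos; [lra | apply pow_lt; lra]).
  pose proof (Rmin_l 1 (Y ^ 2)) as HK1. pose proof (Rmin_r 1 (Y ^ 2)) as HK2.
  assert (HK : forall n Z, PI * INR n <= Z -> K * (INR n + 1) ^ 2 <= Z ^ 2 / 9 + Y ^ 2).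
  { intros n Z HZ. pose proof (pos_INR n) as Hn. unfold K. set (k := Rmin 1 (Y ^ 2)) in *.
    assert (H3n : (3 * INR n) ^ 2 <= Z ^ 2) by (apply pow_incr; nra).
    assert (INR n ^ 2 <= Z ^ 2 / 9) by lra.
    assert ((INR n + 1) ^ 2 <= 2 * (1 + INR n ^ 2)) by (pose proof (pow2_ge_0 (INR n - 1)); lra).
    assert (k / 2 * (INR n + 1) ^ 2 <= k / 2 * (2 * (1 + INR n ^ 2))) by (apply Rmult_le_compat_l; lra).
    pose proof (pow2_ge_0 (INR n)). assert (k * INR n ^ 2 <= 1 * INR n ^ 2) by (apply Rmult_le_compat_r; lra). lra. }
  assert (HKp : 0 < K) by (unfold K; lra).
  pose proof (exp_pos Y) as HeY.
  set (M := fun n => 2 * (Y * exp Y * exp Y / K) * / (INR n + 1) ^ 2).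
  set (g := fun n => Y / ((PI * INR n) ^ 2 + Y ^ 2) + Y / ((PI * INR n + PI) ^ 2 + Y ^ 2)).
  set (t := fun n p => / 2 ^ (S p) * (cotIm ((PI * INR n + 0) / 2 ^ (S p)) (Y / 2 ^ (S p))
      + 1 * cotIm ((PI * INR n + PI - 0) / 2 ^ (S p)) (Y / 2 ^ (S p)))).
  assert (Hone : forall n p Z, (n < 2 ^ p)%nat -> PI * INR n <= Z <= PI * INR n + PI ->
    0 <= / 2 ^ (S p) * cotIm (Z / 2 ^ (S p)) (Y / 2 ^ (S p)) <= Y * exp Y * exp Y / K * / (INR n + 1) ^ 2).
  { intros n p Z Hn HZ.
    pose proof (pos_INR n) as Hn0. pose proof (inv_pow2_range n p Hn) as Hr.
    assert (He : 0 < / 2 ^ S p) by (apply Rinv_0_lt_compat, pow_lt; lra).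
    assert (He1 : / 2 ^ S p <= 1).
    { rewrite <- Rinv_1. apply Rinv_le_contravar; [lra|]. apply pow_R1_Rle; lra. }
    set (e := / 2 ^ S p) in *. unfold Rdiv in *. fold e in Hr |- *.
    assert (He2 : PI * (INR n + 1) * e <= 2) by (rewrite Rmult_assoc; nra).
    assert (0 <= Z) by nra.
    assert (0 <= Z * e) by (apply Rmult_le_pos; lra).
    assert (Z * e <= PI * (INR n + 1) * e) by (apply Rmult_le_compat_r; lra).
    assert (HS1 : Z * e / 3 <= sin (Z * e)) by (apply sin_ge_third; lra).
    assert (HY' : 0 < Y * e) by nra.
    pose proof (cot_den_pos (Z * e) (Y * e) HY') as HD.
    unfold cotIm. set (s := sinh (Y * e)) in *. set (c := cosh (Y * e)).
    assert (HeYe : exp (Y * e) <= exp Y).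
    { destruct (Req_dec e 1) as [->|]; [rewrite Rmult_1_r; lra|]. left; apply exp_increasing; nra. }
    assert (Hs : Y * e <= s <= Y * e * exp Y).
    { unfold s. pose proof (sinh_MVT (Y * e) ltac:(lra)). split; [lra|]. apply Rle_trans with (Y * e * exp (Y * e)); [lra|]. apply Rmult_le_compat_l; lra. }
    assert (Hc : 1 <= c <= exp Y) by (unfold c; pose proof (cosh_bounds (Y * e) ltac:(lra)); lra).
    assert (Hsc : 0 <= s * c <= Y * e * exp Y * exp Y) by (split; [nra | apply Rmult_le_compat; lra]).
    assert (Hden : e ^ 2 * (K * (INR n + 1) ^ 2) <= s ^ 2 + sin (Z * e) ^ 2).
    { apply Rle_trans with (e ^ 2 * (Z ^ 2 / 9 + Y ^ 2)).
      - apply Rmult_le_compat_l; [nra|]. apply HK; lra.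
      - assert (0 <= Z * e) by nra. nra. }
    assert (Hpd : 0 < e ^ 2 * (K * (INR n + 1) ^ 2)).
    { apply Rmult_lt_0_compat; [nra|]. apply Rmult_lt_0_compat; [lra|]. nra. }
    unfold Rdiv. split.
    - apply Rmult_le_pos; [lra|]. apply Rmult_le_pos; [lra|]. left. apply Rinv_0_lt_compat. lra.
    - apply Rle_trans with (e * (Y * e * exp Y * exp Y * / (e ^ 2 * (K * (INR n + 1) ^ 2)))).
      + apply Rmult_le_compat_l; [lra|]. apply Rmult_le_compat; try lra.
        * left. apply Rinv_0_lt_compat. lra.
        * apply Rinv_le_contravar; lra.
      + apply Req_le. field. repeat split; lra. }
  assert (Hlim1 : forall Z, is_lim_seq (fun p => / 2 ^ (S p) * cotIm (Z / 2 ^ (S p)) (Y / 2 ^ (S p))) (Y / (Z ^ 2 + Y ^ 2)))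
    by (intros Z; apply cotIm_lim; auto).
  assert (Hlim : forall n, is_lim_seq (t n) (g n)).
  { intros n. unfold t, g.
    apply is_lim_seq_ext with (fun p => / 2 ^ (S p) * cotIm ((PI * INR n) / 2 ^ (S p)) (Y / 2 ^ (S p))
      + / 2 ^ (S p) * cotIm ((PI * INR n + PI) / 2 ^ (S p)) (Y / 2 ^ (S p))).
    { intros p. rewrite Rplus_0_r, Rminus_0_r. ring. }
    apply is_lim_seq_plus'; apply Hlim1. }
  assert (Hb : forall n p, (n < 2 ^ p)%nat -> Rabs (t n p) <= M n).
  { intros n p Hn. unfold t, M. rewrite Rplus_0_r, Rminus_0_r, Rmult_1_l, Rmult_plus_distr_l.
    pose proof (Hone n p (PI * INR n) Hn ltac:(lra)).
    pose proof (Hone n p (PI * INR n + PI) Hn ltac:(lra)).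
    rewrite Rabs_pos_eq by lra. lra. }
  assert (HM : ex_series M) by (unfold M; apply ex_series_scalR, ex_series_inv_sqr).
  assert (Hg : forall n, Rabs (g n) <= M n).
  { intros n. pose proof (is_lim_seq_abs _ _ (Hlim n)) as Ha.
    apply (is_lim_seq_le_loc (fun p => Rabs (t n p)) (fun _ => M n) (Rabs (g n)) (M n)); auto.
    - exists n. intros p Hp. apply Hb. pose proof (Nat.pow_gt_lin_r 2 p ltac:(lia)). lia.
    - apply is_lim_seq_const. }
  split.
  - replace (cosh Y / sinh Y) with (cotIm 0 Y).
    + apply (doubling_series cotIm 1 ltac:(ring) cotIm_doubling 0 Y g M); auto.
    + unfold cotIm. rewrite sin_0. pose proof (proj1 (sinh_MVT Y ltac:(lra))). field. lra.
  - apply ex_series_dom with M; auto. intros n.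
    assert (Hq : forall Z, 0 < Y / (Z ^ 2 + Y ^ 2)) by (intros Z; apply Rdiv_lt_0_compat; nra).
    eapply Rle_trans; [|apply Hg]. unfold g.
    pose proof (Hq (PI * INR n)). pose proof (Hq (PI * INR n + PI)).
    rewrite !Rabs_pos_eq; lra.
Qed.

(** In the previous expansion every positive multiple of [PI] occurs twice and 0 occurs once, with
    value [/ Y]. *)
Lemma is_series_coth Y : 0 < Y ->
  is_series (fun n => Y / ((PI * (INR n + 1)) ^ 2 + Y ^ 2)) (/ 2 * (cosh Y / sinh Y - / Y)).
Proof.
  intros HY. destruct (is_series_coth_aux Y HY) as [H1 H2].
  assert (H3 : ex_series (fun n => Y / ((PI * (INR n + 1)) ^ 2 + Y ^ 2))).
  { eapply ex_series_extR; [|exact (proj1 (ex_series_incr_1 (fun n => Y / ((PI * INR n) ^ 2 + Y ^ 2))) H2)].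
    intros n. cbv beta. rewrite S_INR. reflexivity. }
  assert (E1 := Series_incr_1 _ H2). cbv beta in E1. change (INR 0) with 0 in E1.
  apply is_series_unique in H1.
  rewrite (Series_ext _ (fun n => Y / ((PI * INR n) ^ 2 + Y ^ 2) + Y / ((PI * (INR n + 1)) ^ 2 + Y ^ 2))) in H1
   by (intros n; do 3 f_equal; ring).
  rewrite Series_plus in H1 by auto.
  rewrite (Series_ext (fun k => Y / ((PI * INR (S k)) ^ 2 + Y ^ 2)) (fun n => Y / ((PI * (INR n + 1)) ^ 2 + Y ^ 2))) in E1
    by (intros n; rewrite S_INR; reflexivity).
  replace (Y / ((PI * 0) ^ 2 + Y ^ 2)) with (/ Y) in E1 by (field; lra).
  replace (/ 2 * (cosh Y / sinh Y - / Y)) with (Series (fun n => Y / ((PI * (INR n + 1)) ^ 2 + Y ^ 2))) by lra.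
  apply Series_correct, H3.
Qed.

(** * A Lambert series transformation *)

Lemma exp_neg_lt1 w : 0 < w -> exp (- w) < 1.
Proof. intros Hw. rewrite <- exp_0. apply exp_increasing; lra. Qed.

Lemma exp_gt1 w : 0 < w -> 1 < exp w.
Proof. intros Hw. rewrite <- exp_0. apply exp_increasing; lra. Qed.

Lemma exp_le x y : x <= y -> exp x <= exp y.
Proof. intros [h|h]; [left; apply exp_increasing, h | rewrite h; lra]. Qed.

Lemma exp_pow x n : exp x ^ n = exp (INR n * x).
Proof.
  induction n as [|n IH]; [simpl; rewrite Rmult_0_l, exp_0; reflexivity|].
  rewrite S_INR. simpl. rewrite IH, <- exp_plus. f_equal. ring.
Qed.

Lemma is_series_exp_geom w c : 0 < w ->
  is_series (fun n => exp (- w * (INR n + c))) (exp (- w * c) / (1 - exp (- w))).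
Proof.
  intros Hw.
  apply (is_series_extR (fun n => exp (- w * c) * exp (- w) ^ n)).
  - intros n. rewrite exp_pow, <- exp_plus. f_equal. ring.
  - apply (is_series_scal_l (exp (- w * c)) (fun n => exp (- w) ^ n)).
    apply is_series_geom. pose proof (exp_pos (- w)). pose proof (exp_neg_lt1 w Hw).
    rewrite Rabs_pos_eq; lra.
Qed.

Lemma is_series_exp_inv y : 0 < y ->
  is_series (fun n => exp (- y * (INR n + 1))) (/ (exp y - 1)).
Proof.
  intros Hy. replace (/ (exp y - 1)) with (exp (- y * 1) / (1 - exp (- y))).
  - apply is_series_exp_geom; auto.
  - rewrite Rmult_1_r, exp_Ropp. pose proof (exp_gt1 y Hy). field. lra.
Qed.

(** The terms satisfy the linear recurrence of r^j sin (j al) with [r = exp (- v)]; summing it gives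
    a linear equation for the sum. The solution is sin al / (2 (cosh v - cos al)), which is half of
    [cotRe] at the half arguments. *)
Lemma is_series_exp_sin v al : 0 < v ->
  is_series (fun j => exp (- v * (INR j + 1)) * sin ((INR j + 1) * al)) (/ 2 * cotRe (al / 2) (v / 2)).
Proof.
  intros Hv.
  set (a := fun j => exp (- v * (INR j + 1)) * sin ((INR j + 1) * al)).
  assert (Ha : ex_series a).
  { apply ex_series_dom with (fun j => exp (- v * (INR j + 1))).
    - intros j. unfold a. rewrite Rabs_mult, (Rabs_pos_eq (exp _)) by (left; apply exp_pos).
      pose proof (exp_pos (- v * (INR j + 1))).
      assert (Rabs (sin ((INR j + 1) * al)) <= 1) by (apply Rabs_le, SIN_bound). nra.
    - eexists. apply is_series_exp_geom; auto. }
  assert (Ha1 : ex_series (fun j => a (S j))) by (apply ex_series_incr_1 in Ha; exact Ha).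
  assert (Ha2 : ex_series (fun j => a (S (S j)))) by (apply (ex_series_incr_1 (fun j => a (S j))) in Ha1; exact Ha1).
  set (r := exp (- v)).
  assert (Hrec : forall j, a (S (S j)) + r ^ 2 * a j = 2 * r * cos al * a (S j)).
  { intros j. unfold a. rewrite !S_INR.
    replace (exp (- v * (INR j + 1 + 1 + 1))) with (exp (- v * (INR j + 1)) * (r * r)).
    2:{ unfold r. rewrite <- !exp_plus. f_equal. ring. }
    replace (exp (- v * (INR j + 1 + 1))) with (exp (- v * (INR j + 1)) * r).
    2:{ unfold r. rewrite <- !exp_plus. f_equal. ring. }
    replace ((INR j + 1 + 1 + 1) * al) with ((INR j + 1 + 1) * al + al) by ring.
    replace ((INR j + 1) * al) with ((INR j + 1 + 1) * al - al) by ring.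
    rewrite sin_plus, sin_minus. ring. }
  assert (E : Series (fun j => a (S (S j))) + r ^ 2 * Series a = 2 * r * cos al * Series (fun j => a (S j))).
  { rewrite <- !Series_scal_l. rewrite <- Series_plus by (auto; apply ex_series_scalR; auto).
    apply Series_ext, Hrec. }
  pose proof (Series_incr_1 a Ha) as E0. pose proof (Series_incr_1 _ Ha1) as E1. cbv beta in E1.
  assert (A0 : a O = r * sin al).
  { unfold a, r. simpl INR. rewrite Rplus_0_l, Rmult_1_r, Rmult_1_l. reflexivity. }
  assert (A1 : a 1%nat = 2 * r * cos al * a O).
  { rewrite A0. unfold a. simpl INR. replace ((1 + 1) * al) with (2 * al) by ring. rewrite sin_2a.
    replace (- v * (1 + 1)) with (- v + - v) by ring. rewrite exp_plus. fold r. ring. }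
  replace (/ 2 * cotRe (al / 2) (v / 2)) with (Series a); [apply Series_correct; auto|].
  unfold cotRe.
  destruct (cot_doubling_trig al) as (F1 & F2 & F3 & _).
  destruct (sinh_cosh_double v) as (_ & _ & G3).
  pose proof (cot_den_pos (al / 2) (v / 2) ltac:(lra)) as HD.
  apply Rmult_eq_reg_r with (2 * (sinh (v / 2) ^ 2 + sin (al / 2) ^ 2)); [|lra].
  replace (/ 2 * (sin (al / 2) * cos (al / 2) / (sinh (v / 2) ^ 2 + sin (al / 2) ^ 2)) *
   (2 * (sinh (v / 2) ^ 2 + sin (al / 2) ^ 2))) with (sin al * / 2) by (rewrite F1; field; lra).
  assert (Hc : sinh (v / 2) ^ 2 = (cosh v - 1) / 2) by lra.
  assert (Hs : sin (al / 2) ^ 2 = (1 - cos al) / 2) by (rewrite F2, F3; field).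
  rewrite Hc, Hs.
  assert (Hr : exp v * r = 1) by (unfold r; rewrite <- exp_plus, Rplus_opp_r; apply exp_0).
  assert (Hr0 : 0 < r) by apply exp_pos.
  apply Rmult_eq_reg_l with (2 * r); [|lra].
  unfold cosh. fold r.
  replace (2 * r * (Series a * (2 * (((exp v + r) / 2 - 1) / 2 + (1 - cos al) / 2)))) with
    (Series a * (exp v * r + r * r - 2 * r * cos al)) by field.
  rewrite Hr. replace (2 * r * (sin al * / 2)) with (r * sin al) by field. nra.
Qed.

(* In the next three families [k] counts derivatives in [th]. *)
Definition lambertSin (u : R) (k j : nat) (th : R) : R :=
  (2 * PI * (INR j + 1)) ^ k * sin (2 * PI * (INR j + 1) * th + INR k * (PI / 2)) / (exp ((INR j + 1) * u) - 1).
Definition hurwitzTerm (k n : nat) (th : R) : R :=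
  (-1) ^ k * INR (fact k) / (INR n + th) ^ S k - INR (fact k) / (INR n + 1 - th) ^ S k.
Definition lambertExp (w : R) (k d : nat) (th : R) : R :=
  ((- (w * (INR d + 1))) ^ k * exp (- (w * (INR d + 1)) * th)
    - (w * (INR d + 1)) ^ k * exp (- (w * (INR d + 1)) * (1 - th))) / (1 - exp (- (w * (INR d + 1)))).

Lemma Rabs_le1_mult a b : Rabs a <= 1 -> 0 <= b -> Rabs (a * b) <= b.
Proof. intros Ha Hb. rewrite Rabs_mult, (Rabs_pos_eq b) by auto. pose proof (Rabs_pos a). nra. Qed.

Lemma Rabs_sin_le1 x : Rabs (sin x) <= 1.
Proof. apply Rabs_le, SIN_bound. Qed.

(** Each [/ (exp y - 1)] is expanded into a geometric series and the sum over [j] is carried out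
    first. The inequality (j + 1)(m + 1) >= j + m separates the two indices in the majorant. *)
Lemma is_series_lambertSin0 u th : 0 < u ->
  is_series (fun j => lambertSin u 0 j th) (Series (fun m => / 2 * cotRe (PI * th) ((INR m + 1) * u / 2))).
Proof.
  intros Hu.
  set (a := fun j m : nat => sin (2 * PI * (INR j + 1) * th) * exp (- ((INR j + 1) * u) * (INR m + 1))).
  assert (H : is_series (fun j => Series (a j)) (Series (fun m => Series (fun j => a j m)))).
  { apply is_series_fubini with (fun j => exp (- u * (INR j + 0))) (fun m => exp (- u * (INR m + 0))).
    - intros j m. unfold a. eapply Rle_trans; [apply Rabs_le1_mult; [apply Rabs_sin_le1 | left; apply exp_pos]|].
      rewrite <- exp_plus. apply exp_le. pose proof (pos_INR j). pose proof (pos_INR m).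
      assert (0 <= u * (INR j * INR m)) by (apply Rmult_le_pos; [lra | nra]). nra.
    - intros; left; apply exp_pos.
    - intros; left; apply exp_pos.
    - eexists; apply is_series_exp_geom; auto.
    - eexists; apply is_series_exp_geom; auto. }
  rewrite (Series_ext (fun m => Series (fun j => a j m)) (fun m => / 2 * cotRe (PI * th) ((INR m + 1) * u / 2))) in H.
  - revert H. apply is_series_extR. intros j. unfold a, lambertSin.
    rewrite Series_scal_l. simpl INR. rewrite Rmult_0_l, Rplus_0_r. simpl pow. unfold Rdiv.
    rewrite Rmult_1_l. f_equal. pose proof (pos_INR j).
    apply is_series_unique, is_series_exp_inv. apply Rmult_lt_0_compat; lra.
  - intros m. apply is_series_unique. pose proof (pos_INR m).
    assert (Hm : 0 < (INR m + 1) * u) by (apply Rmult_lt_0_compat; lra).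
    pose proof (is_series_exp_sin ((INR m + 1) * u) (2 * PI * th) Hm) as H1.
    replace (2 * PI * th / 2) with (PI * th) in H1 by field.
    revert H1. apply is_series_extR. intros j. unfold a. rewrite Rmult_comm. f_equal; f_equal; ring.
Qed.

(** * The double series over [n] and the multiples of [u] *)

(** The real part of 1/(c + i mu), that is, the conjugate Poisson kernel without its factor 1/PI. Up
    to scaling it is a term of the cot expansion when summed along [c], and of the coth expansion
    when summed along [mu]. *)
Definition conjPoisson (mu c : R) : R := c / (c ^ 2 + mu ^ 2).

Lemma conjPoisson_lim mu : 0 < mu -> is_lim_seq (fun n => conjPoisson mu (INR n)) 0.
Proof.
  intros Hmu. apply is_lim_seq_incr_1.
  apply is_lim_seq_le_le with (fun _ => 0) (fun n => / (INR n + 1)).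
  - intros n. rewrite S_INR. pose proof (pos_INR n). unfold conjPoisson. split.
    + apply Rmult_le_pos; [lra|]. left; apply Rinv_0_lt_compat; nra.
    + set (c := INR n + 1). assert (Hc : 0 < c) by (unfold c; lra).
      assert (Hd : 0 < c ^ 2 + mu ^ 2) by nra.
      apply Rmult_le_reg_r with ((c ^ 2 + mu ^ 2) * c); [apply Rmult_lt_0_compat; lra|].
      replace (c / (c ^ 2 + mu ^ 2) * ((c ^ 2 + mu ^ 2) * c)) with (c ^ 2) by (field; lra).
      replace (/ c * ((c ^ 2 + mu ^ 2) * c)) with (c ^ 2 + mu ^ 2) by (field; lra). nra.
  - apply is_lim_seq_const.
  - apply is_lim_seq_ext with (fun n => Rpower (INR n + 1) (- (1))).
    + intros n. pose proof (pos_INR n). rewrite Rpower_Ropp, Rpower_1; lra.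
    + apply is_lim_seq_Rpower_neg; lra.
Qed.

(** The added multiple of the first difference removes the linear interpolation of the kernel
    between [n] and [n + 1]. What remains vanishes at [th] = 0, 1/2 and 1, which accounts for the
    factors [1 - 2 * th] and [ka] in the exact formula, and it decays fast enough for a bound that
    separates [mu] from [n]. *)
Lemma conjPoisson_diff_bound mu th (n : nat) : 0 < mu -> 0 < th < 1 ->
  Rabs (conjPoisson mu (INR n + th) - conjPoisson mu (INR n + 1 - th) + (1 - 2 * th) * (conjPoisson mu (INR n + 1) - conjPoisson mu (INR n)))
   <= 2 / (mu ^ 2 * (INR n + 1) ^ 2).
Proof.
  intros Hmu Hth.
  (* In these variables the product of the two denominators at [th] and [1 - th] is [Pk], and the
     product of those at [n] and [n + 1] is [P0]. *)
  set (ka := th * (1 - th)). set (N := INR n ^ 2 + INR n). set (m2 := mu ^ 2).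
  assert (Hm2 : 0 < m2) by (unfold m2; nra).
  pose proof (pos_INR n) as Hn.
  assert (Hka : 0 < ka <= / 4) by (unfold ka; pose proof (pow2_ge_0 (th - / 2)); split; nra).
  assert (HN : 0 <= N) by (unfold N; nra).
  (* Integrality of [n] matters: [m2 + N <= P0] can fail for [N] strictly between 0 and 1. *)
  assert (HN2 : N = 0 \/ 1 <= N).
  { destruct n; [left; unfold N; simpl; ring|right]. unfold N. rewrite S_INR. pose proof (pos_INR n). nra. }
  set (P0 := (N + m2) ^ 2 + m2).
  set (Pk := (N + ka) ^ 2 + m2 * (1 + 2 * N - 2 * ka) + m2 ^ 2).
  assert (HP0 : 0 < P0) by (unfold P0; nra).
  assert (HPk : m2 * (INR n + 1) ^ 2 / 2 <= Pk) by (unfold Pk, N; nra).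
  assert (HPk0 : 0 < m2 * (INR n + 1) ^ 2) by (apply Rmult_lt_0_compat; nra).
  assert (E : conjPoisson mu (INR n + th) - conjPoisson mu (INR n + 1 - th) + (1 - 2 * th) * (conjPoisson mu (INR n + 1) - conjPoisson mu (INR n)) =
     (1 - 2 * th) * (ka * (((m2 - N) * (2 * N + ka - 2 * m2) + P0) / P0) / Pk)).
  { assert (EP0 : P0 = ((INR n + 1) ^ 2 + mu ^ 2) * (INR n ^ 2 + mu ^ 2)) by (unfold P0, N, m2; ring).
    assert (EPk : Pk = ((INR n + th) ^ 2 + mu ^ 2) * ((INR n + 1 - th) ^ 2 + mu ^ 2)) by (unfold Pk, N, m2, ka; ring).
    rewrite EPk. unfold conjPoisson, ka, N, m2, P0, N, m2. clear - Hmu Hn. field.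
    assert (Hm : 0 < mu ^ 2) by (apply pow_lt; lra).
    repeat split; apply Rgt_not_eq, Rplus_le_lt_0_compat; auto; apply pow2_ge_0. }
  rewrite E, !Rabs_mult.
  assert (H1 : Rabs (1 - 2 * th) <= 1) by (apply Rabs_le; lra).
  unfold Rdiv at 1. rewrite !Rabs_mult, (Rabs_pos_eq ka), (Rabs_pos_eq (/ Pk)) by (try lra; left; apply Rinv_0_lt_compat; lra).
  (* The constant 4 is afterwards absorbed by [ka <= / 4]. *)
  assert (H2 : Rabs (((m2 - N) * (2 * N + ka - 2 * m2) + P0) / P0) <= 4).
  { unfold Rdiv. rewrite Rabs_mult, (Rabs_pos_eq (/ P0)) by (left; apply Rinv_0_lt_compat; lra).
    apply Rmult_le_reg_r with P0; auto. rewrite Rmult_assoc, Rinv_l, Rmult_1_r by lra.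
    assert (H3 : m2 + N <= P0) by (unfold P0; destruct HN2 as [h|h]; [rewrite h; nra | nra]).
    assert (H4 : 2 * (m2 + N) ^ 2 <= 2 * P0) by (unfold P0; nra).
    assert (- (m2 + N) <= m2 - N <= m2 + N) by lra.
    assert ((m2 - N) ^ 2 <= (m2 + N) ^ 2) by nra.
    assert (ka * (m2 + N) <= m2 + N) by nra.
    assert (- (ka * (m2 + N)) <= ka * (m2 - N) <= ka * (m2 + N)) by nra.
    apply Rabs_le. replace ((m2 - N) * (2 * N + ka - 2 * m2) + P0) with (ka * (m2 - N) - 2 * (m2 - N) ^ 2 + P0) by ring.
    pose proof (pow2_ge_0 (m2 - N)). lra. }
  pose proof (Rabs_pos (1 - 2 * th)).
  set (B := Rabs (_ / P0)) in *. assert (HB : 0 <= B) by apply Rabs_pos.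
  assert (HI : / Pk <= 2 / (m2 * (INR n + 1) ^ 2)).
  { replace (2 / (m2 * (INR n + 1) ^ 2)) with (/ (m2 * (INR n + 1) ^ 2 / 2)) by (field; nra).
    apply Rinv_le_contravar; lra. }
  assert (HI0 : 0 < / Pk) by (apply Rinv_0_lt_compat; lra).
  assert (HkB : 0 <= ka * B <= 1) by nra.
  assert (0 <= ka * B * / Pk <= / Pk) by nra. nra.
Qed.

(* The telescoping part sums to 0; it makes the double series over [n] and the
   multiples [mu] absolutely convergent. Summed over [mu] first it no longer
   vanishes and yields the term [PI / (2 * u) * (1 - 2 * th)] below. *)
Lemma is_series_half_cotRe mu th : 0 < mu -> 0 < th < 1 ->
  is_series (fun n => conjPoisson mu (INR n + th) - conjPoisson mu (INR n + 1 - th) + (1 - 2 * th) * (conjPoisson mu (INR n + 1) - conjPoisson mu (INR n)))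
    (PI * cotRe (PI * th) (PI * mu)).
Proof.
  intros Hmu Hth. pose proof PI_RGT_0 as HPI.
  destruct (is_series_cotRe (PI * th) (PI * mu)) as [H1 _]; [nra | nra |].
  assert (H2 : is_series (fun n => (1 - 2 * th) * (conjPoisson mu (INR n + 1) - conjPoisson mu (INR n))) ((1 - 2 * th) * 0)).
  { apply is_series_scalR.
    pose proof (is_series_telescope _ _ (conjPoisson_lim mu Hmu)) as H.
    apply (is_series_scalR (-1)) in H.
    assert (E0 : -1 * (conjPoisson mu (INR 0) - 0) = 0) by (simpl INR; unfold conjPoisson, Rdiv; ring). rewrite E0 in H.
    revert H. apply is_series_extR. intros n. rewrite S_INR. ring. }
  apply (is_series_scalR PI) in H1.
  pose proof (is_series_plusR _ _ _ _ H1 H2) as H.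
  rewrite Rmult_0_r, Rplus_0_r in H.
  revert H. apply is_series_extR. intros n.
  f_equal. unfold conjPoisson. pose proof (pos_INR n).
  assert (0 < mu ^ 2) by (apply pow_lt; lra).
  assert (Hd : forall Z, (PI * Z) ^ 2 + (PI * mu) ^ 2 <> 0 /\ Z ^ 2 + mu ^ 2 <> 0).
  { intros Z. pose proof (pow2_ge_0 Z). pose proof (pow2_ge_0 (PI * Z)).
    assert (0 < (PI * mu) ^ 2) by (apply pow_lt; nra). split; lra. }
  replace (PI * INR n + PI * th) with (PI * (INR n + th)) by ring.
  replace (PI * INR n + PI - PI * th) with (PI * (INR n + 1 - th)) by ring.
  assert (Hq : forall Z, PI * (PI * Z / ((PI * Z) ^ 2 + (PI * mu) ^ 2)) = Z / (Z ^ 2 + mu ^ 2)).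
  { intros Z. destruct (Hd Z). field. split; auto. }
  rewrite <- !Hq. simpl. ring.
Qed.

Definition conjPoissonSum (u c : R) : R := Series (fun m => conjPoisson ((INR m + 1) * u / (2 * PI)) c).

(** The coth expansion at [Y = 2 * PI ^ 2 * c / u], with coth Y = 1 + 2 / (exp (2 Y) - 1). The
    constant 1 becomes [PI ^ 2 / u], and the term [/ Y] missing from the sum over positive multiples
    becomes [/ (2 * c)]. *)
Lemma is_series_conjPoisson u c : 0 < u -> 0 < c ->
  is_series (fun m => conjPoisson ((INR m + 1) * u / (2 * PI)) c)
    (PI ^ 2 / u + 2 * PI ^ 2 / u * / (exp (4 * PI ^ 2 / u * c) - 1) - / (2 * c)).
Proof.
  intros Hu Hc. pose proof PI_RGT_0 as HPI.
  set (Y := 2 * PI ^ 2 * c / u).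
  assert (HP2 : 0 < PI ^ 2) by (apply pow_lt; lra).
  assert (HY : 0 < Y) by (unfold Y; apply Rdiv_lt_0_compat; [nra | lra]).
  pose proof (is_series_scalR (2 * PI ^ 2 / u) _ _ (is_series_coth Y HY)) as H.
  assert (HS : cosh Y / sinh Y = 1 + 2 * / (exp (4 * PI ^ 2 / u * c) - 1)).
  { pose proof (exp_gt1 Y HY). unfold cosh, sinh. rewrite exp_Ropp.
    replace (4 * PI ^ 2 / u * c) with (Y + Y) by (unfold Y; field; lra). rewrite exp_plus.
    field. split; nra. }
  rewrite HS in H.
  replace (2 * PI ^ 2 / u * (/ 2 * (1 + 2 * / (exp (4 * PI ^ 2 / u * c) - 1) - / Y))) with
   (PI ^ 2 / u + 2 * PI ^ 2 / u * / (exp (4 * PI ^ 2 / u * c) - 1) - / (2 * c)) in H.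
  2:{ assert (0 < 4 * PI ^ 2 / u * c).
      { apply Rmult_lt_0_compat; auto. apply Rdiv_lt_0_compat; auto. apply Rmult_lt_0_compat; [lra | apply pow_lt; lra]. }
      pose proof (exp_gt1 _ H0). unfold Y. simpl in *. field. repeat split; lra. }
  revert H. apply is_series_extR. intros m. unfold conjPoisson, Y.
  pose proof (pos_INR m).
  assert (Hb : 0 < INR m + 1) by lra. set (b := INR m + 1) in *.
  field. repeat split; try lra; apply Rgt_not_eq, Rplus_lt_0_compat; apply pow_lt;
    repeat first [lra | apply Rmult_lt_0_compat].
Qed.

Lemma conjPoissonSum_pos u c : 0 < u -> 0 < c ->
  conjPoissonSum u c = PI ^ 2 / u + 2 * PI ^ 2 / u * / (exp (4 * PI ^ 2 / u * c) - 1) - / (2 * c).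
Proof. intros Hu Hc. apply is_series_unique, is_series_conjPoisson; auto. Qed.

Lemma is_lim_seq_inv_INR : is_lim_seq (fun n => / (INR n + 1)) 0.
Proof.
  apply is_lim_seq_ext with (fun n => Rpower (INR n + 1) (- (1))).
  - intros n. pose proof (pos_INR n). rewrite Rpower_Ropp, Rpower_1; lra.
  - apply is_lim_seq_Rpower_neg; lra.
Qed.

Lemma is_lim_seq_exp_inv w : 0 < w -> is_lim_seq (fun n => / (exp (w * (INR n + 1)) - 1)) 0.
Proof.
  intros Hw.
  apply is_lim_seq_le_le with (fun _ => 0) (fun n => / w * / (INR n + 1)).
  - intros n. pose proof (pos_INR n).
    assert (0 < w * (INR n + 1)) by (apply Rmult_lt_0_compat; lra).
    pose proof (exp_ineq1 (w * (INR n + 1)) ltac:(lra)). split.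
    + left; apply Rinv_0_lt_compat; lra.
    + rewrite <- Rinv_mult. apply Rinv_le_contravar; lra.
  - apply is_lim_seq_const.
  - replace (Finite 0) with (Rbar_mult (/ w) 0) by (simpl; f_equal; ring).
    apply is_lim_seq_scal_l, is_lim_seq_inv_INR.
Qed.

(** Each summand tends to 0 as [c] grows, but not uniformly in the multiple of [u]; the constant
    term of coth survives as the limit. Since the value at [c = 0] is 0, the telescoping sum of
    [conjPoissonSum] equals this limit. *)
Lemma conjPoissonSum_lim u : 0 < u -> is_lim_seq (fun n => conjPoissonSum u (INR n)) (PI ^ 2 / u).
Proof.
  intros Hu. apply is_lim_seq_incr_1.
  set (w := 4 * PI ^ 2 / u).
  assert (Hw : 0 < w).
  { unfold w. pose proof PI_RGT_0. apply Rdiv_lt_0_compat; auto. assert (0 < PI ^ 2) by (apply pow_lt; lra). lra. }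
  apply is_lim_seq_ext with (fun n => PI ^ 2 / u + 2 * PI ^ 2 / u * / (exp (w * (INR n + 1)) - 1) - / 2 * / (INR n + 1)).
  - intros n. pose proof (pos_INR n). rewrite conjPoissonSum_pos by (rewrite ?S_INR; lra).
    rewrite S_INR, Rinv_mult. reflexivity.
  - assert (H1 : is_lim_seq (fun n => 2 * PI ^ 2 / u * / (exp (w * (INR n + 1)) - 1)) (2 * PI ^ 2 / u * 0))
      by (apply (is_lim_seq_scal_l _ _ 0), is_lim_seq_exp_inv, Hw).
    assert (H2 : is_lim_seq (fun n => / 2 * / (INR n + 1)) (/ 2 * 0)) by (apply (is_lim_seq_scal_l _ _ 0), is_lim_seq_inv_INR).
    pose proof (is_lim_seq_minus' _ _ _ _ (is_lim_seq_plus' _ _ _ _ (is_lim_seq_const (PI ^ 2 / u)) H1) H2) as H.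
    rewrite !Rmult_0_r, Rplus_0_r, Rminus_0_r in H. exact H.
Qed.

Lemma conjPoissonSum_0 u : conjPoissonSum u 0 = 0.
Proof.
  unfold conjPoissonSum. rewrite (Series_ext _ (fun m => 0 * 0)).
  - rewrite Series_scal_l. ring.
  - intros m. unfold conjPoisson, Rdiv. ring.
Qed.

Lemma hurwitzTerm0_bound m0 n th : 0 < m0 -> m0 <= th -> m0 <= 1 - th ->
  Rabs (hurwitzTerm 0 n th) <= / m0 ^ 2 * / (INR n + 1) ^ 2.
Proof.
  intros Hm H1 H2. pose proof (pos_INR n). unfold hurwitzTerm.
  replace ((-1) ^ 0 * INR (fact 0) / (INR n + th) ^ 1 - INR (fact 0) / (INR n + 1 - th) ^ 1) with
   ((1 - 2 * th) * / ((INR n + th) * (INR n + 1 - th))) by (simpl; field; lra).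
  assert (m0 * (INR n + 1) <= INR n + th) by nra.
  assert (m0 * (INR n + 1) <= INR n + 1 - th) by nra.
  assert (0 < m0 * (INR n + 1)) by nra.
  assert (0 < (INR n + th) * (INR n + 1 - th)) by (apply Rmult_lt_0_compat; lra).
  eapply Rle_trans; [apply Rabs_le1_mult|].
  - apply Rabs_le; lra.
  - left; apply Rinv_0_lt_compat; auto.
  - rewrite <- Rinv_mult. apply Rinv_le_contravar; [apply Rmult_lt_0_compat; apply pow_lt; lra|].
    replace (m0 ^ 2 * (INR n + 1) ^ 2) with ((m0 * (INR n + 1)) * (m0 * (INR n + 1))) by ring.
    apply Rmult_le_compat; lra.
Qed.

Lemma ex_series_hurwitzTerm0 th : 0 < th < 1 -> ex_series (fun n => hurwitzTerm 0 n th).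
Proof.
  intros Hth. set (m0 := Rmin th (1 - th)).
  assert (Hm : 0 < m0) by (apply Rmin_pos; lra).
  apply ex_series_dom with (fun n => / m0 ^ 2 * / (INR n + 1) ^ 2); [|apply ex_series_scalR, ex_series_inv_sqr].
  intros n. apply hurwitzTerm0_bound; [exact Hm | apply Rmin_l | apply Rmin_r].
Qed.

(** Both sides arise from one absolutely convergent double series of exponentials, summed
    geometrically over [n] or over [d]. The distance [m0] of [th] from the endpoints supplies the
    decay in [d]. *)
Lemma is_series_lambertExp0 w th : 0 < w -> 0 < th < 1 ->
  is_series (fun d => lambertExp w 0 d th)
    (Series (fun n => / (exp (w * (INR n + th)) - 1) - / (exp (w * (INR n + 1 - th)) - 1)))
  /\ ex_series (fun n => / (exp (w * (INR n + th)) - 1) - / (exp (w * (INR n + 1 - th)) - 1)).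
Proof.
  intros Hw Hth.
  set (a := fun d n : nat => exp (- (w * (INR d + 1)) * (INR n + th)) - exp (- (w * (INR d + 1)) * (INR n + (1 - th)))).
  set (m0 := Rmin th (1 - th)).
  assert (Hm : 0 < m0) by (apply Rmin_pos; lra).
  assert (Hm1 : m0 <= th) by apply Rmin_l. assert (Hm2 : m0 <= 1 - th) by apply Rmin_r.
  assert (Hb : forall d n, Rabs (a d n) <= 2 * exp (- (w * m0) * (INR d + 0)) * exp (- w * (INR n + 0))).
  { intros d n. pose proof (pos_INR d). pose proof (pos_INR n). unfold a.
    assert (He : forall c, m0 <= c -> 0 <= exp (- (w * (INR d + 1)) * (INR n + c)) <= exp (- (w * m0) * (INR d + 0)) * exp (- w * (INR n + 0))).
    { intros c Hc. split; [left; apply exp_pos|]. rewrite <- exp_plus. apply exp_le.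
      assert (0 <= INR d * INR n) by nra. assert (INR d * m0 <= INR d * c) by nra.
      assert (w * (INR d * m0 + INR n) <= w * ((INR d + 1) * (INR n + c))) by (apply Rmult_le_compat_l; nra). nra. }
    pose proof (He th Hm1). pose proof (He (1 - th) Hm2). apply Rabs_le. lra. }
  assert (Hb' : forall n d, Rabs (a d n) <= exp (- w * (INR n + 0)) * (2 * exp (- (w * m0) * (INR d + 0)))).
  { intros n d. rewrite Rmult_comm. apply Hb. }
  assert (E1 : ex_series (fun d => 2 * exp (- (w * m0) * (INR d + 0)))).
  { apply ex_series_scalR. eexists. apply is_series_exp_geom. nra. }
  assert (E2 : ex_series (fun n => exp (- w * (INR n + 0)))).
  { eexists. apply is_series_exp_geom. lra. }
  assert (P1 : forall d : nat, 0 <= 2 * exp (- (w * m0) * (INR d + 0))) by (intros; pose proof (exp_pos (- (w * m0) * (INR d + 0))); lra).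
  assert (P2 : forall n : nat, 0 <= exp (- w * (INR n + 0))) by (intros; left; apply exp_pos).
  pose proof (is_series_fubini a _ _ Hb P1 P2 E1 E2) as F1.
  pose proof (ex_series_fubini (fun n d => a d n) _ _ Hb' P2 P1 E2 E1) as F2.
  assert (Hinner : forall n, Series (fun d => a d n) = / (exp (w * (INR n + th)) - 1) - / (exp (w * (INR n + 1 - th)) - 1)).
  { intros n. pose proof (pos_INR n). apply is_series_unique. unfold a.
    apply is_series_extR with (fun d => exp (- (w * (INR n + th)) * (INR d + 1)) - exp (- (w * (INR n + 1 - th)) * (INR d + 1))).
    - intros d. f_equal; f_equal; ring.
    - apply is_series_minusR; apply is_series_exp_inv; apply Rmult_lt_0_compat; lra. }
  split.
  - rewrite (Series_ext _ _ Hinner) in F1. revert F1. apply is_series_extR. intros d. pose proof (pos_INR d).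
    apply is_series_unique. unfold a, lambertExp. simpl pow. rewrite !Rmult_1_l.
    unfold Rdiv. rewrite Rmult_minus_distr_r.
    apply is_series_minusR; apply is_series_exp_geom; nra.
  - revert F2. apply ex_series_extR. exact Hinner.
Qed.

(** When [conjPoissonSum] is evaluated at [INR n + th] and [INR n + 1 - th], the constants
    [PI ^ 2 / u] cancel, the exponential parts give [lambertExp], the parts [/ (2 * c)] give
    [hurwitzTerm], and the correction telescopes. The overall factor is [/ (2 * PI)]. *)
Lemma lambertSin0_transform u th : 0 < u -> 0 < th < 1 ->
  Series (fun j => lambertSin u 0 j th) =
  - / (4 * PI) * Series (fun n => hurwitzTerm 0 n th) + PI / (2 * u) * (1 - 2 * th)
  + PI / u * Series (fun d => lambertExp (4 * PI ^ 2 / u) 0 d th).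
Proof.
  intros Hu Hth. pose proof PI_RGT_0 as HPI.
  set (w := 4 * PI ^ 2 / u).
  assert (Hw : 0 < w).
  { unfold w. apply Rdiv_lt_0_compat; auto. assert (0 < PI ^ 2) by (apply pow_lt; lra). lra. }
  rewrite (is_series_unique _ _ (is_series_lambertSin0 u th Hu)).
  set (mu := fun m : nat => (INR m + 1) * u / (2 * PI)).
  assert (Hmu : forall m, 0 < mu m).
  { intros m. pose proof (pos_INR m). unfold mu. apply Rdiv_lt_0_compat; [apply Rmult_lt_0_compat|]; lra. }
  set (A := fun m n : nat => conjPoisson (mu m) (INR n + th) - conjPoisson (mu m) (INR n + 1 - th) + (1 - 2 * th) * (conjPoisson (mu m) (INR n + 1) - conjPoisson (mu m) (INR n))).
  rewrite (Series_ext _ (fun m => / (2 * PI) * Series (A m))).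
  2:{ intros m. rewrite (is_series_unique (A m) _ (is_series_half_cotRe (mu m) th (Hmu m) Hth)).
      unfold mu. replace ((INR m + 1) * u / 2) with (PI * ((INR m + 1) * u / (2 * PI))) by (field; lra).
      field. lra. }
  rewrite Series_scal_l.
  rewrite (Series_fubini A (fun m => 8 * PI ^ 2 / u ^ 2 * / (INR m + 1) ^ 2) (fun n => / (INR n + 1) ^ 2)).
  2:{ intros m n. eapply Rle_trans; [apply conjPoisson_diff_bound; auto|]. right. unfold mu.
      pose proof (pos_INR m). pose proof (pos_INR n). field. lra. }
  2:{ intros m. pose proof (pos_INR m). apply Rmult_le_pos.
      - left. apply Rdiv_lt_0_compat; [|apply pow_lt; lra]. assert (0 < PI ^ 2) by (apply pow_lt; lra). lra.
      - left. apply Rinv_0_lt_compat, pow_lt; lra. }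
  2:{ intros m. pose proof (pos_INR m). left. apply Rinv_0_lt_compat, pow_lt; lra. }
  2:{ apply ex_series_scalR, ex_series_inv_sqr. }
  2:{ apply ex_series_inv_sqr. }
  assert (Eq : forall c, 0 <= c -> ex_series (fun m => conjPoisson (mu m) c)).
  { intros c Hc. destruct (Req_dec c 0) as [->|Hc0].
    - apply ex_series_extR with (fun _ => 0 * 0); [intros; unfold conjPoisson, Rdiv; ring|].
      apply ex_series_scalR. apply ex_series_extR with (fun n => 0 * / (INR n + 1) ^ 2); [intros; ring|].
      apply ex_series_scalR, ex_series_inv_sqr.
    - eexists. apply is_series_conjPoisson; lra. }
  rewrite (Series_ext _ (fun n => conjPoissonSum u (INR n + th) - conjPoissonSum u (INR n + 1 - th) + (1 - 2 * th) * (conjPoissonSum u (INR n + 1) - conjPoissonSum u (INR n)))).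
  2:{ intros n. pose proof (pos_INR n). apply is_series_unique. unfold A.
      apply is_series_plusR; [|apply is_series_scalR]; apply is_series_minusR; apply Series_correct, Eq; lra. }
  destruct (is_series_lambertExp0 w th Hw Hth) as [G1 G2].
  pose proof (ex_series_hurwitzTerm0 th Hth) as G3.
  assert (G4 : is_series (fun n => (1 - 2 * th) * (conjPoissonSum u (INR n + 1) - conjPoissonSum u (INR n))) ((1 - 2 * th) * (PI ^ 2 / u))).
  { apply is_series_scalR.
    pose proof (is_series_scalR (-1) _ _ (is_series_telescope _ _ (conjPoissonSum_lim u Hu))) as H.
    cbv beta in H. change (INR 0) with 0 in H. rewrite conjPoissonSum_0 in H. replace (PI ^ 2 / u) with (-1 * (0 - PI ^ 2 / u)) by ring.
    revert H. apply is_series_extR. intros n. rewrite S_INR. ring. }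
  pose proof (is_series_plusR _ _ _ _ (is_series_plusR _ _ _ _
    (is_series_scalR (2 * PI ^ 2 / u) _ _ (Series_correct _ G2)) (is_series_scalR (- / 2) _ _ (Series_correct _ G3))) G4) as G.
  rewrite (is_series_unique _ ((2 * PI ^ 2 / u) * Series (fun n => / (exp (w * (INR n + th)) - 1) - / (exp (w * (INR n + 1 - th)) - 1))
     + - / 2 * Series (fun n => hurwitzTerm 0 n th) + (1 - 2 * th) * (PI ^ 2 / u))).
  - rewrite (is_series_unique _ _ G1). field. lra.
  - revert G. apply is_series_extR. intros n. pose proof (pos_INR n). f_equal.
    rewrite !conjPoissonSum_pos by lra. fold w. unfold hurwitzTerm. simpl pow. simpl fact. change (INR 1) with 1.
    assert (K1 : 0 < w * (INR n + th)) by (apply Rmult_lt_0_compat; lra).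
    assert (K2 : 0 < w * (INR n + 1 - th)) by (apply Rmult_lt_0_compat; lra).
    pose proof (exp_gt1 _ K1). pose proof (exp_gt1 _ K2).
    field. repeat split; lra.
Qed.

(** * Termwise differentiation in [th] *)

(** All three families blow up, or may do so, only at the endpoints of (0, 1), so majorants on each
    interval from [m0] to [1 - m0] suffice; [m0] is taken as half the distance of [th] from the
    endpoints. *)
Lemma is_derive_smooth_series (f : nat -> nat -> R -> R) :
  (forall k n th, 0 < th < 1 -> is_derive (f k n) th (f (S k) n th)) ->
  (forall k m0, 0 < m0 -> exists M, ex_series M /\
     forall n th, m0 <= th -> m0 <= 1 - th -> Rabs (f k n th) <= M n) ->
  forall k th, 0 < th < 1 ->
  is_derive (fun y => Series (fun n => f k n y)) th (Series (fun n => f (S k) n th)).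
Proof.
  intros Hd Hb k th Hth.
  set (m0 := Rmin th (1 - th) / 2).
  assert (Hm : 0 < Rmin th (1 - th)) by (apply Rmin_pos; lra).
  pose proof (Rmin_l th (1 - th)) as Hm1. pose proof (Rmin_r th (1 - th)) as Hm2.
  destruct (Hb (S k) m0 ltac:(unfold m0; lra)) as [M [HM HMb]].
  destruct (Hb k m0 ltac:(unfold m0; lra)) as [M' [HM' HMb']].
  apply is_derive_Series with M m0 (1 - m0); auto.
  - unfold m0; lra.
  - intros n y Hy. apply Hd. unfold m0 in Hy; lra.
  - intros n y Hy. apply HMb; lra.
  - intros y Hy. apply ex_series_dom with M'; auto. intros n. apply HMb'; lra.
Qed.

(** The [N]-th power of 1 + x/N <= exp (x/N); for [N = 0] the convention [0 ^ 0 = 1] keeps the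
    constant equal to 1. *)
Lemma pow_le_exp N x : 0 <= x -> x ^ N <= INR N ^ N * exp x.
Proof.
  intros Hx. destruct N as [|N].
  - simpl. rewrite Rmult_1_l. pose proof (exp_ineq1_le x). lra.
  - set (m := INR (S N)). assert (Hm : 0 < m) by (apply lt_0_INR; lia).
    replace (exp x) with (exp (x / m) ^ S N).
    + rewrite <- Rpow_mult_distr. apply pow_incr. split; auto.
      pose proof (exp_ineq1_le (x / m)).
      replace x with (m * (x / m)) at 1 by (field; lra). apply Rmult_le_compat_l; lra.
    + rewrite exp_pow. f_equal. fold m. field. lra.
Qed.

(** [pow_le_exp] with exponent [k + 2]: [k] powers pay for the polynomial factor and two remain for
    summability. *)
Lemma pow_exp_bound k c (j : nat) : 0 < c ->
  (INR j + 1) ^ k * exp (- c * (INR j + 1)) <= INR (k + 2) ^ (k + 2) / c ^ (k + 2) * / (INR j + 1) ^ 2.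
Proof.
  intros Hc. pose proof (pos_INR j). set (b := INR j + 1). assert (Hb : 0 < b) by (unfold b; lra).
  pose proof (pow_le_exp (k + 2) (c * b) ltac:(nra)) as H1. rewrite Rpow_mult_distr in H1.
  set (K := INR (k + 2) ^ (k + 2)) in *.
  assert (0 < c ^ (k + 2)) by (apply pow_lt; lra). assert (0 < b ^ 2) by (apply pow_lt; lra).
  assert (He : exp (c * b) * exp (- c * b) = 1) by (rewrite <- exp_plus; replace (c * b + - c * b) with 0 by ring; apply exp_0).
  pose proof (exp_pos (- c * b)).
  apply Rmult_le_reg_r with (c ^ (k + 2) * b ^ 2); [nra|].
  replace (K / c ^ (k + 2) * / b ^ 2 * (c ^ (k + 2) * b ^ 2)) with (K * (exp (c * b) * exp (- c * b))) by (rewrite He; field; lra).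
  replace (b ^ k * exp (- c * b) * (c ^ (k + 2) * b ^ 2)) with (c ^ (k + 2) * b ^ (k + 2) * exp (- c * b)) by (rewrite (pow_add b); ring).
  nra.
Qed.

Lemma ex_series_pow_exp k c : 0 < c -> ex_series (fun j => (INR j + 1) ^ k * exp (- c * (INR j + 1))).
Proof.
  intros Hc. apply ex_series_dom with (fun j => INR (k + 2) ^ (k + 2) / c ^ (k + 2) * / (INR j + 1) ^ 2).
  - intros j. rewrite Rabs_pos_eq.
    + apply pow_exp_bound; auto.
    + pose proof (pos_INR j). apply Rmult_le_pos; [apply pow_le; lra | left; apply exp_pos].
  - apply ex_series_scalR, ex_series_inv_sqr.
Qed.

Lemma is_derive_lambertSin u k j th : is_derive (lambertSin u k j) th (lambertSin u (S k) j th).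
Proof.
  unfold lambertSin. set (a := 2 * PI * (INR j + 1)). set (D := exp ((INR j + 1) * u) - 1).
  auto_derive; auto. rewrite S_INR.
  replace (a * th + (INR k + 1) * (PI / 2)) with (PI / 2 + (a * th + INR k * (PI / 2))) by field.
  rewrite <- cos_sin. unfold Rdiv. simpl. ring.
Qed.

(** The denominator is at least (1 - exp (-u)) exp ((j + 1) u), with equality at [j = 0]. Here the
    bound is uniform in [th]. *)
Lemma lambertSin_bound u k : 0 < u -> exists M, ex_series M /\
  forall n th, Rabs (lambertSin u k n th) <= M n.
Proof.
  intros Hu. pose proof PI_RGT_0 as HPI.
  exists (fun j => (2 * PI) ^ k / (1 - exp (- u)) * ((INR j + 1) ^ k * exp (- u * (INR j + 1)))).
  split; [apply ex_series_scalR, ex_series_pow_exp; auto|].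
  intros j th. pose proof (pos_INR j). unfold lambertSin.
  pose proof (exp_neg_lt1 u Hu).
  rewrite Rpow_mult_distr.
  assert (H1 : 0 < (INR j + 1) * u) by (apply Rmult_lt_0_compat; lra). pose proof (exp_gt1 _ H1).
  replace ((2 * PI) ^ k * (INR j + 1) ^ k * sin (2 * PI * (INR j + 1) * th + INR k * (PI / 2)) / (exp ((INR j + 1) * u) - 1))
    with (sin (2 * PI * (INR j + 1) * th + INR k * (PI / 2)) * ((2 * PI) ^ k * (INR j + 1) ^ k / (exp ((INR j + 1) * u) - 1)))
    by (field; lra).
  assert (0 <= (2 * PI) ^ k * (INR j + 1) ^ k) by (apply Rmult_le_pos; apply pow_le; lra).
  eapply Rle_trans; [apply Rabs_le1_mult; [apply Rabs_sin_le1|]|].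
  - apply Rmult_le_pos; auto. left; apply Rinv_0_lt_compat; lra.
  - replace ((2 * PI) ^ k / (1 - exp (- u)) * ((INR j + 1) ^ k * exp (- u * (INR j + 1)))) with
     ((2 * PI) ^ k * (INR j + 1) ^ k * (/ (1 - exp (- u)) * exp (- u * (INR j + 1)))) by (field; lra).
    apply Rmult_le_compat_l; auto.
    replace (- u * (INR j + 1)) with (- ((INR j + 1) * u)) by ring. rewrite (exp_Ropp ((INR j + 1) * u)).
    rewrite <- Rinv_mult. pose proof (exp_pos ((INR j + 1) * u)).
    apply Rinv_le_contravar; [apply Rmult_lt_0_compat; lra|].
    assert (exp ((INR j + 1) * u) * exp (- u) >= 1).
    { rewrite <- exp_plus. replace ((INR j + 1) * u + - u) with (INR j * u) by ring.
      pose proof (exp_ineq1_le (INR j * u)). assert (0 <= INR j * u) by nra. lra. }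
    lra.
Qed.

Lemma is_derive_hurwitzTerm k n th : 0 < th < 1 -> is_derive (hurwitzTerm k n) th (hurwitzTerm (S k) n th).
Proof.
  intros Hth. unfold hurwitzTerm. pose proof (pos_INR n).
  assert (0 < INR n + th) by lra. assert (0 < INR n + 1 - th) by lra.
  assert (F1 : INR (fact (S k)) = (INR k + 1) * INR (fact k)) by (rewrite fact_simpl, mult_INR, S_INR; reflexivity).
  auto_derive.
  - split; [apply pow_nonzero with (n := S k); lra | split; [apply pow_nonzero with (n := S k); lra | auto]].
  - rewrite F1. set (f := INR (fact k)). change (INR n + 1 + - th) with (INR n + 1 - th).
    set (b := INR n + th) in *. set (c := INR n + 1 - th) in *.
    replace (match k with O => 1 | S _ => INR k + 1 end) with (INR k + 1) by (destruct k; simpl; lra).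
    assert (b ^ k <> 0) by (apply pow_nonzero; lra). assert (c ^ k <> 0) by (apply pow_nonzero; lra).
    simpl. field. repeat split; auto; lra.
Qed.

(** For [k = 0] only the difference of the two fractions is summable; from [k = 1] on the exponent
    [S k] is at least 2 and each fraction can be bounded by itself. *)
Lemma hurwitzTerm_bound k m0 : 0 < m0 -> exists M, ex_series M /\
  forall n th, m0 <= th -> m0 <= 1 - th -> Rabs (hurwitzTerm k n th) <= M n.
Proof.
  intros Hm. destruct k as [|k].
  - exists (fun n => / m0 ^ 2 * / (INR n + 1) ^ 2). split; [apply ex_series_scalR, ex_series_inv_sqr|].
    intros n th H1 H2. apply hurwitzTerm0_bound; auto.
  - exists (fun n => 2 * INR (fact (S k)) / m0 ^ (S (S k)) * / (INR n + 1) ^ 2).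
    split; [apply ex_series_scalR, ex_series_inv_sqr|].
    intros n th H1 H2. pose proof (pos_INR n). unfold hurwitzTerm.
    set (f := INR (fact (S k))). assert (Hf : 0 < f) by (apply INR_fact_lt_0).
    assert (HH : forall c, m0 * (INR n + 1) <= c -> 0 <= f / c ^ S (S k) <= f / m0 ^ S (S k) * / (INR n + 1) ^ 2).
    { intros c Hc. assert (0 < m0 * (INR n + 1)) by nra.
      assert (0 < c ^ S (S k)) by (apply pow_lt; lra).
      split; [apply Rmult_le_pos; [lra | left; apply Rinv_0_lt_compat; auto]|].
      unfold Rdiv. rewrite Rmult_assoc, <- Rinv_mult. apply Rmult_le_compat_l; [lra|].
      apply Rinv_le_contravar; [apply Rmult_lt_0_compat; apply pow_lt; lra|].
      apply Rle_trans with ((m0 * (INR n + 1)) ^ S (S k)); [|apply pow_incr; lra].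
      rewrite Rpow_mult_distr. apply Rmult_le_compat_l; [apply pow_le; lra|].
      apply Rle_pow; [lra | lia]. }
    pose proof (HH (INR n + th) ltac:(nra)). pose proof (HH (INR n + 1 - th) ltac:(nra)).
    assert (Hs : Rabs ((-1) ^ S k) = 1) by apply pow_1_abs.
    assert (Hs' : -1 <= (-1) ^ S k <= 1) by (apply Rabs_le_between; lra).
    replace ((-1) ^ S k * f / (INR n + th) ^ S (S k)) with ((-1) ^ S k * (f / (INR n + th) ^ S (S k))) by (unfold Rdiv; ring).
    set (A := f / (INR n + th) ^ S (S k)) in *. set (B := f / (INR n + 1 - th) ^ S (S k)) in *.
    replace (2 * f / m0 ^ S (S k) * / (INR n + 1) ^ 2) with (2 * (f / m0 ^ S (S k) * / (INR n + 1) ^ 2)) by (unfold Rdiv; ring).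
    set (s := (-1) ^ S k) in *. apply Rabs_le. nra.
Qed.

Lemma is_derive_lambertExp w k d th : is_derive (lambertExp w k d) th (lambertExp w (S k) d th).
Proof.
  unfold lambertExp. set (b := w * (INR d + 1)). set (D := 1 - exp (- b)).
  auto_derive; auto. change (1 + - th) with (1 - th). unfold Rdiv. simpl. ring.
Qed.

Lemma lambertExp_bound w k m0 : 0 < w -> 0 < m0 -> exists M, ex_series M /\
  forall n th, m0 <= th -> m0 <= 1 - th -> Rabs (lambertExp w k n th) <= M n.
Proof.
  intros Hw Hm.
  exists (fun d => 2 * w ^ k / (1 - exp (- w)) * ((INR d + 1) ^ k * exp (- (w * m0) * (INR d + 1)))).
  split; [apply ex_series_scalR, ex_series_pow_exp; nra|].
  intros d th H1 H2. pose proof (pos_INR d). unfold lambertExp.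
  pose proof (exp_neg_lt1 w Hw).
  assert (Hb : w <= w * (INR d + 1)) by nra.
  assert (exp (- (w * (INR d + 1))) <= exp (- w)) by (apply exp_le; lra).
  assert (He : forall c, m0 <= c -> 0 <= exp (- (w * (INR d + 1)) * c) <= exp (- (w * m0) * (INR d + 1))).
  { intros c Hc. split; [left; apply exp_pos|]. apply exp_le. nra. }
  pose proof (He th H1) as E1. pose proof (He (1 - th) H2) as E2.
  rewrite <- (Rmult_1_l (w * (INR d + 1))) at 1. rewrite Ropp_mult_distr_l.
  rewrite (Rpow_mult_distr (- (1))). rewrite (Rpow_mult_distr w).
  set (s := (- (1)) ^ k). set (P := w ^ k). set (Q := (INR d + 1) ^ k).
  assert (Hs' : -1 <= s <= 1) by (apply Rabs_le_between; right; apply pow_1_abs).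
  assert (HP : 0 <= P) by (apply pow_le; lra). assert (HQ : 0 <= Q) by (apply pow_le; lra).
  assert (HPQ : 0 <= P * Q) by nra.
  set (e1 := exp (- (w * (INR d + 1)) * th)) in *. set (e2 := exp (- (w * (INR d + 1)) * (1 - th))) in *.
  set (E := exp (- (w * m0) * (INR d + 1))) in *.
  set (D := 1 - exp (- (w * (INR d + 1)))) in *. set (D' := 1 - exp (- w)) in *.
  replace ((s * (P * Q) * e1 - P * Q * e2) / D) with (P * Q * (s * e1 - e2) * / D) by (unfold Rdiv; ring).
  rewrite Rabs_mult, (Rabs_pos_eq (/ D)) by (left; apply Rinv_0_lt_compat; unfold D, D' in *; lra).
  replace (2 * P / D' * (Q * E)) with (P * Q * (2 * E) * / D') by (unfold Rdiv; ring).
  apply Rmult_le_compat.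
  - apply Rabs_pos.
  - left; apply Rinv_0_lt_compat; unfold D, D' in *; lra.
  - rewrite Rabs_mult, (Rabs_pos_eq (P * Q)) by auto. apply Rmult_le_compat_l; auto. apply Rabs_le. nra.
  - apply Rinv_le_contravar; unfold D, D' in *; lra.
Qed.

(** The [k]-th derivative of [1 - 2 * th]. It vanishes for [k >= 2], so among even [k] only [k = 0]
    keeps this term. *)
Definition linTerm (k : nat) (th : R) : R :=
  match k with O => 1 - 2 * th | 1%nat => -2 | _ => 0 end.

(** Induction on [k]: the identity holds for all [th] in the open interval, so both sides agree near
    each point and may be differentiated there. This is why [th] is quantified after the induction
    variable. *)
Lemma lambertSin_transform u k : 0 < u -> forall th, 0 < th < 1 ->
  Series (fun j => lambertSin u k j th) =
  - / (4 * PI) * Series (fun n => hurwitzTerm k n th) + PI / (2 * u) * linTerm k th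
  + PI / u * Series (fun d => lambertExp (4 * PI ^ 2 / u) k d th).
Proof.
  intros Hu. pose proof PI_RGT_0 as HPI.
  set (w := 4 * PI ^ 2 / u).
  assert (Hw : 0 < w).
  { unfold w. apply Rdiv_lt_0_compat; auto. assert (0 < PI ^ 2) by (apply pow_lt; lra). lra. }
  induction k as [|k IH]; intros th Hth; [apply lambertSin0_transform; auto|].
  assert (DL : is_derive (fun y => Series (fun j => lambertSin u k j y)) th (Series (fun j => lambertSin u (S k) j th))).
  { apply (is_derive_smooth_series (lambertSin u)); auto.
    - intros; apply is_derive_lambertSin.
    - intros k' m0 _. destruct (lambertSin_bound u k' Hu) as [M [H1 H2]]. exists M; split; auto. }
  assert (DZ : is_derive (fun y => Series (fun j => hurwitzTerm k j y)) th (Series (fun j => hurwitzTerm (S k) j th))).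
  { apply (is_derive_smooth_series hurwitzTerm); auto.
    - intros; apply is_derive_hurwitzTerm; auto.
    - intros; apply hurwitzTerm_bound; auto. }
  assert (DG : is_derive (fun y => Series (fun j => lambertExp w k j y)) th (Series (fun j => lambertExp w (S k) j th))).
  { apply (is_derive_smooth_series (lambertExp w)); auto.
    - intros; apply is_derive_lambertExp; auto.
    - intros; apply lambertExp_bound; auto. }
  assert (DX : is_derive (linTerm k) th (linTerm (S k) th)).
  { destruct k as [|[|k]]; unfold linTerm; auto_derive; auto; ring. }
  assert (DR : is_derive (fun y => - / (4 * PI) * Series (fun n => hurwitzTerm k n y) + PI / (2 * u) * linTerm k y
     + PI / u * Series (fun d => lambertExp w k d y)) th
   (- / (4 * PI) * Series (fun n => hurwitzTerm (S k) n th) + PI / (2 * u) * linTerm (S k) th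
     + PI / u * Series (fun d => lambertExp w (S k) d th))).
  { apply (is_derive_plus (fun y => - / (4 * PI) * Series (fun n => hurwitzTerm k n y) + PI / (2 * u) * linTerm k y)
      (fun y => PI / u * Series (fun d => lambertExp w k d y))).
    apply (is_derive_plus (fun y => - / (4 * PI) * Series (fun n => hurwitzTerm k n y)) (fun y => PI / (2 * u) * linTerm k y)).
    - apply is_derive_scal, DZ.
    - apply is_derive_scal, DX.
    - apply is_derive_scal, DG. }
  rewrite <- (is_derive_unique _ _ _ DL). symmetry. apply is_derive_unique in DR. rewrite <- DR.
  apply Derive_ext_loc.
  assert (Hr : 0 < Rmin th (1 - th)) by (apply Rmin_pos; lra).
  exists (mkposreal _ Hr). intros y Hy. change (Rabs (y - th) < Rmin th (1 - th)) in Hy.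
  apply Rabs_def2 in Hy. pose proof (Rmin_l th (1 - th)). pose proof (Rmin_r th (1 - th)).
  symmetry. apply IH. lra.
Qed.

(** * Divisor sums and the Hurwitz zeta function *)

(** Divisibility by [S d] is periodic, so dropping the first [S d] terms multiplies the series by
    [r], while these first terms contribute only their last one, again [r]. The sum thus solves S =
    r + r S, and no reindexing over the multiples is needed. *)
Lemma is_series_exp_multiples u d : 0 < u ->
  is_series (fun n => if Nat.eqb (S n mod S d) 0 then exp (- u * (INR n + 1)) else 0) (/ (exp ((INR d + 1) * u) - 1)).
Proof.
  intros Hu. set (a := fun n => if Nat.eqb (S n mod S d) 0 then exp (- u * (INR n + 1)) else 0).
  assert (Ha : ex_series a).
  { apply ex_series_dom with (fun n => exp (- u * (INR n + 1))).
    - intros n. unfold a. pose proof (exp_pos (- u * (INR n + 1))).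
      destruct (Nat.eqb _ _); [rewrite Rabs_pos_eq; lra | rewrite Rabs_R0; lra].
    - eexists. apply is_series_exp_geom, Hu. }
  set (r := exp (- ((INR d + 1) * u))).
  assert (Hr : exp ((INR d + 1) * u) * r = 1) by (unfold r; rewrite <- exp_plus, Rplus_opp_r; apply exp_0).
  assert (Hr0 : 0 < r) by apply exp_pos.
  assert (Hr1 : 1 < exp ((INR d + 1) * u)).
  { apply exp_gt1. pose proof (pos_INR d). apply Rmult_lt_0_compat; lra. }
  pose proof (Series_incr_n a (S d) ltac:(lia) Ha) as E. change (Init.Nat.pred (S d)) with d in E.
  assert (E1 : sum_f_R0 a d = r).
  { change (sum_lt a (S d) = r). rewrite sum_lt_S.
    rewrite (sum_lt_ext _ (fun _ => 0 * 0)).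
    - rewrite sum_lt_scal. unfold a. rewrite Nat.Div0.mod_same, Nat.eqb_refl. rewrite Rmult_0_l, Rplus_0_l.
      unfold r. f_equal. ring.
    - intros n Hn. unfold a. rewrite Nat.mod_small by lia. simpl. ring. }
  assert (E2 : Series (fun k => a (S d + k)%nat) = r * Series a).
  { rewrite <- Series_scal_l. apply Series_ext. intros n. unfold a.
    replace (S (S d + n)) with (S n + 1 * S d)%nat by lia. rewrite Nat.Div0.mod_add.
    destruct (Nat.eqb _ _); [|ring]. unfold r. rewrite <- exp_plus. f_equal.
    rewrite plus_INR, S_INR. ring. }
  rewrite E1, E2 in E.
  replace (/ (exp ((INR d + 1) * u) - 1)) with (Series a); [apply Series_correct, Ha|].
  apply Rmult_eq_reg_r with (exp ((INR d + 1) * u) - 1); [|lra].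
  rewrite Rinv_l by lra.
  set (X := exp ((INR d + 1) * u)) in *.
  assert (E3 : X * Series a = X * r + X * r * Series a) by (rewrite E at 1; ring).
  rewrite Hr in E3. lra.
Qed.

(** Exchange of [n] with its divisors. A divisor does not exceed the number, so half of the
    exponential decay in [n] can be handed over to [d], which separates the majorant. *)
Lemma Series_divsum_sin k th u : 0 < u ->
  Series (fun n => divsum_sin k th (S n) * exp (- u * (INR n + 1))) =
  Series (fun j => (INR j + 1) ^ k * sin (2 * PI * (INR j + 1) * th) / (exp ((INR j + 1) * u) - 1)).
Proof.
  intros Hu.
  set (c := fun d : nat => INR (S d) ^ k * sin (2 * PI * INR (S d) * th)).
  assert (Hc : forall d, Rabs (c d) <= (INR d + 1) ^ k).
  { intros d. unfold c. rewrite <- S_INR, Rmult_comm. apply Rabs_le1_mult; [apply Rabs_sin_le1|].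
    apply pow_le, pos_INR. }
  set (a := fun n d : nat => (if Nat.eqb (S n mod S d) 0 then c d else 0) * exp (- u * (INR n + 1))).
  rewrite (Series_ext _ (fun n => Series (a n))).
  - rewrite (Series_fubini a (fun n => exp (- (u / 2) * (INR n + 1))) (fun d => (INR d + 1) ^ k * exp (- (u / 2) * (INR d + 1)))).
    + apply Series_ext. intros d. apply is_series_unique.
      apply is_series_extR with (fun n => c d * (if Nat.eqb (S n mod S d) 0 then exp (- u * (INR n + 1)) else 0)).
      * intros n. unfold a. destruct (Nat.eqb _ _); ring.
      * rewrite <- S_INR. apply is_series_scalR. rewrite S_INR. apply is_series_exp_multiples, Hu.
    + intros n d. unfold a. rewrite Rabs_mult, (Rabs_pos_eq (exp _)) by (left; apply exp_pos).
      assert (0 <= (INR d + 1) ^ k) by (apply pow_le; pose proof (pos_INR d); lra).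
      pose proof (exp_pos (- (u / 2) * (INR n + 1))). pose proof (exp_pos (- (u / 2) * (INR d + 1))).
      destruct (Nat.eqb_spec (S n mod S d) 0) as [Hm|Hm].
      * assert (Hdn : (d <= n)%nat).
        { destruct (Nat.le_gt_cases d n); auto. rewrite Nat.mod_small in Hm by lia. discriminate. }
        apply le_INR in Hdn.
        apply Rle_trans with ((INR d + 1) ^ k * exp (- u * (INR n + 1))).
        { apply Rmult_le_compat_r; [left; apply exp_pos | apply Hc]. }
        replace (exp (- (u / 2) * (INR n + 1)) * ((INR d + 1) ^ k * exp (- (u / 2) * (INR d + 1))))
         with ((INR d + 1) ^ k * (exp (- (u / 2) * (INR n + 1)) * exp (- (u / 2) * (INR d + 1)))) by ring.
        rewrite <- exp_plus. apply Rmult_le_compat_l; auto. apply exp_le. nra.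
      * rewrite Rabs_R0, Rmult_0_l. apply Rmult_le_pos; [lra|]. apply Rmult_le_pos; lra.
    + intros; left; apply exp_pos.
    + intros d. pose proof (pos_INR d). apply Rmult_le_pos; [apply pow_le; lra | left; apply exp_pos].
    + eexists. apply is_series_exp_geom. lra.
    + apply ex_series_pow_exp. lra.
  - intros n. symmetry. apply is_series_unique. unfold a.
    (* Indices [d] beyond [n] stand for numbers larger than [S n], which do not divide it, so the
       finite divisor sum is the full series over [d]. *)
    apply is_series_extR with (fun d => exp (- u * (INR n + 1)) *
      (if Nat.ltb d (S n) then (if Nat.eqb (S n mod S d) 0 then c d else 0) else 0)).
    + intros d. destruct (Nat.ltb_spec d (S n)) as [H|H]; [ring|].
      rewrite Nat.mod_small by lia. simpl. ring.
    + rewrite (Rmult_comm (divsum_sin k th (S n))). apply is_series_scalR.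
      apply (is_series_finite (fun d => if Nat.eqb (S n mod S d) 0 then c d else 0) (S n)).
Qed.

Lemma divsum_sin_bound k th n : Rabs (divsum_sin k th (S n)) <= (INR n + 1) ^ (k + 1).
Proof.
  unfold divsum_sin. change (Init.Nat.pred (S n)) with n.
  eapply Rle_trans; [apply Rsum_abs|].
  apply Rle_trans with (sum_f_R0 (fun _ => (INR n + 1) ^ k) n).
  - apply sum_Rle. intros d Hd. destruct (Nat.eqb _ _).
    + rewrite Rmult_comm. eapply Rle_trans; [apply Rabs_le1_mult; [apply Rabs_sin_le1|apply pow_le, pos_INR]|].
      apply pow_incr. split; [apply pos_INR|]. rewrite S_INR. apply le_INR in Hd. lra.
    + rewrite Rabs_R0. apply pow_le. pose proof (pos_INR n); lra.
  - rewrite sum_cte, S_INR, pow_add. simpl. lra.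
Qed.

(** * Values of the Hurwitz zeta function *)

(** For [s > 1] both Euler-Maclaurin correction terms are negative powers of [INR N + al] and vanish
    in the limit. *)
Lemma HurwitzZeta_gt1 s al : 1 < s -> 0 < al ->
  HurwitzZeta s al = Series (fun n => Rpower (INR n + al) (- s)).
Proof.
  intros Hs Hal. unfold HurwitzZeta.
  assert (H1 : is_lim_seq (sum_lt (fun n => Rpower (INR n + al) (- s))) (Series (fun n => Rpower (INR n + al) (- s)))).
  { apply is_lim_seq_incr_1. pose proof (Series_correct _ (ex_series_Rpower s al Hs Hal)) as H.
    revert H. apply filterlim_ext. intros n. rewrite sum_n_Reals. reflexivity. }
  assert (H2 : is_lim_seq (fun N => Rpower (INR N + al) (1 - s) / (s - 1)) 0).
  { apply is_lim_seq_ext with (fun N => / (s - 1) * Rpower (INR N + al) (- (s - 1))).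
    - intros n. replace (- (s - 1)) with (1 - s) by ring. unfold Rdiv. ring.
    - replace (Finite 0) with (Rbar_mult (/ (s - 1)) 0) by (simpl; f_equal; ring).
      apply is_lim_seq_scal_l, is_lim_seq_Rpower_neg. lra. }
  assert (H3 : is_lim_seq (fun N => Rpower (INR N + al) (- s) / 2) 0).
  { apply is_lim_seq_ext with (fun N => / 2 * Rpower (INR N + al) (- s)).
    - intros n. unfold Rdiv. ring.
    - replace (Finite 0) with (Rbar_mult (/ 2) 0) by (simpl; f_equal; ring).
      apply is_lim_seq_scal_l, is_lim_seq_Rpower_neg. lra. }
  pose proof (is_lim_seq_plus' _ _ _ _ (is_lim_seq_plus' _ _ _ _ H1 H2) H3) as H.
  rewrite !Rplus_0_r in H. apply is_lim_seq_unique in H. rewrite H. reflexivity.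
Qed.

(** At [s = 0] the Euler-Maclaurin expression is N - (N + al) + 1/2, constant in [N]. *)
Lemma HurwitzZeta_0 al : 0 < al -> HurwitzZeta 0 al = / 2 - al.
Proof.
  intros Hal. unfold HurwitzZeta.
  rewrite (Lim_seq_ext _ (fun _ => / 2 - al)); [rewrite Lim_seq_const; reflexivity|].
  intros N. pose proof (pos_INR N).
  rewrite (sum_lt_ext _ (fun _ => 1)).
  - rewrite Ropp_0, Rminus_0_r, Rpower_1, Rpower_O by lra.
    replace (sum_lt (fun _ => 1) N) with (INR N); [field|].
    clear. induction N as [|N IH]; [reflexivity|]. rewrite sum_lt_S, S_INR, IH. reflexivity.
  - intros n _. pose proof (pos_INR n). rewrite Ropp_0, Rpower_O; lra.
Qed.

Lemma Rpower_neg_nat x k : 0 < x -> Rpower x (- (1 + INR k)) = / x ^ S k.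
Proof.
  intros Hx. rewrite Rpower_Ropp. f_equal. rewrite Rplus_comm, <- S_INR. apply Rpower_pow, Hx.
Qed.

(** The bound is uniform for [s] down to 1, where the two zeta series diverge separately. By
    monotonicity the gap is at most its value over the whole unit interval, b^(-s) (1 - ((b +
    1)/b)^(-s)); the first factor is largest at [s = 1] and the second at [s = 2]. *)
Lemma Rpower_unit_gap_bound x y s (n : nat) : 1 <= s <= 2 ->
  INR n + 1 <= x <= INR n + 2 -> INR n + 1 <= y <= INR n + 2 ->
  Rabs (Rpower x (- s) - Rpower y (- s)) <= 2 * / (INR n + 1) ^ 2.
Proof.
  intros Hs Hx Hy. pose proof (pos_INR n). set (b := INR n + 1) in *.
  replace (INR n + 2) with (b + 1) in * by (unfold b; ring).
  assert (Hb : 1 <= b) by (unfold b; lra).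
  assert (B : forall z, b <= z <= b + 1 -> Rpower (b + 1) (- s) <= Rpower z (- s) <= Rpower b (- s)).
  { intros z Hz. split; apply Rpower_le_neg; lra. }
  pose proof (B x Hx). pose proof (B y Hy).
  apply Rle_trans with (Rpower b (- s) - Rpower (b + 1) (- s)); [apply Rabs_le; lra|].
  assert (E : Rpower (b + 1) (- s) = Rpower b (- s) * Rpower ((b + 1) / b) (- s)).
  { rewrite Rpower_mult_distr; [f_equal; field; lra | lra | apply Rdiv_lt_0_compat; lra]. }
  assert (G1 : Rpower ((b + 1) / b) (- (2)) <= Rpower ((b + 1) / b) (- s)).
  { apply Rle_Rpower; [|lra]. apply Rmult_le_reg_r with b; [lra|]. unfold Rdiv. rewrite Rmult_assoc, Rinv_l; lra. }
  assert (G2 : Rpower ((b + 1) / b) (- (2)) = / ((b + 1) / b) ^ 2).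
  { replace 2 with (1 + INR 1) by (simpl; ring). apply Rpower_neg_nat. apply Rdiv_lt_0_compat; lra. }
  assert (G3 : Rpower b (- s) <= / b).
  { replace (/ b) with (Rpower b (- (1))) by (rewrite Rpower_Ropp, Rpower_1; lra). apply Rle_Rpower; lra. }
  pose proof (Rpower_pos b (- s)).
  rewrite E.
  apply Rle_trans with (/ b * (1 - / ((b + 1) / b) ^ 2)).
  - replace (Rpower b (- s) - Rpower b (- s) * Rpower ((b + 1) / b) (- s)) with
      (Rpower b (- s) * (1 - Rpower ((b + 1) / b) (- s))) by ring.
    rewrite G2 in G1.
    assert (/ ((b + 1) / b) ^ 2 <= 1).
    { rewrite <- Rinv_1. apply Rinv_le_contravar; [lra|]. apply pow_R1_Rle.
      apply Rmult_le_reg_r with b; [lra|]. unfold Rdiv. rewrite Rmult_assoc, Rinv_l; lra. }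
    apply Rle_trans with (Rpower b (- s) * (1 - / ((b + 1) / b) ^ 2)).
    + apply Rmult_le_compat_l; lra.
    + apply Rmult_le_compat_r; lra.
  - replace (/ b * (1 - / ((b + 1) / b) ^ 2)) with ((2 * b + 1) / (b * (b + 1) ^ 2)) by (field; lra).
    apply Rmult_le_reg_r with (b ^ 2 * (b + 1) ^ 2); [apply Rmult_lt_0_compat; apply pow_lt; lra|].
    replace ((2 * b + 1) / (b * (b + 1) ^ 2) * (b ^ 2 * (b + 1) ^ 2)) with ((2 * b + 1) * b) by (field; lra).
    replace (2 * / b ^ 2 * (b ^ 2 * (b + 1) ^ 2)) with (2 * (b + 1) ^ 2) by (field; lra). nra.
Qed.

(** Evenness makes the sign [(-1) ^ k] equal to 1, so the termwise difference matches the difference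
    of zeta values. For [k = 0] the limit [s -> 1] is taken inside the paired series. *)
Lemma Series_hurwitzTerm_even k th : 0 < th < 1 -> Nat.Even k ->
  Series (fun n => hurwitzTerm k n th) = INR (fact k) * HurwitzDiff k th.
Proof.
  intros Hth [r Hr].
  assert (Hsgn : (-1) ^ k = 1) by (rewrite Hr, pow_mult; replace ((-1) ^ 2) with 1 by ring; apply pow1).
  destruct k as [|k].
  - rewrite Rmult_1_l. unfold HurwitzDiff, Lim. simpl Rbar_loc_seq.
    (* [Lim] at a finite point is defined as the limit along this very sequence, so only exponents
       in the interval from 1 to 2 enter. *)
    set (s := fun n : nat => 1 + / (INR n + 1)).
    assert (Hs : forall n, 1 < s n <= 2).
    { intros n. unfold s. pose proof (pos_INR n).
      assert (0 < / (INR n + 1)) by (apply Rinv_0_lt_compat; lra).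
      assert (/ (INR n + 1) <= / 1) by (apply Rinv_le_contravar; lra). lra. }
    rewrite (Lim_seq_ext _ (fun n => Series (fun m => Rpower (INR m + th) (- s n) - Rpower (INR m + (1 - th)) (- s n)))).
    2:{ intros n. destruct (Hs n). change (1 + / (INR n + 1)) with (s n). rewrite !HurwitzZeta_gt1 by lra.
        rewrite Series_minus; auto; apply ex_series_Rpower; lra. }
    assert (HL : is_lim_seq (fun n => Series (fun m => Rpower (INR m + th) (- s n) - Rpower (INR m + (1 - th)) (- s n)))
       (Series (fun m => hurwitzTerm 0 m th))).
    (* The term of index 0 involves [th] and [1 - th] themselves, which may be small, so it has its
       own bound from c^(-s) <= c^(-2); later terms compare two points of one unit interval. *)
    { set (M := fun m => match m with O => / th ^ 2 + / (1 - th) ^ 2 | S m => 2 * / (INR m + 1) ^ 2 end).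
      apply (dominated_series eventually _ _ _ M).
      - intros m. pose proof (pos_INR m).
        assert (Hp : forall c, 0 < c -> is_lim_seq (fun n => Rpower c (- s n)) (/ c)).
        { intros c Hc. replace (/ c) with (Rpower c (- (1))) by (rewrite Rpower_Ropp, Rpower_1; lra).
          unfold Rpower. apply (is_lim_seq_continuous (fun z => exp (- z * ln c)) s 1).
          - apply continuity_pt_filterlim. apply (ex_derive_continuous (fun z => exp (- z * ln c))). auto_derive; auto.
          - unfold s. pose proof (is_lim_seq_plus' _ _ _ _ (is_lim_seq_const 1) is_lim_seq_inv_INR) as HH.
            rewrite Rplus_0_r in HH. exact HH. }
        replace (hurwitzTerm 0 m th) with (/ (INR m + th) - / (INR m + (1 - th))).
        + apply (is_lim_seq_minus' (fun n => Rpower (INR m + th) (- s n))); apply Hp; lra.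
        + unfold hurwitzTerm. simpl. field. lra.
      - apply filter_forall. intros n m. destruct (Hs n). destruct m as [|m].
        + unfold M. simpl INR. rewrite !Rplus_0_l.
          assert (HB : forall c, 0 < c < 1 -> 0 <= Rpower c (- s n) <= / c ^ 2).
          { intros c Hc. split; [left; apply Rpower_pos|].
            replace (c ^ 2) with (Rpower c 2).
            - rewrite Rpower_Ropp. apply Rinv_le_contravar; [apply Rpower_pos|].
              unfold Rpower. apply exp_le. assert (ln c < 0) by (rewrite <- ln_1; apply ln_increasing; lra). nra.
            - change 2 with (INR 2). apply Rpower_pow. lra. }
          pose proof (HB th Hth). pose proof (HB (1 - th) ltac:(lra)). apply Rabs_le. lra.
        + unfold M. pose proof (pos_INR m). apply Rpower_unit_gap_bound; rewrite ?S_INR; lra.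
      - apply (ex_series_incr_1 M). unfold M. apply ex_series_scalR, ex_series_inv_sqr. }
    apply is_lim_seq_unique in HL. rewrite HL. reflexivity.
  - unfold HurwitzDiff.
    assert (H1 : 1 < 1 + INR (S k)) by (assert (0 < INR (S k)) by (apply lt_0_INR; lia); lra).
    rewrite !HurwitzZeta_gt1 by lra.
    rewrite <- Series_minus by (apply ex_series_Rpower; lra).
    rewrite <- Series_scal_l. apply Series_ext. intros n. pose proof (pos_INR n).
    rewrite !Rpower_neg_nat by lra. unfold hurwitzTerm. rewrite Hsgn.
    replace (INR n + (1 - th)) with (INR n + 1 - th) by ring. unfold Rdiv. ring.
Qed.

(** For even [k] the shift by [INR k * (PI / 2)] is only the sign [(-1) ^ (k / 2)], so the
    differentiated identity concerns the original sine sums; dividing by [(2 * PI) ^ k] normalises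
    it. *)
Lemma Series_divsum_sin_transform k th u : Nat.Even k -> 0 < th < 1 -> 0 < u ->
  Series (fun n => divsum_sin k th (S n) * exp (- u * (INR n + 1))) =
  (-1) ^ (Nat.div k 2) / (2 * PI) ^ k * (- / (4 * PI) * (INR (fact k) * HurwitzDiff k th))
  + (if Nat.eqb k 0 then 1 else 0) * (PI / (2 * u) * (1 - 2 * th))
  + (-1) ^ (Nat.div k 2) * (2 * PI / u) ^ k * (PI / u) *
    Series (fun d => (INR d + 1) ^ k * lambertExp (4 * PI ^ 2 / u) 0 d th).
Proof.
  intros Hk Hth Hu. pose proof PI_RGT_0 as HPI.
  rewrite Series_divsum_sin by auto.
  rewrite <- Series_hurwitzTerm_even by auto.
  pose proof (lambertSin_transform u k Hu th Hth) as H.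
  destruct Hk as [r Hr].
  assert (Hd : Nat.div k 2 = r) by (rewrite Hr, Nat.mul_comm; apply Nat.div_mul; lia).
  rewrite Hd. set (sg := (-1) ^ r).
  assert (Hsg : sg * sg = 1).
  { unfold sg. rewrite <- pow_add. replace (r + r)%nat with (2 * r)%nat by lia.
    rewrite pow_mult. replace ((-1) ^ 2) with 1 by ring. apply pow1. }
  assert (Hsin : forall y, sin (y + INR k * (PI / 2)) = sg * sin y).
  { intros y. rewrite Hr, mult_INR. change (INR 2) with 2. replace (2 * INR r * (PI / 2)) with (INR r * PI) by field.
    unfold sg. clear. induction r as [|r IH].
    - simpl. rewrite Rmult_0_l, Rplus_0_r. ring.
    - rewrite S_INR. replace (y + (INR r + 1) * PI) with (y + INR r * PI + PI) by ring.
      rewrite neg_sin, IH. simpl. ring. }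
  assert (HP : 0 < (2 * PI) ^ k) by (apply pow_lt; lra).
  rewrite (Series_ext (fun j => lambertSin u k j th) (fun j => sg * (2 * PI) ^ k *
     ((INR j + 1) ^ k * sin (2 * PI * (INR j + 1) * th) / (exp ((INR j + 1) * u) - 1)))) in H.
  2:{ intros j. unfold lambertSin. rewrite Hsin, Rpow_mult_distr. unfold Rdiv. ring. }
  rewrite Series_scal_l in H. set (L := Series _) in H |- *.
  set (w := 4 * PI ^ 2 / u) in *.
  rewrite (Series_ext (fun d => lambertExp w k d th) (fun d => w ^ k * ((INR d + 1) ^ k * lambertExp w 0 d th))) in H.
  2:{ intros d. unfold lambertExp. replace ((- (w * (INR d + 1))) ^ k) with ((w * (INR d + 1)) ^ k).
      - rewrite Rpow_mult_distr. simpl pow. unfold Rdiv. ring.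
      - rewrite Hr, !pow_mult. f_equal. ring. }
  rewrite Series_scal_l in H. set (G := Series _) in H |- *. set (Z := Series _) in H |- *.
  (* [k = 1] is excluded by parity and [linTerm] is 0 for larger [k]; this is where the indicator of
     [k = 0] appears. *)
  assert (Hlin : sg / (2 * PI) ^ k * (PI / (2 * u) * linTerm k th) = (if Nat.eqb k 0 then 1 else 0) * (PI / (2 * u) * (1 - 2 * th))).
  { destruct k as [|[|k]].
    - assert (r = O) by lia. subst r. simpl. unfold sg. simpl. field. lra.
    - exfalso; lia.
    - simpl. unfold Rdiv; ring. }
  rewrite <- Hlin.
  assert (Hw : (2 * PI / u) ^ k = w ^ k / (2 * PI) ^ k).
  { replace w with (2 * PI / u * (2 * PI)) by (unfold w; field; lra). rewrite Rpow_mult_distr. field. lra. }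
  rewrite Hw.
  replace L with (sg / (2 * PI) ^ k * (sg * (2 * PI) ^ k * L)).
  - rewrite H. unfold Rdiv. ring.
  - replace (sg / (2 * PI) ^ k * (sg * (2 * PI) ^ k * L)) with (sg * sg * L) by (field; lra). rewrite Hsg. ring.
Qed.

(** * Improper integrals *)

(** The relational form of the integrals inside [CInt0inf], with the two bounds tending to their
    limits independently. Unlike the total function [RInt_gen], it carries convergence. *)
Definition has_int (f : R -> R) (l : R) : Prop :=
  is_RInt_gen f (at_right 0) (Rbar_locally p_infty) l.
Definition cont_pos (f : R -> R) : Prop := forall t, 0 < t -> continuous f t.

#[local] Instance F0inf_proper : ProperFilter (filter_prod (at_right 0) (Rbar_locally p_infty)).
Proof. apply filter_prod_proper. Qed.

Lemma at_right_0 p : 0 < p -> at_right 0 (fun a => 0 < a <= p).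
Proof.
  intros Hp. exists (mkposreal _ Hp). intros a Ha Ha0. change (Rabs (a - 0) < p) in Ha.
  apply Rabs_def2 in Ha. lra.
Qed.

Lemma F0inf_intro (P : R * R -> Prop) p q : 0 < p ->
  (forall a b, 0 < a <= p -> q < b -> P (a, b)) ->
  filter_prod (at_right 0) (Rbar_locally p_infty) P.
Proof.
  intros Hp H. apply (Filter_prod _ _ _ (fun a => 0 < a <= p) (fun b => q < b)).
  - apply at_right_0, Hp.
  - exists q. auto.
  - intros a b Ha Hb. apply H; auto.
Qed.

Lemma F0inf_elim (P : R * R -> Prop) :
  filter_prod (at_right 0) (Rbar_locally p_infty) P ->
  exists p q, 0 < p <= 1 /\ 1 <= q /\ forall a b, 0 < a <= p -> q <= b -> P (a, b).
Proof.
  intros [Q S [d HQ] [M HS] H].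
  assert (Hd := cond_pos d). assert (Hm : 0 < Rmin 1 (d / 2)) by (apply Rmin_pos; lra).
  pose proof (Rmin_l 1 (d / 2)). pose proof (Rmin_r 1 (d / 2)).
  pose proof (Rmax_l 1 (M + 1)). pose proof (Rmax_r 1 (M + 1)).
  exists (Rmin 1 (d / 2)), (Rmax 1 (M + 1)). repeat split; try lra.
  intros a b Ha Hb. apply H.
  - apply HQ; [|lra]. change (Rabs (a - 0) < d). rewrite Rminus_0_r, Rabs_pos_eq; lra.
  - apply HS. lra.
Qed.

Lemma cont_pos_ex_RInt f a b : cont_pos f -> 0 < a -> 0 < b -> ex_RInt f a b.
Proof.
  intros Hf Ha Hb. apply (ex_RInt_continuous (V := R_CompleteNormedModule)).
  intros z Hz. apply Hf. unfold Rmin in Hz. destruct (Rle_dec a b); lra.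
Qed.

(** [is_RInt_gen] is a limit of a relation; continuity makes the proper integral exist between all
    positive bounds, which turns it into the limit of a function of the bounds. *)
Lemma has_int_filterlim f l : cont_pos f ->
  has_int f l <-> filterlim (fun ab => RInt f (fst ab) (snd ab)) (filter_prod (at_right 0) (Rbar_locally p_infty)) (locally l).
Proof.
  intros Hf. split; intros H P HP.
  - specialize (H P HP). unfold filtermapi in H. unfold filtermap. revert H. apply filter_imp.
    intros ab [y [Hy1 Hy2]]. now rewrite (is_RInt_unique _ _ _ _ Hy1).
  - specialize (H P HP). unfold filtermap in H. unfold filtermapi.
    assert (Hpos : filter_prod (at_right 0) (Rbar_locally p_infty) (fun ab => 0 < fst ab /\ 0 < snd ab)).
    { apply (F0inf_intro _ 1 1); [lra|]. intros a b Ha Hb. simpl. lra. }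
    generalize (filter_and _ _ H Hpos). apply filter_imp. intros ab [H1 [H2 H3]].
    exists (RInt f (fst ab) (snd ab)). split; auto.
    apply (RInt_correct (V := R_CompleteNormedModule)), cont_pos_ex_RInt; auto.
Qed.

Lemma has_int_unique f l : has_int f l ->
  RInt_gen f (at_right 0) (Rbar_locally p_infty) = l.
Proof. intros H. exact (is_RInt_gen_unique (V := R_CompleteNormedModule) f l H). Qed.

Lemma has_int_ext f g l : (forall t, 0 < t -> f t = g t) -> has_int f l -> has_int g l.
Proof.
  intros E H. unfold has_int in *. revert H. apply is_RInt_gen_ext.
  apply (F0inf_intro _ 1 1); [lra|]. intros a b Ha Hb x Hx. simpl in Hx. apply E.
  rewrite Rmin_left in Hx by lra. lra.
Qed.

Lemma has_int_plus f g lf lg : has_int f lf -> has_int g lg -> has_int (fun t => f t + g t) (lf + lg).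
Proof. intros Hf Hg. apply (is_RInt_gen_plus f g lf lg Hf Hg). Qed.

Lemma has_int_scal c f l : has_int f l -> has_int (fun t => c * f t) (c * l).
Proof. intros Hf. apply (is_RInt_gen_scal f c l Hf). Qed.

Lemma has_int_minus f g lf lg : has_int f lf -> has_int g lg -> has_int (fun t => f t - g t) (lf - lg).
Proof.
  intros Hf Hg. replace (lf - lg) with (lf + -1 * lg) by ring.
  apply has_int_ext with (fun t => f t + -1 * g t); [intros; ring|].
  apply has_int_plus; auto. apply has_int_scal; auto.
Qed.

Lemma has_int_eps f l : cont_pos f -> has_int f l -> forall eps, 0 < eps ->
  exists p q, 0 < p <= 1 /\ 1 <= q /\ forall a b, 0 < a <= p -> q <= b -> Rabs (RInt f a b - l) < eps.
Proof.
  intros Hf H eps He. apply has_int_filterlim in H; auto.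
  apply (F0inf_elim (fun ab => Rabs (RInt f (fst ab) (snd ab) - l) < eps)). exact (proj1 (filterlim_locally _ _) H (mkposreal _ He)).
Qed.

Lemma eps_has_int f l : cont_pos f ->
  (forall eps, 0 < eps -> exists p q, 0 < p /\ forall a b, 0 < a <= p -> q < b -> Rabs (RInt f a b - l) < eps) ->
  has_int f l.
Proof.
  intros Hf H. apply has_int_filterlim; auto. apply filterlim_locally. intros eps.
  destruct (H eps (cond_pos eps)) as (p & q & Hp & Hpq). apply (F0inf_intro _ p q); auto.
Qed.

Lemma RInt_mono_pos f a p q b : cont_pos f -> (forall t, 0 < t -> 0 <= f t) ->
  0 < a <= p -> p <= q -> q <= b -> RInt f p q <= RInt f a b.
Proof.
  intros Hf H0 Ha Hpq Hb.
  assert (EX : forall x y, 0 < x -> 0 < y -> ex_RInt f x y) by (intros; apply cont_pos_ex_RInt; auto).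
  pose proof (RInt_Chasles (V := R_CompleteNormedModule) f a p q (EX a p ltac:(lra) ltac:(lra)) (EX p q ltac:(lra) ltac:(lra))) as E1.
  pose proof (RInt_Chasles (V := R_CompleteNormedModule) f a q b (EX a q ltac:(lra) ltac:(lra)) (EX q b ltac:(lra) ltac:(lra))) as E2.
  unfold plus in E1, E2; simpl in E1, E2.
  pose proof (RInt_ge_0 f a p ltac:(lra) (EX a p ltac:(lra) ltac:(lra)) ltac:(intros; apply H0; lra)).
  pose proof (RInt_ge_0 f q b ltac:(lra) (EX q b ltac:(lra) ltac:(lra)) ltac:(intros; apply H0; lra)).
  lra.
Qed.

Lemma has_int_pos_bound f I p q : cont_pos f -> (forall t, 0 < t -> 0 <= f t) -> has_int f I ->
  0 < p <= q -> RInt f p q <= I.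
Proof.
  intros Hf H0 HI Hpq. apply Rnot_lt_le. intros Hlt.
  destruct (has_int_eps f I Hf HI (RInt f p q - I) ltac:(lra)) as (p' & q' & Hp' & Hq' & H).
  pose proof (Rmin_l p p'). pose proof (Rmin_r p p'). pose proof (Rmax_l q q'). pose proof (Rmax_r q q').
  assert (0 < Rmin p p') by (apply Rmin_pos; lra).
  specialize (H (Rmin p p') (Rmax q q') ltac:(lra) ltac:(lra)).
  pose proof (RInt_mono_pos f (Rmin p p') p q (Rmax q q') Hf H0 ltac:(lra) ltac:(lra) ltac:(lra)).
  apply Rabs_def2 in H. lra.
Qed.

(** The improper integral is the supremum of the proper ones, which increase as the interval
    grows. *)
Lemma ex_has_int_pos f K : cont_pos f -> (forall t, 0 < t -> 0 <= f t) ->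
  (forall p q, 0 < p <= q -> RInt f p q <= K) -> exists l, has_int f l.
Proof.
  intros Hf H0 HK.
  destruct (completeness (fun y => exists p q, 0 < p <= q /\ y = RInt f p q)) as [l [Hub Hl]].
  - exists K. intros y (p & q & Hpq & ->). auto.
  - exists (RInt f 1 1), 1, 1. split; auto; lra.
  - exists l. apply eps_has_int; auto. intros eps He.
    destruct (Classical_Prop.classic (exists p q, 0 < p <= q /\ l - eps < RInt f p q)) as [(p & q & Hpq & Hlt)|Hn].
    + exists p, q. split; [lra|]. intros a b Ha Hb.
      pose proof (RInt_mono_pos f a p q b Hf H0 ltac:(lra) ltac:(lra) ltac:(lra)).
      assert (RInt f a b <= l) by (apply Hub; exists a, b; split; auto; lra).
      apply Rabs_def1; lra.
    + exfalso. assert (l <= l - eps); [|lra]. apply Hl. intros y (p & q & Hpq & ->).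
      apply Rnot_lt_le. intros Hlt. apply Hn. exists p, q. auto.
Qed.

Lemma cont_pos_plus f g : cont_pos f -> cont_pos g -> cont_pos (fun t => f t + g t).
Proof. intros Hf Hg t Ht. apply (continuous_plus f g); auto. Qed.

Lemma cont_pos_scal c f : cont_pos f -> cont_pos (fun t => c * f t).
Proof. intros Hf t Ht. apply (continuous_scal_r c f); auto. Qed.

Lemma RInt_abs_le_dom f g p q : cont_pos f -> cont_pos g -> (forall t, 0 < t -> Rabs (f t) <= g t) ->
  0 < p <= q -> Rabs (RInt f p q) <= RInt g p q.
Proof.
  intros Hf Hg H Hpq.
  assert (EX : forall x y, 0 < x -> 0 < y -> ex_RInt f x y) by (intros; apply cont_pos_ex_RInt; auto).
  eapply Rle_trans; [apply abs_RInt_le; [lra | apply EX; lra]|].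
  apply RInt_le; [lra | | apply cont_pos_ex_RInt; auto; lra | intros; apply H; lra].
  apply (cont_pos_ex_RInt (fun t => Rabs (f t))); try lra.
  intros t Ht. apply (continuous_comp f Rabs); [apply Hf; auto|]. apply continuous_Rabs.
Qed.

(** [f + g] is nonnegative with proper integrals at most [I + I], hence integrable, and [g] is
    subtracted again. *)
Lemma ex_has_int_dom f g I : cont_pos f -> cont_pos g -> (forall t, 0 < t -> Rabs (f t) <= g t) ->
  has_int g I -> exists l, has_int f l.
Proof.
  intros Hf Hg H HI.
  assert (Hg0 : forall t, 0 < t -> 0 <= g t) by (intros t Ht; eapply Rle_trans; [apply Rabs_pos | apply H, Ht]).
  destruct (ex_has_int_pos (fun t => f t + g t) (I + I)) as [l Hl].
  - apply cont_pos_plus; auto.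
  - intros t Ht. specialize (H t Ht). apply Rabs_le_between in H. lra.
  - intros p q Hpq.
    pose proof (RInt_plus (V := R_CompleteNormedModule) f g p q (cont_pos_ex_RInt f p q Hf ltac:(lra) ltac:(lra)) (cont_pos_ex_RInt g p q Hg ltac:(lra) ltac:(lra))) as E.
    unfold plus in E; simpl in E. change (RInt (fun t => f t + g t) p q = RInt f p q + RInt g p q) in E.
    rewrite E.
    pose proof (RInt_abs_le_dom f g p q Hf Hg H Hpq) as H1. apply Rabs_le_between in H1.
    pose proof (has_int_pos_bound g I p q Hg Hg0 HI Hpq). lra.
  - exists (l - I). apply has_int_ext with (fun t => f t + g t - g t); [intros; ring|].
    apply has_int_minus; auto.
Qed.

Lemma is_RInt_Series (f : nat -> R -> R) (M : nat -> R) a b : a <= b ->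
  (forall n t, a <= t <= b -> continuous (f n) t) ->
  (forall n t, a <= t <= b -> Rabs (f n t) <= M n) -> ex_series M ->
  is_RInt (fun t => Series (fun n => f n t)) a b (Series (fun n => RInt (f n) a b)).
Proof.
  intros Hab Hc Hb HM.
  (* [filterlim_RInt] asks for uniform convergence on the whole line; composing with the projection
     onto the interval provides it without changing the integrals. *)
  set (clip := fun t => Rmax a (Rmin b t)).
  assert (Hclip : forall t, a <= clip t <= b).
  { intros t. unfold clip. split; [apply Rmax_l|]. apply Rmax_lub; auto. apply Rmin_l. }
  assert (Hclip' : forall t, a <= t <= b -> clip t = t).
  { intros t Ht. unfold clip. rewrite Rmin_right, Rmax_right; lra. }
  assert (HI : forall n, is_RInt (fun t => f n (clip t)) a b (RInt (f n) a b)).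
  { intros n. apply (is_RInt_ext (f n)).
    - intros t Ht. rewrite Rmin_left, Rmax_right in Ht by auto. rewrite Hclip' by lra. reflexivity.
    - apply (RInt_correct (V := R_CompleteNormedModule)), (ex_RInt_continuous (V := R_CompleteNormedModule)).
      intros z Hz. rewrite Rmin_left, Rmax_right in Hz by auto. auto. }
  assert (HS : forall N, is_RInt (fun t => sum_f_R0 (fun n => f n (clip t)) N) a b (sum_f_R0 (fun n => RInt (f n) a b) N)).
  { induction N as [|N IH]; simpl; auto.
    apply (is_RInt_plus (V := R_NormedModule) _ _ _ _ _ _ IH (HI (S N))). }
  destruct (filterlim_RInt (V := R_CompleteNormedModule) (fun N t => sum_f_R0 (fun n => f n (clip t)) N) a b eventually eventually_filter
    (fun t => Series (fun n => f n (clip t))) (fun N => sum_f_R0 (fun n => RInt (f n) a b) N) HS) as [If [H1 H2]].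
  - apply filterlim_locally. intros eps.
    destruct (proj1 (filterlim_locally _ _) (Series_tail_lim M HM) eps) as [N HN].
    exists N. intros m Hm t. change (Rabs (sum_f_R0 (fun n => f n (clip t)) m - Series (fun n => f n (clip t))) < eps).
    assert (Hbt : forall n, Rabs (f n (clip t)) <= M n) by (intros; apply Hb; auto).
    rewrite (Series_incr_n (fun n => f n (clip t)) (S m)); [|lia|apply ex_series_dom with M; auto].
    change (Init.Nat.pred (S m)) with m.
    replace (sum_f_R0 (fun n => f n (clip t)) m - (sum_f_R0 (fun n => f n (clip t)) m + Series (fun k => f (S m + k)%nat (clip t))))
      with (- Series (fun k => f (S m + k)%nat (clip t))) by ring.
    rewrite Rabs_Ropp.
    eapply Rle_lt_trans; [apply (Series_tail_bound (fun n => f n (clip t)) M (S m)); auto|].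
    specialize (HN (S m) ltac:(lia)). change (Rabs (Series (fun k => M (S m + k)%nat) - 0) < eps) in HN.
    rewrite Rminus_0_r in HN. apply Rabs_def2 in HN. lra.
  - assert (E : Series (fun n => RInt (f n) a b) = If).
    { apply is_series_unique. unfold is_series. revert H1. apply filterlim_ext. intros N. rewrite sum_n_Reals. reflexivity. }
    rewrite E. revert H2. apply is_RInt_ext. intros t Ht. rewrite Rmin_left, Rmax_right in Ht by auto.
    rewrite Hclip' by lra. reflexivity.
Qed.

Lemma cont_pos_bounded g p q : cont_pos g -> 0 < p <= q -> exists B, forall t, p <= t <= q -> g t <= B.
Proof.
  intros Hg Hpq. destruct (continuity_ab_maj g p q) as [m [Hm _]]; [lra| |].
  - intros c Hc. apply continuity_pt_filterlim. apply Hg. lra.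
  - exists (g m). auto.
Qed.

(** The factor [beta] serves twice: its integral dominates the integrals of the terms over every
    interval, and its local boundedness justifies integrating termwise between fixed bounds. *)
Lemma has_int_Series (f : nat -> R -> R) (c : nat -> R) (beta : R -> R) (J : R) (l : nat -> R) :
  (forall n, cont_pos (f n)) -> cont_pos beta -> has_int beta J -> ex_series c ->
  (forall n, 0 <= c n) -> (forall t, 0 < t -> 0 <= beta t) ->
  (forall n t, 0 < t -> Rabs (f n t) <= c n * beta t) ->
  (forall n, has_int (f n) (l n)) ->
  has_int (fun t => Series (fun n => f n t)) (Series l) /\ ex_series l.
Proof.
  intros Hf Hbc HJ Hc Hc0 Hb0 Hd Hl.
  assert (Hb : forall n p q, 0 < p <= q -> Rabs (RInt (f n) p q) <= c n * J).
  { intros n p q Hpq.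
    eapply Rle_trans; [apply (RInt_abs_le_dom (f n) (fun t => c n * beta t)); auto; apply cont_pos_scal; auto|].
    apply (has_int_pos_bound (fun t => c n * beta t)); auto.
    - apply cont_pos_scal; auto.
    - intros t Ht. apply Rmult_le_pos; auto.
    - apply has_int_scal, HJ. }
  assert (EJ : ex_series (fun n => c n * J)).
  { apply ex_series_extR with (fun n => J * c n); [intros; ring|]. apply ex_series_scalR, Hc. }
  assert (Hpos : filter_prod (at_right 0) (Rbar_locally p_infty) (fun ab => 0 < fst ab <= snd ab)).
  { apply (F0inf_intro _ 1 1); [lra|]. intros a b Ha Hb'. simpl. lra. }
  (* Dominated convergence with the pair of integration bounds as parameter. *)
  assert (HL : filterlim (fun ab => Series (fun n => RInt (f n) (fst ab) (snd ab)))
     (filter_prod (at_right 0) (Rbar_locally p_infty)) (locally (Series l))).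
  { apply dominated_series with (fun n => c n * J); auto.
    - apply F0inf_proper.
    - intros n. apply has_int_filterlim; auto.
    - revert Hpos. apply filter_imp. intros ab Hab n. apply Hb, Hab. }
  split.
  - intros P HP. specialize (HL P HP). unfold filtermap in HL. unfold filtermapi.
    generalize (filter_and _ _ HL Hpos). apply filter_imp. intros ab [H1 H2].
    exists (Series (fun n => RInt (f n) (fst ab) (snd ab))). split; auto.
    destruct (cont_pos_bounded beta (fst ab) (snd ab) Hbc H2) as [B HB].
    apply is_RInt_Series with (fun n => c n * B); [lra | intros n t Ht; apply Hf; lra | |].
    + intros n t Ht. eapply Rle_trans; [apply Hd; lra|]. apply Rmult_le_compat_l; auto.
    + apply ex_series_extR with (fun n => B * c n); [intros; ring|]. apply ex_series_scalR, Hc.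
  - apply ex_series_dom with (fun n => c n * J); auto. intros n.
    apply Rnot_lt_le. intros Hlt.
    destruct (has_int_eps (f n) (l n) (Hf n) (Hl n) (Rabs (l n) - c n * J) ltac:(lra)) as (p & q & Hp & Hq & H).
    specialize (H p q ltac:(lra) ltac:(lra)).
    pose proof (Hb n p q ltac:(lra)). pose proof (Rabs_triang_inv (l n) (RInt (f n) p q)).
    rewrite Rabs_minus_sym in H. lra.
Qed.

Lemma has_int_scale f l c : 0 < c -> cont_pos f -> has_int f l -> has_int (fun t => c * f (c * t)) l.
Proof.
  intros Hc Hf H.
  assert (Hcf : cont_pos (fun t => c * f (c * t))).
  { apply cont_pos_scal. intros t Ht. apply (continuous_comp (fun t => c * t) f).
    - apply (ex_derive_continuous (fun t => c * t)). auto_derive; auto.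
    - apply Hf. nra. }
  apply eps_has_int; auto. intros eps He.
  destruct (has_int_eps f l Hf H eps He) as (p & q & Hp & Hq & Hpq).
  exists (p / c), (q / c). split; [apply Rdiv_lt_0_compat; lra|].
  intros a b Ha Hb.
  replace (RInt (fun t => c * f (c * t)) a b) with (RInt f (c * a) (c * b)).
  - apply Hpq.
    + split; [nra|]. replace p with (c * (p / c)) by (field; lra). apply Rmult_le_compat_l; lra.
    + left. replace q with (c * (q / c)) by (field; lra). apply Rmult_lt_compat_l; lra.
  - symmetry. rewrite <- (Rplus_0_r (c * a)), <- (Rplus_0_r (c * b)).
    assert (0 < b). { assert (0 < q / c) by (apply Rdiv_lt_0_compat; lra). lra. }
    rewrite <- (RInt_comp_lin (V := R_CompleteNormedModule)) by (apply cont_pos_ex_RInt; auto; nra).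
    apply RInt_ext. intros t _. unfold scal; simpl; unfold mult; simpl. now rewrite Rplus_0_r.
Qed.

(* The substitution [t = r * exp s] folds the line onto the half-line [s > 0]. *)
Lemma has_int_exp_fold f l r : 0 < r -> cont_pos f -> has_int f l ->
  has_int (fun s => f (r * exp s) * (r * exp s) + f (r * exp (- s)) * (r * exp (- s))) l.
Proof.
  intros Hr Hf H.
  assert (Hpos : forall s, 0 < r * exp s) by (intros s; pose proof (exp_pos s); nra).
  assert (Dg : forall s, is_derive (fun s => r * exp s) s (r * exp s)) by (intros s; auto_derive; auto; ring).
  assert (Dg' : forall s, is_derive (fun s => r * exp (- s)) s (- (r * exp (- s)))) by (intros s; auto_derive; auto; ring).
  assert (Cg : forall s, continuous (fun s => r * exp s) s) by (intros s; apply (ex_derive_continuous (fun s => r * exp s)); eexists; apply Dg).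
  assert (Cg' : forall s, continuous (fun s => r * exp (- s)) s) by (intros s; apply (ex_derive_continuous (fun s => r * exp (- s))); eexists; apply Dg').
  assert (C1 : forall s, continuous (fun s => f (r * exp s) * (r * exp s)) s).
  { intros s. apply (continuous_mult (fun s => f (r * exp s)) (fun s => r * exp s)); auto.
    apply (continuous_comp (fun s => r * exp s) f); auto. }
  assert (C2 : forall s, continuous (fun s => f (r * exp (- s)) * (r * exp (- s))) s).
  { intros s. apply (continuous_mult (fun s => f (r * exp (- s))) (fun s => r * exp (- s))); auto.
    apply (continuous_comp (fun s => r * exp (- s)) f); auto. }
  assert (I1 : forall p q, RInt (fun s => f (r * exp s) * (r * exp s)) p q = RInt f (r * exp p) (r * exp q)).
  { intros p q. rewrite <- (RInt_comp (V := R_CompleteNormedModule) f (fun s => r * exp s) (fun s => r * exp s)); auto.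
    apply RInt_ext. intros s _. unfold scal; simpl; unfold mult; simpl. ring. }
  assert (I2 : forall p q, RInt (fun s => f (r * exp (- s)) * (r * exp (- s))) p q = - RInt f (r * exp (- p)) (r * exp (- q))).
  { intros p q. rewrite <- (RInt_comp (V := R_CompleteNormedModule) f (fun s => r * exp (- s)) (fun s => - (r * exp (- s)))); auto.
    - rewrite <- (RInt_opp (V := R_CompleteNormedModule)).
      + apply RInt_ext. intros s _. unfold scal, opp; simpl; unfold mult; simpl. ring.
      + apply (ex_RInt_ext (fun s => -1 * (f (r * exp (- s)) * (r * exp (- s))))).
        * intros s _. unfold scal; simpl; unfold mult; simpl. ring.
        * apply (ex_RInt_continuous (V := R_CompleteNormedModule)). intros z _.
          apply (continuous_scal_r (-1) (fun s => f (r * exp (- s)) * (r * exp (- s)))), C2.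
    - intros s _. split; auto. apply (continuous_opp (fun s => r * exp (- s))), Cg'. }
  assert (EX : forall x y, 0 < x -> 0 < y -> ex_RInt f x y) by (intros; apply cont_pos_ex_RInt; auto).
  apply eps_has_int.
  { intros s _. apply (continuous_plus (fun s => f (r * exp s) * (r * exp s))); auto. }
  intros eps He.
  destruct (has_int_eps f l Hf H (eps / 2) ltac:(lra)) as (p & q & Hp & Hq & Hpq).
  (* Starting at [a > 0] instead of 0 omits the part of [f] between [r * exp (- a)] and [r * exp a];
     by continuity it is small when [a] is. *)
  assert (CI : continuous (fun s => RInt f (r * exp (- s)) (r * exp s)) 0).
  { apply (continuous_ext (fun s => RInt f r (r * exp s) - RInt f r (r * exp (- s)))).
    - intros s. pose proof (RInt_Chasles (V := R_CompleteNormedModule) f (r * exp (- s)) r (r * exp s) (EX _ _ (Hpos _) Hr) (EX _ _ Hr (Hpos _))) as E.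
      rewrite <- (opp_RInt_swap (V := R_CompleteNormedModule)) in E by (apply EX; auto).
      unfold plus, opp in E; simpl in E. lra.
    - assert (CR : forall z, 0 < z -> continuous (fun y => RInt f r y) z).
      { intros z Hz. apply (continuous_RInt_1 (V := R_NormedModule) f r z (fun y => RInt f r y)).
        exists (mkposreal _ Hz). intros y Hy. change (Rabs (y - z) < z) in Hy. apply Rabs_def2 in Hy.
        apply (RInt_correct (V := R_CompleteNormedModule)), EX; lra. }
      apply (continuous_minus (fun s => RInt f r (r * exp s)) (fun s => RInt f r (r * exp (- s)))).
      + apply (continuous_comp (fun s => r * exp s) (fun y => RInt f r y)); auto.
      + apply (continuous_comp (fun s => r * exp (- s)) (fun y => RInt f r y)); auto. }
  destruct (proj1 (filterlim_locally _ _) CI (pos_div_2 (mkposreal _ He))) as [d Hd].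
  assert (Hd2 := cond_pos d).
  (* For [b] beyond [Q], [r * exp b] is at least [q] and [r * exp (- b)] is at most [p]. *)
  set (Q := Rmax (ln (q / r)) (- ln (p / r))).
  exists (d / 2), Q. split; [lra|]. intros a b Ha Hb.
  assert (Hqb : q <= r * exp b).
  { replace q with (r * exp (ln (q / r))).
    - apply Rmult_le_compat_l; [lra|]. apply exp_le. pose proof (Rmax_l (ln (q / r)) (- ln (p / r))). unfold Q in Hb. lra.
    - rewrite exp_ln by (apply Rdiv_lt_0_compat; lra). field; lra. }
  assert (Hpb : r * exp (- b) <= p).
  { replace p with (r * exp (ln (p / r))) at 1.
    - apply Rmult_le_compat_l; [lra|]. apply exp_le. pose proof (Rmax_r (ln (q / r)) (- ln (p / r))). unfold Q in Hb. lra.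
    - rewrite exp_ln by (apply Rdiv_lt_0_compat; lra). field; lra. }
  assert (HE : RInt (fun s => f (r * exp s) * (r * exp s) + f (r * exp (- s)) * (r * exp (- s))) a b =
     RInt f (r * exp (- b)) (r * exp b) - RInt f (r * exp (- a)) (r * exp a)).
  { pose proof (RInt_plus (V := R_CompleteNormedModule) (fun s => f (r * exp s) * (r * exp s)) (fun s => f (r * exp (- s)) * (r * exp (- s))) a b
      (ex_RInt_continuous (V := R_CompleteNormedModule) _ _ _ (fun z _ => C1 z))
      (ex_RInt_continuous (V := R_CompleteNormedModule) _ _ _ (fun z _ => C2 z))) as E.
    unfold plus in E; simpl in E. rewrite E, I1, I2.
    pose proof (RInt_Chasles (V := R_CompleteNormedModule) f (r * exp (- b)) (r * exp (- a)) (r * exp b) (EX _ _ (Hpos _) (Hpos _)) (EX _ _ (Hpos _) (Hpos _))) as E1.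
    pose proof (RInt_Chasles (V := R_CompleteNormedModule) f (r * exp (- a)) (r * exp a) (r * exp b) (EX _ _ (Hpos _) (Hpos _)) (EX _ _ (Hpos _) (Hpos _))) as E2.
    rewrite <- (opp_RInt_swap (V := R_CompleteNormedModule) f (r * exp (- a)) (r * exp (- b))) in E1 by (apply EX; auto).
    unfold plus, opp in E1, E2; simpl in E1, E2. lra. }
  rewrite HE.
  specialize (Hpq (r * exp (- b)) (r * exp b) ltac:(split; auto) Hqb).
  assert (Hda : ball 0 d a). { change (Rabs (a - 0) < d). rewrite Rminus_0_r, Rabs_pos_eq; lra. }
  specialize (Hd a Hda).
  change (Rabs (RInt f (r * exp (- a)) (r * exp a) - RInt f (r * exp (- 0)) (r * exp 0)) < eps / 2) in Hd.
  rewrite Ropp_0, RInt_point in Hd. unfold zero in Hd; simpl in Hd. rewrite Rminus_0_r in Hd.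
  apply Rabs_def2 in Hpq. apply Rabs_def2 in Hd. apply Rabs_def1; lra.
Qed.

(** * Gamma and Bessel integrals *)

Definition has_cint (f : R -> C) (l : C) : Prop :=
  has_int (fun t => Re (f t)) (Re l) /\ has_int (fun t => Im (f t)) (Im l).

Lemma C_ext (z w : C) : Re z = Re w -> Im z = Im w -> z = w.
Proof. destruct z, w. simpl. intros -> ->. reflexivity. Qed.

Lemma Re_mult z w : Re (Cmult z w) = Re z * Re w - Im z * Im w.
Proof. reflexivity. Qed.
Lemma Im_mult z w : Im (Cmult z w) = Re z * Im w + Im z * Re w.
Proof. reflexivity. Qed.

Lemma Re_mult_R z r : Re (Cmult z (RtoC r)) = Re z * r.
Proof. rewrite Re_mult. simpl. ring. Qed.
Lemma Im_mult_R z r : Im (Cmult z (RtoC r)) = Im z * r.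
Proof. rewrite Im_mult. simpl. ring. Qed.

Lemma Re_mult_Rl r z : Re (Cmult (RtoC r) z) = r * Re z.
Proof. rewrite Re_mult. simpl. ring. Qed.
Lemma Im_mult_Rl r z : Im (Cmult (RtoC r) z) = r * Im z.
Proof. rewrite Im_mult. simpl. ring. Qed.

Lemma CInt0inf_eq f l : has_cint f l -> CInt0inf f = l.
Proof.
  intros [H1 H2]. unfold CInt0inf. rewrite (has_int_unique _ _ H1), (has_int_unique _ _ H2).
  destruct l; reflexivity.
Qed.

Lemma has_cint_unique f l l' : has_cint f l -> has_cint f l' -> l = l'.
Proof. intros H H'. rewrite <- (CInt0inf_eq _ _ H). apply CInt0inf_eq, H'. Qed.

Lemma has_cint_ext f g l : (forall t, 0 < t -> f t = g t) -> has_cint f l -> has_cint g l.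
Proof.
  intros E [H1 H2]. split; [revert H1 | revert H2]; apply has_int_ext; intros t Ht; rewrite E; auto.
Qed.

Lemma has_cint_plus f g lf lg : has_cint f lf -> has_cint g lg ->
  has_cint (fun t => Cplus (f t) (g t)) (Cplus lf lg).
Proof.
  intros [H1 H2] [H3 H4]. split; simpl.
  - apply (has_int_plus _ _ _ _ H1 H3).
  - apply (has_int_plus _ _ _ _ H2 H4).
Qed.

Lemma has_cint_scal z f l : has_cint f l -> has_cint (fun t => Cmult z (f t)) (Cmult z l).
Proof.
  intros [H1 H2]. split.
  - rewrite Re_mult. apply (has_int_minus (fun t => Re z * Re (f t)) (fun t => Im z * Im (f t))); apply has_int_scal; auto.
  - rewrite Im_mult. apply (has_int_plus (fun t => Re z * Im (f t)) (fun t => Im z * Re (f t))); apply has_int_scal; auto.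
Qed.

Lemma cexp_plus z w : cexp (Cplus z w) = Cmult (cexp z) (cexp w).
Proof.
  unfold cexp. destruct z as [a b], w as [c d]. simpl. rewrite exp_plus, cos_plus, sin_plus.
  apply C_ext; simpl; ring.
Qed.

Lemma cpow_plus b z w : cpow b (Cplus z w) = Cmult (cpow b z) (cpow b w).
Proof. unfold cpow. rewrite <- cexp_plus. f_equal. ring. Qed.

Lemma cpow_mult b c w : 0 < b -> 0 < c -> cpow (b * c) w = Cmult (cpow b w) (cpow c w).
Proof.
  intros Hb Hc. unfold cpow. rewrite <- cexp_plus, ln_mult by auto. f_equal. rewrite RtoC_plus. ring.
Qed.

Lemma cpow_RtoC b r : cpow b (RtoC r) = RtoC (Rpower b r).
Proof.
  unfold cpow, cexp, Rpower. simpl.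
  replace (r * 0 + 0 * ln b) with 0 by ring. replace (r * ln b - 0 * 0) with (r * ln b) by ring.
  rewrite cos_0, sin_0. apply C_ext; simpl; ring.
Qed.

Lemma cpow_0 b : cpow b (RtoC 0) = RtoC 1.
Proof. rewrite cpow_RtoC. unfold Rpower. rewrite Rmult_0_l, exp_0. reflexivity. Qed.

Lemma cpow_opp b w : Cmult (cpow b w) (cpow b (Copp w)) = RtoC 1.
Proof. rewrite <- cpow_plus. replace (Cplus w (Copp w)) with (RtoC 0) by ring. apply cpow_0. Qed.

Lemma cpow_nat b n : 0 < b -> cpow b (RtoC (INR n)) = RtoC (b ^ n).
Proof. intros Hb. rewrite cpow_RtoC, Rpower_pow; auto. Qed.

Lemma cpow_1 b : 0 < b -> cpow b (RtoC 1) = RtoC b.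
Proof. intros Hb. rewrite cpow_RtoC, Rpower_1; auto. Qed.

Lemma Re_cpow b w : Re (cpow b w) = Rpower b (Re w) * cos (Im w * ln b).
Proof. destruct w as [c d]. unfold cpow, cexp, Rpower. simpl. f_equal; f_equal; ring. Qed.

Lemma Im_cpow b w : Im (cpow b w) = Rpower b (Re w) * sin (Im w * ln b).
Proof. destruct w as [c d]. unfold cpow, cexp, Rpower. simpl. f_equal; f_equal; ring. Qed.

Lemma cpow_int_cont w h : cont_pos h ->
  cont_pos (fun t => Re (Cmult (cpow t w) (RtoC (h t)))) /\ cont_pos (fun t => Im (Cmult (cpow t w) (RtoC (h t)))).
Proof.
  intros Hh. split; intros t Ht.
  - apply (continuous_ext (fun t => (Rpower t (Re w) * cos (Im w * ln t)) * h t)).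
    { intros y. rewrite Re_mult_R, Re_cpow. reflexivity. }
    apply (continuous_mult (fun t => Rpower t (Re w) * cos (Im w * ln t)) h); [|apply Hh, Ht].
    unfold Rpower. apply (ex_derive_continuous (fun t => exp (Re w * ln t) * cos (Im w * ln t))). auto_derive; auto.
  - apply (continuous_ext (fun t => (Rpower t (Re w) * sin (Im w * ln t)) * h t)).
    { intros y. rewrite Im_mult_R, Im_cpow. reflexivity. }
    apply (continuous_mult (fun t => Rpower t (Re w) * sin (Im w * ln t)) h); [|apply Hh, Ht].
    unfold Rpower. apply (ex_derive_continuous (fun t => exp (Re w * ln t) * sin (Im w * ln t))). auto_derive; auto.
Qed.

Lemma cpow_int_bound w r t :
  Rabs (Re (Cmult (cpow t w) (RtoC r))) <= Rpower t (Re w) * Rabs r /\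
  Rabs (Im (Cmult (cpow t w) (RtoC r))) <= Rpower t (Re w) * Rabs r.
Proof.
  rewrite Re_mult_R, Im_mult_R, Re_cpow, Im_cpow, !Rabs_mult, (Rabs_pos_eq (Rpower _ _)) by (left; apply Rpower_pos).
  assert (Rabs (cos (Im w * ln t)) <= 1) by (apply Rabs_le, COS_bound).
  pose proof (Rabs_sin_le1 (Im w * ln t)). pose proof (Rpower_pos t (Re w)). pose proof (Rabs_pos r).
  assert (0 <= Rpower t (Re w) * Rabs r) by (apply Rmult_le_pos; lra).
  split.
  - replace (Rpower t (Re w) * Rabs (cos (Im w * ln t)) * Rabs r) with (Rabs (cos (Im w * ln t)) * (Rpower t (Re w) * Rabs r)) by ring.
    pose proof (Rabs_pos (cos (Im w * ln t))). nra.
  - replace (Rpower t (Re w) * Rabs (sin (Im w * ln t)) * Rabs r) with (Rabs (sin (Im w * ln t)) * (Rpower t (Re w) * Rabs r)) by ring.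
    pose proof (Rabs_pos (sin (Im w * ln t))). nra.
Qed.

(** The integrand of the real Gamma function, used as the integrable factor in all later majorants
    with a positive parameter [s] chosen each time. *)
Definition gammaDens (s t : R) : R := Rpower t (s - 1) * exp (- t).

Lemma gammaDens_cont s : cont_pos (gammaDens s).
Proof.
  intros t Ht. unfold gammaDens, Rpower.
  apply (ex_derive_continuous (fun t => exp ((s - 1) * ln t) * exp (- t))). auto_derive; auto.
Qed.

Lemma gammaDens_pos s t : 0 <= gammaDens s t.
Proof. unfold gammaDens. apply Rmult_le_pos; [left; apply Rpower_pos | left; apply exp_pos]. Qed.

(** Trades exponential decay for an arbitrary negative power. An integer [N] above [r] settles
    [x >= 1] through [pow_le_exp]; below 1 the power is at most 1, hence the extra 1 in the
    constant. *)
Lemma exp_neg_le_Rpower r : 0 <= r -> exists K, 0 < K /\ forall x, 0 < x -> exp (- x) <= K * Rpower x (- r).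
Proof.
  intros Hr. destruct (INR_unbounded r) as [N HN].
  exists (INR N ^ N + 1). assert (HNN : 0 <= INR N ^ N) by (apply pow_le, pos_INR). split; [lra|].
  intros x Hx. pose proof (exp_pos x). pose proof (Rpower_pos x r).
  assert (HB : Rpower x r <= (INR N ^ N + 1) * exp x).
  { destruct (Rle_dec 1 x) as [H1|H1].
    - apply Rle_trans with (x ^ N); [|pose proof (pow_le_exp N x ltac:(lra)); lra].
      rewrite <- Rpower_pow by auto. apply Rle_Rpower; lra.
    - apply Rle_trans with 1.
      + unfold Rpower. rewrite <- exp_0. apply exp_le. assert (ln x < 0) by (rewrite <- ln_1; apply ln_increasing; lra).
        assert (0 <= r * - ln x) by (apply Rmult_le_pos; lra). lra.
      + pose proof (exp_ineq1_le x). replace 1 with (1 * 1) by ring. apply Rmult_le_compat; lra. }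
  rewrite exp_Ropp, Rpower_Ropp. set (K := INR N ^ N + 1) in *.
  apply Rmult_le_reg_r with (exp x * Rpower x r); [apply Rmult_lt_0_compat; lra|].
  replace (/ exp x * (exp x * Rpower x r)) with (Rpower x r) by (field; lra).
  replace (K * / Rpower x r * (exp x * Rpower x r)) with (K * exp x) by (field; lra). auto.
Qed.

(* [(t / (1 + t)) ^ s] is a bounded primitive of a function dominating the density up to a constant. *)
Lemma ex_gammaDens s : 0 < s -> exists J, has_int (gammaDens s) J.
Proof.
  intros Hs.
  destruct (exp_neg_le_Rpower (1 + s)) as [K [HK HKb]]; [lra|].
  set (b := fun t => s * Rpower (t / (1 + t)) (s - 1) * / (1 + t) ^ 2).
  assert (Db : forall t, 0 < t -> is_derive (fun t => Rpower (t / (1 + t)) s) t (b t)).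
  { intros t Ht. assert (0 < t / (1 + t)) by (apply Rdiv_lt_0_compat; lra).
    replace (b t) with (scal (/ (1 + t) ^ 2) (s * Rpower (t / (1 + t)) (s - 1))) by (unfold b, scal; simpl; unfold mult; simpl; field; lra).
    apply (is_derive_comp (fun y => Rpower y s) (fun t => t / (1 + t))).
    - apply is_derive_Rpower; auto.
    - auto_derive; [lra|]. field. lra. }
  assert (Cb : cont_pos b).
  { intros t Ht. assert (0 < t / (1 + t)) by (apply Rdiv_lt_0_compat; lra).
    unfold b, Rpower. apply (ex_derive_continuous (fun t => s * exp ((s - 1) * ln (t / (1 + t))) * / (1 + t) ^ 2)).
    auto_derive. repeat split; auto; try lra. apply Rmult_integral_contrapositive_currified; lra. }
  assert (Pb : forall t, 0 < t -> 0 <= b t).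
  { intros t Ht. unfold b. apply Rmult_le_pos; [apply Rmult_le_pos; [lra | left; apply Rpower_pos]|].
    left. apply Rinv_0_lt_compat, pow_lt; lra. }
  destruct (ex_has_int_pos b 1 Cb Pb) as [I HI].
  { intros p q Hpq.
    assert (E : is_RInt b p q (Rpower (q / (1 + q)) s - Rpower (p / (1 + p)) s)).
    { apply (is_RInt_derive (V := R_CompleteNormedModule) (fun t => Rpower (t / (1 + t)) s)).
      - intros t Ht. rewrite Rmin_left in Ht by lra. apply Db; lra.
      - intros t Ht. rewrite Rmin_left in Ht by lra. apply Cb; lra. }
    rewrite (is_RInt_unique _ _ _ _ E). pose proof (Rpower_pos (p / (1 + p)) s).
    assert (Rpower (q / (1 + q)) s <= 1); [|lra].
    assert (0 < q / (1 + q)) by (apply Rdiv_lt_0_compat; lra).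
    assert (q / (1 + q) < 1) by (apply Rmult_lt_reg_r with (1 + q); [lra|]; unfold Rdiv; rewrite Rmult_assoc, Rinv_l; lra).
    assert (ln (q / (1 + q)) < 0) by (rewrite <- ln_1; apply ln_increasing; lra).
    apply Rle_trans with (exp 0); [|rewrite exp_0; lra]. apply exp_le. nra. }
  set (K' := K * exp 1 / s).
  apply (ex_has_int_dom _ (fun t => K' * b t) (K' * I)).
  - apply gammaDens_cont.
  - apply cont_pos_scal, Cb.
  - intros t Ht. rewrite Rabs_pos_eq by apply gammaDens_pos. unfold gammaDens.
    replace (exp (- t)) with (exp 1 * exp (- (1 + t))) by (rewrite <- exp_plus; f_equal; ring).
    specialize (HKb (1 + t) ltac:(lra)).
    pose proof (Rpower_pos t (s - 1)). pose proof (exp_pos 1).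
    apply Rle_trans with (Rpower t (s - 1) * (exp 1 * (K * Rpower (1 + t) (- (1 + s))))).
    + apply Rmult_le_compat_l; [lra|]. apply Rmult_le_compat_l; lra.
    + right. unfold b, K'.
      assert (E : Rpower (t / (1 + t)) (s - 1) * / (1 + t) ^ 2 = Rpower t (s - 1) * Rpower (1 + t) (- (1 + s))).
      { unfold Rdiv. rewrite <- Rpower_mult_distr; [|lra | apply Rinv_0_lt_compat; lra].
        rewrite Rmult_assoc. f_equal.
        replace (/ (1 + t)) with (Rpower (1 + t) (- (1))) at 1 by (rewrite Rpower_Ropp, Rpower_1; lra).
        rewrite Rpower_mult. rewrite <- Rpower_pow by lra. rewrite <- Rpower_Ropp, <- Rpower_plus. f_equal. simpl. ring. }
      replace (K * exp 1 / s * (s * Rpower (t / (1 + t)) (s - 1) * / (1 + t) ^ 2)) with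
        (K * exp 1 * (Rpower (t / (1 + t)) (s - 1) * / (1 + t) ^ 2)) by (field; lra).
      rewrite E. ring.
  - apply has_int_scal, HI.
Qed.

Lemma ex_has_cint_dom w h c s : 0 < s -> cont_pos h -> 
  (forall t, 0 < t -> Rpower t (Re w) * Rabs (h t) <= c * gammaDens s t) ->
  exists l, has_cint (fun t => Cmult (cpow t w) (RtoC (h t))) l.
Proof.
  intros Hs Hh Hd. destruct (ex_gammaDens s Hs) as [J HJ].
  destruct (cpow_int_cont w h Hh) as [C1 C2].
  assert (Cd : cont_pos (fun t => c * gammaDens s t)) by (apply cont_pos_scal, gammaDens_cont).
  destruct (ex_has_int_dom _ _ (c * J) C1 Cd) as [l1 H1].
  { intros t Ht. exact (Rle_trans _ _ _ (proj1 (cpow_int_bound w (h t) t)) (Hd t Ht)). }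
  { apply has_int_scal, HJ. }
  destruct (ex_has_int_dom _ _ (c * J) C2 Cd) as [l2 H2].
  { intros t Ht. exact (Rle_trans _ _ _ (proj2 (cpow_int_bound w (h t) t)) (Hd t Ht)). }
  { apply has_int_scal, HJ. }
  exists (l1, l2). split; auto.
Qed.

(** Real and imaginary parts of [cpow t w] are bounded by [Rpower t (Re w)], so complex termwise
    integration reduces to one real inequality. Convergence of both parts is also returned, since
    factors can be pulled out of [CSeries] only then. *)
Lemma has_cint_Series w (h : nat -> R -> R) (c : nat -> R) s (l : nat -> C) :
  0 < s -> (forall n, cont_pos (h n)) -> ex_series c -> (forall n, 0 <= c n) ->
  (forall n t, 0 < t -> Rpower t (Re w) * Rabs (h n t) <= c n * gammaDens s t) ->
  (forall n, has_cint (fun t => Cmult (cpow t w) (RtoC (h n t))) (l n)) ->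
  has_cint (fun t => Cmult (cpow t w) (RtoC (Series (fun n => h n t)))) (CSeries l)
  /\ ex_series (fun n => Re (l n)) /\ ex_series (fun n => Im (l n)).
Proof.
  intros Hs Hh Hc Hc0 Hd Hl. destruct (ex_gammaDens s Hs) as [J HJ].
  destruct (has_int_Series (fun n t => Re (Cmult (cpow t w) (RtoC (h n t)))) c (gammaDens s) J (fun n => Re (l n))) as [H1 E1]; auto.
  - intros n. exact (proj1 (cpow_int_cont w (h n) (Hh n))).
  - apply gammaDens_cont.
  - intros; apply gammaDens_pos.
  - intros n t Ht. exact (Rle_trans _ _ _ (proj1 (cpow_int_bound w (h n t) t)) (Hd n t Ht)).
  - intros n. exact (proj1 (Hl n)).
  - destruct (has_int_Series (fun n t => Im (Cmult (cpow t w) (RtoC (h n t)))) c (gammaDens s) J (fun n => Im (l n))) as [H2 E2]; auto.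
    + intros n. exact (proj2 (cpow_int_cont w (h n) (Hh n))).
    + apply gammaDens_cont.
    + intros; apply gammaDens_pos.
    + intros n t Ht. exact (Rle_trans _ _ _ (proj2 (cpow_int_bound w (h n t) t)) (Hd n t Ht)).
    + intros n. exact (proj2 (Hl n)).
    + split; [|auto]. split; [revert H1 | revert H2]; apply has_int_ext; intros t Ht.
      * rewrite Re_mult_R, <- Series_scal_l. apply Series_ext. intros n. apply Re_mult_R.
      * rewrite Im_mult_R, <- Series_scal_l. apply Series_ext. intros n. apply Im_mult_R.
Qed.

Lemma CSeries_ext u v : (forall n, u n = v n) -> CSeries u = CSeries v.
Proof. intros H. unfold CSeries. f_equal; apply Series_ext; intros n; rewrite H; reflexivity. Qed.

Lemma CSeries_scal z u : ex_series (fun n => Re (u n)) -> ex_series (fun n => Im (u n)) ->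
  CSeries (fun n => Cmult z (u n)) = Cmult z (CSeries u).
Proof.
  intros H1 H2. unfold CSeries. apply C_ext.
  - rewrite Re_mult. simpl. rewrite <- !Series_scal_l, <- Series_minus by (apply ex_series_scalR; auto). reflexivity.
  - rewrite Im_mult. simpl. rewrite <- !Series_scal_l, <- Series_plus by (apply ex_series_scalR; auto). reflexivity.
Qed.

Lemma has_cint_Gamma w : 0 < Re w ->
  has_cint (fun t => Cmult (cpow t (Cminus w (RtoC 1))) (RtoC (exp (- t)))) (CGamma w).
Proof.
  intros Hw. destruct (ex_has_cint_dom (Cminus w (RtoC 1)) (fun t => exp (- t)) 1 (Re w)) as [l Hl]; auto.
  - intros t _. apply (ex_derive_continuous (fun t => exp (- t))). auto_derive; auto.
  - intros t Ht. rewrite Rabs_pos_eq by (left; apply exp_pos). unfold gammaDens. simpl.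
    right. rewrite Rmult_1_l. reflexivity.
  - unfold CGamma. rewrite (CInt0inf_eq _ _ Hl). exact Hl.
Qed.

Lemma has_cint_Gamma_scale w c : 0 < Re w -> 0 < c ->
  has_cint (fun t => Cmult (cpow t (Cminus w (RtoC 1))) (RtoC (exp (- (c * t))))) (Cmult (CGamma w) (cpow c (Copp w))).
Proof.
  intros Hw Hc. destruct (has_cint_Gamma w Hw) as [H1 H2].
  destruct (cpow_int_cont (Cminus w (RtoC 1)) (fun t => exp (- t))) as [C1 C2].
  { intros t _. apply (ex_derive_continuous (fun t => exp (- t))). auto_derive; auto. }
  apply (has_int_scale _ _ c Hc C1) in H1. apply (has_int_scale _ _ c Hc C2) in H2.
  assert (H : has_cint (fun t => Cmult (RtoC c) (Cmult (cpow (c * t) (Cminus w (RtoC 1))) (RtoC (exp (- (c * t)))))) (CGamma w)).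
  { split; [revert H1 | revert H2]; apply has_int_ext; intros t Ht.
    - rewrite (Re_mult_Rl c). reflexivity.
    - rewrite (Im_mult_Rl c). reflexivity. }
  apply (has_cint_scal (cpow c (Copp w))) in H. rewrite (Cmult_comm (CGamma w)).
  revert H. apply has_cint_ext. intros t Ht. rewrite cpow_mult by auto.
  replace (RtoC c) with (cpow c (RtoC 1)) at 1 by (apply cpow_1; auto).
  set (E := RtoC (exp _)). set (T := cpow t _).
  replace (Cmult (cpow c (Copp w)) (Cmult (cpow c (RtoC 1)) (Cmult (Cmult (cpow c (Cminus w (RtoC 1))) T) E)))
    with (Cmult (Cmult (cpow c (Copp w)) (Cmult (cpow c (RtoC 1)) (cpow c (Cminus w (RtoC 1))))) (Cmult T E)) by ring.
  rewrite <- !cpow_plus. replace (Cplus (Copp w) (Cplus (RtoC 1) (Cminus w (RtoC 1)))) with (RtoC 0) by ring.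
  rewrite cpow_0. ring.
Qed.

(** [r = sqrt Y] is the fixed point of [t -> Y / t]. Folding about it turns [- t - Y / t] into -2 r
    cosh s, and the two halves carry exp (nu s) and exp (-nu s), which add up to 2 cosh (nu s).
    Convergence is known beforehand because exp (-Y/t) is at most 1. *)
Lemma has_cint_BesselK nu Y : 0 < Re nu -> 0 < Y ->
  has_cint (fun t => Cmult (cpow t (Cminus nu (RtoC 1))) (RtoC (exp (- t - Y / t))))
    (Cmult (Cmult (RtoC 2) (cpow Y (Cmult nu (RtoC (/ 2))))) (BesselK nu (2 * sqrt Y))).
Proof.
  intros Hnu HY.
  assert (Ch : cont_pos (fun t => exp (- t - Y / t))).
  { intros t Ht. apply (ex_derive_continuous (fun t => exp (- t - Y / t))). auto_derive. lra. }
  destruct (ex_has_cint_dom (Cminus nu (RtoC 1)) (fun t => exp (- t - Y / t)) 1 (Re nu)) as [J HJ]; auto.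
  { intros t Ht. rewrite Rabs_pos_eq by (left; apply exp_pos). unfold gammaDens. simpl. rewrite Rmult_1_l.
    apply Rmult_le_compat_l; [left; apply Rpower_pos|]. apply exp_le.
    assert (0 < Y / t) by (apply Rdiv_lt_0_compat; auto). lra. }
  set (r := sqrt Y). assert (Hr : 0 < r) by (apply sqrt_lt_R0; auto).
  assert (Hrr : r * r = Y) by (apply sqrt_sqrt; lra).
  destruct (cpow_int_cont (Cminus nu (RtoC 1)) (fun t => exp (- t - Y / t)) Ch) as [C1 C2].
  pose proof (has_int_exp_fold _ _ r Hr C1 (proj1 HJ)) as H1.
  pose proof (has_int_exp_fold _ _ r Hr C2 (proj2 HJ)) as H2.
  cbv beta in H1, H2.
  set (c := Cmult (RtoC 2) (cpow Y (Cmult nu (RtoC (/ 2))))).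
  assert (Hcr : cpow r nu = cpow Y (Cmult nu (RtoC (/ 2)))).
  { rewrite <- Hrr. rewrite cpow_mult by auto. rewrite <- cpow_plus. f_equal.
    rewrite <- Cmult_plus_distr_l, <- RtoC_plus. replace (/ 2 + / 2) with 1 by field. ring. }
  (* The Jacobian [r * exp s] raises the exponent from [nu - 1] to [nu]. *)
  assert (Hpt : forall s, Cmult (Cmult (cpow (r * exp s) (Cminus nu (RtoC 1))) (RtoC (exp (- (r * exp s) - Y / (r * exp s))))) (RtoC (r * exp s))
    = Cmult (cpow r nu) (Cmult (RtoC (exp (- (2 * r) * cosh s))) (cexp (Cmult nu (RtoC s))))).
  { intros s. pose proof (exp_pos s) as He.
    replace (- (r * exp s) - Y / (r * exp s)) with (- (2 * r) * cosh s).
    2:{ rewrite <- Hrr. unfold cosh. rewrite exp_Ropp. field. lra. }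
    rewrite <- (cpow_1 (r * exp s)) by nra.
    set (E := RtoC (exp (- (2 * r) * cosh s))).
    replace (Cmult (Cmult (cpow (r * exp s) (Cminus nu (RtoC 1))) E) (cpow (r * exp s) (RtoC 1))) with
      (Cmult E (Cmult (cpow (r * exp s) (Cminus nu (RtoC 1))) (cpow (r * exp s) (RtoC 1)))) by ring.
    rewrite <- cpow_plus. replace (Cplus (Cminus nu (RtoC 1)) (RtoC 1)) with nu by ring.
    rewrite cpow_mult by auto. unfold cpow at 2. rewrite ln_exp. ring. }
  assert (H : has_cint (fun s => Cmult c (Cmult (RtoC (exp (- (2 * r) * cosh s))) (ccosh (Cmult nu (RtoC s))))) J).
  { assert (HS : forall s, Cmult c (Cmult (RtoC (exp (- (2 * r) * cosh s))) (ccosh (Cmult nu (RtoC s)))) =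
      Cplus (Cmult (Cmult (cpow (r * exp s) (Cminus nu (RtoC 1))) (RtoC (exp (- (r * exp s) - Y / (r * exp s))))) (RtoC (r * exp s)))
       (Cmult (Cmult (cpow (r * exp (- s)) (Cminus nu (RtoC 1))) (RtoC (exp (- (r * exp (- s)) - Y / (r * exp (- s)))))) (RtoC (r * exp (- s))))).
    { intros s. rewrite !Hpt. replace (cosh (- s)) with (cosh s) by (unfold cosh; rewrite Ropp_involutive; f_equal; ring).
      replace (Cmult nu (RtoC (- s))) with (Copp (Cmult nu (RtoC s))) by (rewrite RtoC_opp; ring).
      unfold c. rewrite <- Hcr. unfold ccosh. set (E := RtoC (exp _)).
      set (e1 := cexp _). set (e2 := cexp _).
      replace (Cmult (Cmult (RtoC 2) (cpow r nu)) (Cmult E (Cmult (RtoC (/ 2)) (Cplus e1 e2)))) with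
       (Cmult (RtoC 2) (Cmult (RtoC (/ 2)) (Cmult (cpow r nu) (Cmult E (Cplus e1 e2))))) by ring.
      rewrite Cmult_assoc, <- RtoC_mult. replace (2 * / 2) with 1 by field. ring. }
    split; [revert H1 | revert H2]; apply has_int_ext; intros s Hs; rewrite HS.
    - change (Re (Cplus ?a ?b)) with (Re a + Re b). rewrite !(Re_mult_R (Cmult _ _)). reflexivity.
    - change (Im (Cplus ?a ?b)) with (Im a + Im b). rewrite !(Im_mult_R (Cmult _ _)). reflexivity. }
  (* The inverse of [c]: the fold represents [J] as the integral of [c] times the Bessel integrand,
     and [BesselK] is the integral of the latter alone. *)
  set (ci := Cmult (RtoC (/ 2)) (cpow Y (Copp (Cmult nu (RtoC (/ 2)))))).
  assert (Hci : Cmult ci c = RtoC 1).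
  { unfold ci, c. replace (Cmult (Cmult (RtoC (/ 2)) (cpow Y (Copp (Cmult nu (RtoC (/ 2)))))) (Cmult (RtoC 2) (cpow Y (Cmult nu (RtoC (/ 2)))))) with
     (Cmult (Cmult (RtoC (/ 2)) (RtoC 2)) (Cmult (cpow Y (Cmult nu (RtoC (/ 2)))) (cpow Y (Copp (Cmult nu (RtoC (/ 2))))))) by ring.
    rewrite cpow_opp, <- RtoC_mult. replace (/ 2 * 2) with 1 by field. ring. }
  assert (HB : BesselK nu (2 * r) = Cmult ci J).
  { unfold BesselK. apply CInt0inf_eq. apply (has_cint_scal ci) in H. revert H. apply has_cint_ext. intros s Hs.
    rewrite Cmult_assoc, Hci. ring. }
  rewrite HB. fold c. replace (Cmult c (Cmult ci J)) with (Cmult (Cmult ci c) J) by ring. rewrite Hci.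
  replace (Cmult (RtoC 1) J) with J by ring. exact HJ.
Qed.

(** * The two sides as integrals *)

Lemma has_cint_Bessel_series lam nu k th : 0 < lam -> 0 < Re nu ->
  let l := fun n => Cmult (Cmult (Cmult (RtoC 2) (cpow (lam * INR (S n)) (Cmult nu (RtoC (/ 2)))))
                      (BesselK nu (2 * sqrt (lam * INR (S n))))) (RtoC (divsum_sin k th (S n))) in
  has_cint (fun t => Cmult (cpow t (Cminus nu (RtoC 1)))
      (RtoC (Series (fun n => divsum_sin k th (S n) * exp (- t - lam * INR (S n) / t))))) (CSeries l)
  /\ ex_series (fun n => Re (l n)) /\ ex_series (fun n => Im (l n)).
Proof.
  (* The divisor sums cost [k + 1] powers of [INR n + 1], and two more give summability. Bounding
     exp (-x) by N^N / x^N at x = lam (n + 1) / t leaves a factor t^N, which moves the density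
     parameter to [Re nu + INR N]. *)
  intros Hlam Hnu l. set (N := (k + 3)%nat).
  apply (has_cint_Series (Cminus nu (RtoC 1)) (fun n t => divsum_sin k th (S n) * exp (- t - lam * INR (S n) / t))
    (fun n => INR N ^ N / lam ^ N * / (INR n + 1) ^ 2) (Re nu + INR N) l).
  - pose proof (pos_INR N). lra.
  - intros n. apply cont_pos_scal. intros t Ht. 
    apply (ex_derive_continuous (fun t => exp (- t - lam * INR (S n) / t))). auto_derive. lra.
  - apply ex_series_scalR, ex_series_inv_sqr.
  - intros n. pose proof (pos_INR n). apply Rmult_le_pos.
    + apply Rmult_le_pos; [apply pow_le, pos_INR | left; apply Rinv_0_lt_compat, pow_lt; lra].
    + left; apply Rinv_0_lt_compat, pow_lt; lra.
  - intros n t Ht. rewrite S_INR. pose proof (pos_INR n). set (b := INR n + 1). assert (Hb : 0 < b) by (unfold b; lra).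
    rewrite Rabs_mult, (Rabs_pos_eq (exp _)) by (left; apply exp_pos).
    unfold gammaDens. change (Re (Cminus nu (RtoC 1))) with (Re nu - 1).
    replace (Re nu + INR N - 1) with (Re nu - 1 + INR N) by ring. rewrite Rpower_plus, (Rpower_pow N t Ht).
    pose proof (divsum_sin_bound k th n) as Hd. fold b in Hd.
    pose proof (pow_le_exp N (lam * b / t)) as HP.
    assert (Hx : 0 < lam * b / t) by (apply Rdiv_lt_0_compat; nra).
    specialize (HP ltac:(lra)). 
    replace (- t - lam * b / t) with (- t + - (lam * b / t)) by ring. rewrite exp_plus, (exp_Ropp (lam * b / t)).
    pose proof (Rpower_pos t (Re nu - 1)). pose proof (exp_pos (- t)). pose proof (exp_pos (lam * b / t)).
    assert (HtN : 0 < t ^ N) by (apply pow_lt; lra). assert (HlN : 0 < lam ^ N) by (apply pow_lt; lra).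
    assert (HbN : 0 < b ^ N) by (apply pow_lt; lra). assert (Hb2 : 0 < b ^ 2) by (apply pow_lt; lra).
    assert (HK : / exp (lam * b / t) <= INR N ^ N / lam ^ N * / b ^ N * t ^ N).
    { replace ((lam * b / t) ^ N) with (lam ^ N * b ^ N / t ^ N) in HP
        by (unfold Rdiv; rewrite !Rpow_mult_distr, pow_inv; reflexivity).
      apply Rmult_le_reg_r with (exp (lam * b / t) * (lam ^ N * b ^ N / t ^ N)).
      { apply Rmult_lt_0_compat; auto. apply Rdiv_lt_0_compat; auto. nra. }
      replace (/ exp (lam * b / t) * (exp (lam * b / t) * (lam ^ N * b ^ N / t ^ N))) with (lam ^ N * b ^ N / t ^ N) by (field; lra).
      replace (INR N ^ N / lam ^ N * / b ^ N * t ^ N * (exp (lam * b / t) * (lam ^ N * b ^ N / t ^ N))) with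
        (INR N ^ N * exp (lam * b / t)) by (field; lra). auto. }
    apply Rle_trans with (Rpower t (Re nu - 1) * (b ^ (k + 1) * (exp (- t) * (INR N ^ N / lam ^ N * / b ^ N * t ^ N)))).
    + apply Rmult_le_compat_l; [lra|]. apply Rmult_le_compat; auto.
      * apply Rabs_pos.
      * apply Rmult_le_pos; [lra|]. left; apply Rinv_0_lt_compat; lra.
      * apply Rmult_le_compat_l; lra.
    + right. assert (E : b ^ N = b ^ (k + 1) * b ^ 2) by (rewrite <- pow_add; f_equal; unfold N; lia).
      rewrite E in *. assert (0 < b ^ (k + 1)) by (apply pow_lt; lra).
      set (B := b ^ (k + 1)) in *. set (B2 := b ^ 2) in *. field. repeat split; lra.
  - intros n. assert (Hn : 0 < lam * INR (S n)) by (apply Rmult_lt_0_compat; auto; apply lt_0_INR; lia).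
    pose proof (has_cint_scal (RtoC (divsum_sin k th (S n))) _ _ (has_cint_BesselK nu _ Hnu Hn)) as H.
    unfold l. rewrite (Cmult_comm _ (RtoC (divsum_sin k th (S n)))).
    revert H. apply has_cint_ext. intros t Ht. rewrite RtoC_mult. ring.
Qed.

(** The numerator is exp (-y p) (1 - exp (-y (q - p))) up to sign, with 0 <= q - p <= 1; its second
    factor is at most the denominator, so nothing blows up as [y] tends to 0. *)
Lemma exp_diff_bound y th m0 : 0 < y -> 0 < m0 -> m0 <= th -> m0 <= 1 - th ->
  Rabs ((exp (- y * th) - exp (- y * (1 - th))) / (1 - exp (- y))) <= exp (- (y * m0)).
Proof.
  intros Hy Hm H1 H2. pose proof (exp_neg_lt1 y Hy) as Hlt.
  assert (H : forall p q, m0 <= p -> p <= q -> q - p <= 1 ->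
     0 <= exp (- y * p) - exp (- y * q) <= exp (- (y * m0)) * (1 - exp (- y))).
  { intros p q Hp Hpq Hqp. replace (exp (- y * q)) with (exp (- y * p) * exp (- (y * (q - p)))) by (rewrite <- exp_plus; f_equal; ring).
    assert (exp (- y * p) <= exp (- (y * m0))) by (apply exp_le; nra).
    assert (exp (- y) <= exp (- (y * (q - p)))) by (apply exp_le; nra).
    assert (exp (- (y * (q - p))) <= 1) by (rewrite <- exp_0; apply exp_le; nra).
    pose proof (exp_pos (- y * p)). pose proof (exp_pos (- y)). split; [nra|].
    replace (exp (- y * p) - exp (- y * p) * exp (- (y * (q - p)))) with (exp (- y * p) * (1 - exp (- (y * (q - p))))) by ring.
    apply Rmult_le_compat; lra. }
  unfold Rdiv. rewrite Rabs_mult, (Rabs_pos_eq (/ _)) by (left; apply Rinv_0_lt_compat; lra).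
  apply Rmult_le_reg_r with (1 - exp (- y)); [lra|]. rewrite Rmult_assoc, Rinv_l, Rmult_1_r by lra.
  destruct (Rle_dec th (1 - th)) as [h|h].
  - pose proof (H th (1 - th) H1 h ltac:(lra)). apply Rabs_le. lra.
  - pose proof (H (1 - th) th H2 ltac:(lra) ltac:(lra)). apply Rabs_le. lra.
Qed.

Lemma Rpower_mult3 a b c r : 0 < a -> 0 < b -> 0 < c ->
  Rpower (a * b * c) r = Rpower a r * Rpower b r * Rpower c r.
Proof. intros. rewrite <- !Rpower_mult_distr; auto. nra. Qed.

(** The quotient by [1 - exp (- (y * t))] is a geometric series, and each exponential integrates to
    a Gamma value times a power by [has_cint_Gamma_scale]. *)
Lemma has_cint_inner (y th : R) (k : nat) (nu : C) : 0 < y -> 0 < th < 1 -> 0 < Re nu ->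
  let w := Cplus nu (RtoC (INR k + 1)) in
  let e := Copp (Cplus (RtoC 1) (Cplus nu (RtoC (INR k)))) in
  has_cint (fun t => Cmult (cpow t (Cminus w (RtoC 1)))
      (RtoC (exp (- t) * ((exp (- (y * t) * th) - exp (- (y * t) * (1 - th))) / (1 - exp (- (y * t)))))))
    (CSeries (fun m => Cminus (Cmult (CGamma w) (cpow (1 + y * (INR m + th)) e))
                              (Cmult (CGamma w) (cpow (1 + y * (INR m + 1 - th)) e)))).
Proof.
  intros Hy Hth Hnu w e.
  set (m0 := Rmin th (1 - th)).
  assert (Hm : 0 < m0) by (apply Rmin_pos; lra).
  assert (Hm1 : m0 <= th) by apply Rmin_l. assert (Hm2 : m0 <= 1 - th) by apply Rmin_r.
  set (s := Re nu). fold s in Hnu. pose proof (pos_INR k) as Hk.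
  (* This exponent exceeds 1, which sums over [m], and still leaves a power of [t] belonging to the
     density of positive parameter [s / 2 + INR k]. *)
  destruct (exp_neg_le_Rpower (1 + s / 2)) as [K [HK HKb]]; [lra|].
  set (h := fun m t => exp (- ((1 + y * (INR m + th)) * t)) - exp (- ((1 + y * (INR m + 1 - th)) * t))).
  destruct (has_cint_Series (Cminus w (RtoC 1)) h
    (fun m => 2 * K * Rpower (y * m0) (- (1 + s / 2)) * Rpower (INR m + 1) (- (1 + s / 2))) (s / 2 + INR k)
    (fun m => Cminus (Cmult (CGamma w) (cpow (1 + y * (INR m + th)) e))
                              (Cmult (CGamma w) (cpow (1 + y * (INR m + 1 - th)) e)))) as [H _].
  - lra.
  - intros m t _. unfold h. apply (ex_derive_continuous (fun t => exp (- ((1 + y * (INR m + th)) * t)) - exp (- ((1 + y * (INR m + 1 - th)) * t)))).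
    auto_derive; auto.
  - apply ex_series_scalR, ex_series_Rpower; lra.
  - intros m. pose proof (Rpower_pos (y * m0) (- (1 + s / 2))). pose proof (Rpower_pos (INR m + 1) (- (1 + s / 2))).
    apply Rmult_le_pos; [apply Rmult_le_pos|]; lra.
  - intros m t Ht. pose proof (pos_INR m).
    replace (Re (Cminus w (RtoC 1))) with (s + INR k) by (unfold w, s, Re; simpl; ring).
    assert (Hone : forall c, m0 * (INR m + 1) <= c -> 0 <= exp (- ((1 + y * c) * t)) <=
       exp (- t) * (K * (Rpower (y * m0) (- (1 + s / 2)) * Rpower (INR m + 1) (- (1 + s / 2)) * Rpower t (- (1 + s / 2))))).
    { intros c Hc. split; [left; apply exp_pos|].
      replace (- ((1 + y * c) * t)) with (- t + - (y * c * t)) by ring. rewrite exp_plus.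
      apply Rmult_le_compat_l; [left; apply exp_pos|].
      assert (Hym : 0 < y * m0) by nra.
      rewrite <- Rpower_mult3 by lra.
      assert (0 < y * m0 * (INR m + 1)) by (apply Rmult_lt_0_compat; lra).
      eapply Rle_trans; [|apply HKb; nra].
      apply exp_le. apply Ropp_le_contravar. apply Rmult_le_compat_r; [lra|]. rewrite Rmult_assoc. apply Rmult_le_compat_l; lra. }
    pose proof (Hone (INR m + th) ltac:(nra)) as A1. pose proof (Hone (INR m + 1 - th) ltac:(nra)) as A2.
    unfold h, gammaDens.
    replace (s / 2 + INR k - 1) with (s + INR k + - (1 + s / 2)) by field. rewrite (Rpower_plus (s + INR k)).
    set (P := Rpower t (s + INR k)). assert (0 < P) by apply Rpower_pos.
    set (B := exp (- t) * _) in *.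
    apply Rle_trans with (P * (2 * B)).
    + apply Rmult_le_compat_l; [lra|]. apply Rabs_le. lra.
    + right. unfold B. ring.
  - intros m. pose proof (pos_INR m).
    assert (Hw : 0 < Re w) by (unfold w, Re; simpl; unfold s, Re in Hnu; lra).
    assert (He : e = Copp w) by (unfold e, w; rewrite RtoC_plus; ring).
    assert (Hc1 : 0 < 1 + y * (INR m + th)) by nra. assert (Hc2 : 0 < 1 + y * (INR m + 1 - th)) by nra.
    rewrite He.
    pose proof (has_cint_plus _ _ _ _ (has_cint_Gamma_scale w _ Hw Hc1)
       (has_cint_scal (RtoC (-1)) _ _ (has_cint_Gamma_scale w _ Hw Hc2))) as G.
    match goal with |- has_cint _ ?l => match type of G with has_cint _ ?l' => replace l with l' by
      (replace (RtoC (-1)) with (Copp (RtoC 1)) by (rewrite <- RtoC_opp; reflexivity); ring) end end.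
    revert G. apply has_cint_ext. intros t Ht. unfold h. rewrite RtoC_minus.
    replace (RtoC (-1)) with (Copp (RtoC 1)) by (rewrite <- RtoC_opp; reflexivity). ring.
  - revert H. apply has_cint_ext. intros t Ht. do 2 f_equal.
    assert (Hyt : 0 < y * t) by nra.
    apply is_series_unique. 
    replace (exp (- t) * ((exp (- (y * t) * th) - exp (- (y * t) * (1 - th))) / (1 - exp (- (y * t))))) with
     (exp (- t) * (exp (- (y * t) * th) / (1 - exp (- (y * t))) - exp (- (y * t) * (1 - th)) / (1 - exp (- (y * t))))) by (unfold Rdiv; ring).
    apply is_series_extR with (fun m => exp (- t) * (exp (- (y * t) * (INR m + th)) - exp (- (y * t) * (INR m + (1 - th))))).
    + intros m. unfold h. rewrite Rmult_minus_distr_l, <- !exp_plus. f_equal; f_equal; ring.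
    + apply is_series_scalR, is_series_minusR; apply is_series_exp_geom; auto.
Qed.

(** The sum over [m] stays in closed form inside the integral, so only [d] has to be dominated, and
    [has_cint_inner] supplies the value of each term. *)
Lemma has_cint_outer (kap th : R) (k : nat) (nu : C) : 0 < kap -> 0 < th < 1 -> 0 < Re nu ->
  let w := Cplus nu (RtoC (INR k + 1)) in
  let e := Copp (Cplus (RtoC 1) (Cplus nu (RtoC (INR k)))) in
  has_cint (fun t => Cmult (cpow t (Cminus w (RtoC 1)))
      (RtoC (exp (- t) * Series (fun d => (INR d + 1) ^ k * lambertExp (kap * t) 0 d th))))
    (CSeries (fun d => Cmult (RtoC (INR (S d) ^ k)) (CSeries (fun m =>
       Cminus (Cmult (CGamma w) (cpow (1 + kap * INR (S d) * (INR m + th)) e))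
              (Cmult (CGamma w) (cpow (1 + kap * INR (S d) * (INR m + 1 - th)) e)))))).
Proof.
  intros Hkap Hth Hnu w e.
  set (m0 := Rmin th (1 - th)).
  assert (Hm : 0 < m0) by (apply Rmin_pos; lra).
  assert (Hm1 : m0 <= th) by apply Rmin_l. assert (Hm2 : m0 <= 1 - th) by apply Rmin_r.
  set (s := Re nu). fold s in Hnu. pose proof (pos_INR k) as Hk.
  (* [INR k] cancels the factor [(INR d + 1) ^ k], [1 + s / 2] sums over [d], and the density keeps
     the parameter [s / 2]. *)
  set (r := 1 + s / 2 + INR k).
  destruct (exp_neg_le_Rpower r) as [K [HK HKb]]; [unfold r; lra|].
  set (h := fun d t => exp (- t) * ((INR d + 1) ^ k * lambertExp (kap * t) 0 d th)).
  assert (Hlam : forall d t, lambertExp (kap * t) 0 d th =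
     (exp (- (kap * INR (S d) * t) * th) - exp (- (kap * INR (S d) * t) * (1 - th))) / (1 - exp (- (kap * INR (S d) * t)))).
  { intros d t. unfold lambertExp. rewrite S_INR. replace (kap * (INR d + 1) * t) with (kap * t * (INR d + 1)) by ring.
    simpl pow. rewrite !Rmult_1_l. reflexivity. }
  assert (HSd : forall d, 0 < INR (S d)) by (intros d; apply lt_0_INR; lia).
  destruct (has_cint_Series (Cminus w (RtoC 1)) h
    (fun d => K * Rpower (kap * m0) (- r) * Rpower (INR d + 1) (- (1 + s / 2))) (s / 2)
    (fun d => Cmult (RtoC (INR (S d) ^ k)) (CSeries (fun m =>
       Cminus (Cmult (CGamma w) (cpow (1 + kap * INR (S d) * (INR m + th)) e))
              (Cmult (CGamma w) (cpow (1 + kap * INR (S d) * (INR m + 1 - th)) e)))))) as [H _].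
  - lra.
  - intros d t Ht.
    assert (Hp : 0 < kap * INR (S d) * t) by (repeat apply Rmult_lt_0_compat; auto).
    pose proof (exp_neg_lt1 _ Hp).
    apply (continuous_ext (fun t => exp (- t) * ((INR d + 1) ^ k * ((exp (- (kap * INR (S d) * t) * th) - exp (- (kap * INR (S d) * t) * (1 - th))) / (1 - exp (- (kap * INR (S d) * t))))))).
    { intros z. unfold h. rewrite Hlam. reflexivity. }
    apply (ex_derive_continuous (fun t => exp (- t) * ((INR d + 1) ^ k * ((exp (- (kap * INR (S d) * t) * th) - exp (- (kap * INR (S d) * t) * (1 - th))) / (1 - exp (- (kap * INR (S d) * t))))))).
    set (z := INR (S d)) in *. clearbody z.
    auto_derive. unfold Rminus in *. lra.
  - apply ex_series_scalR, ex_series_Rpower; lra.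
  - intros d. pose proof (Rpower_pos (kap * m0) (- r)). pose proof (Rpower_pos (INR d + 1) (- (1 + s / 2))).
    apply Rmult_le_pos; [apply Rmult_le_pos|]; lra.
  - intros d t Ht. pose proof (pos_INR d).
    replace (Re (Cminus w (RtoC 1))) with (s + INR k) by (unfold w, s, Re; simpl; ring).
    set (b := INR d + 1) in *. assert (Hb : 0 < b) by (unfold b; lra).
    assert (Hp : 0 < kap * b * t) by (repeat apply Rmult_lt_0_compat; auto).
    assert (HG : Rabs (lambertExp (kap * t) 0 d th) <= K * (Rpower (kap * m0) (- r) * Rpower b (- r) * Rpower t (- r))).
    { rewrite Hlam, S_INR. fold b. eapply Rle_trans; [apply (exp_diff_bound (kap * b * t) th m0); auto|].
      replace (kap * b * t * m0) with (kap * m0 * b * t) by ring.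
      rewrite <- Rpower_mult3; auto; [|nra]. apply HKb. assert (0 < kap * b * t * m0) by nra. nra. }
    unfold h, gammaDens. fold b. rewrite !Rabs_mult, (Rabs_pos_eq (exp _)), (Rabs_pos_eq (b ^ k)) by (try apply pow_le; try (left; apply exp_pos); lra).
    replace (s / 2 - 1) with (s + INR k + - r) by (unfold r; field). rewrite (Rpower_plus (s + INR k)).
    assert (Hbk : b ^ k * Rpower b (- r) = Rpower b (- (1 + s / 2))).
    { rewrite <- Rpower_pow, <- Rpower_plus by auto. f_equal. unfold r. ring. }
    rewrite <- Hbk.
    set (P := Rpower t (s + INR k)). assert (0 < P) by apply Rpower_pos.
    pose proof (exp_pos (- t)). assert (0 < b ^ k) by (apply pow_lt; auto).
    apply Rle_trans with (P * (exp (- t) * (b ^ k * (K * (Rpower (kap * m0) (- r) * Rpower b (- r) * Rpower t (- r)))))).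
    + apply Rmult_le_compat_l; [lra|]. apply Rmult_le_compat_l; [lra|]. apply Rmult_le_compat_l; lra.
    + right. ring.
  - intros d.
    pose proof (has_cint_inner (kap * INR (S d)) th k nu (Rmult_lt_0_compat _ _ Hkap (HSd d)) Hth Hnu) as G.
    apply (has_cint_scal (RtoC (INR (S d) ^ k))) in G. revert G. apply has_cint_ext. intros t Ht.
    unfold h. rewrite Hlam, <- (S_INR d), !RtoC_mult. fold w. ring.
  - revert H. apply has_cint_ext. intros t Ht. do 2 f_equal. unfold h. apply Series_scal_l.
Qed.

Theorem theorem2p1 (a x theta : R) (k : nat) (nu : C)
  (ha : 0 < a) (hx : 0 < x) (htheta0 : 0 < theta) (htheta1 : theta < 1)
  (hk : Nat.Even k) (hnu : 0 < Re nu) :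
  Cmult (cpow (a ^ 2 * x / 4) (Cplus (Cmult nu (RtoC (/ 2))) (RtoC (INR k + 1))))
    (CSeries (fun n0 => let n := S n0 in
       Cmult (Cmult (cpow (INR n) (Cmult nu (RtoC (/ 2))))
                    (BesselK nu (a * sqrt (INR n * x))))
             (RtoC (divsum_sin k theta n))))
  =
  Cplus
   (Cplus
    (Cmult (RtoC (- ((-1) ^ (Nat.div k 2) * a ^ (2 * k + 2) * INR (fact k))
                   / (2 ^ (2 * k + 4) * (2 * PI) ^ (k + 1))))
       (Cmult (CGamma nu) (RtoC (HurwitzDiff k theta * x ^ (k + 1)))))
    (Cmult (RtoC ((if Nat.eqb k 0 then 1 else 0) * PI / 4))
       (Cmult (CGamma (Cplus (RtoC 1) nu))
              (RtoC (HurwitzZeta 0 theta - HurwitzZeta 0 (1 - theta))))))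
   (Cmult (RtoC ((-1) ^ (Nat.div k 2) / 4 * (2 * PI) ^ (k + 1)))
     (CSeries (fun d0 => let d := S d0 in
        Cmult (RtoC (INR d ^ k))
          (CSeries (fun m =>
             Cminus
               (Cmult (CGamma (Cplus nu (RtoC (INR k + 1))))
                  (cpow (1 + 16 * PI ^ 2 * INR d / (a ^ 2 * x) * (INR m + theta))
                        (Copp (Cplus (RtoC 1) (Cplus nu (RtoC (INR k)))))))
               (Cmult (CGamma (Cplus nu (RtoC (INR k + 1))))
                  (cpow (1 + 16 * PI ^ 2 * INR d / (a ^ 2 * x) * (INR m + 1 - theta))
                        (Copp (Cplus (RtoC 1) (Cplus nu (RtoC (INR k)))))))))))).
Proof.
  pose proof PI_RGT_0 as HPI.
  assert (Hth : 0 < theta < 1) by lra.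
  set (lam := a ^ 2 * x / 4).
  assert (Ha2 : 0 < a ^ 2) by (apply pow_lt; auto).
  assert (Hlam : 0 < lam) by (unfold lam; nra).
  (* This is [16 * PI ^ 2 / (a ^ 2 * x)]; with [u = lam / t] the parameter [4 * PI ^ 2 / u] of the
     transformation becomes [kap * t]. *)
  set (kap := 4 * PI ^ 2 / lam).
  assert (HPI2 : 0 < PI ^ 2) by (apply pow_lt; lra).
  assert (Hkap : 0 < kap) by (unfold kap; apply Rdiv_lt_0_compat; lra).
  set (sg := (-1) ^ Nat.div k 2).
  set (T3 := CSeries (fun d => Cmult (RtoC (INR (S d) ^ k)) (CSeries (fun m =>
       Cminus (Cmult (CGamma (Cplus nu (RtoC (INR k + 1)))) (cpow (1 + kap * INR (S d) * (INR m + theta)) (Copp (Cplus (RtoC 1) (Cplus nu (RtoC (INR k)))))))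
              (Cmult (CGamma (Cplus nu (RtoC (INR k + 1)))) (cpow (1 + kap * INR (S d) * (INR m + 1 - theta)) (Copp (Cplus (RtoC 1) (Cplus nu (RtoC (INR k))))))))))).
  match goal with |- _ = Cplus _ (Cmult _ ?S) => replace S with T3 end.
  2:{ unfold T3. apply CSeries_ext. intros d. cbv zeta. f_equal. apply CSeries_ext. intros m.
      replace (16 * PI ^ 2 * INR (S d) / (a ^ 2 * x)) with (kap * INR (S d)) by (unfold kap, lam; field; lra). reflexivity. }
  destruct (has_cint_Bessel_series lam nu k theta Hlam hnu) as [HL [E1 E2]].
  set (l := fun n => Cmult (Cmult (Cmult (RtoC 2) (cpow (lam * INR (S n)) (Cmult nu (RtoC (/ 2)))))
                      (BesselK nu (2 * sqrt (lam * INR (S n))))) (RtoC (divsum_sin k theta (S n)))) in *.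
  cbv zeta in HL, E1, E2.
  pose proof (has_cint_outer kap theta k nu Hkap Hth hnu) as HO. cbv zeta in HO. fold T3 in HO.
  (* The coefficients of the three terms of the transformation at [u = lam / t], freed from their
     powers of [t]. These powers, of exponents 0, 1 and [k + 1], shift the Gamma arguments to [nu],
     [1 + nu] and [nu + k + 1]. *)
  set (c1 := sg / (2 * PI) ^ k * (- / (4 * PI) * (INR (fact k) * HurwitzDiff k theta))).
  set (dl := if Nat.eqb k 0 then 1 else 0).
  set (c2 := dl * (PI / (2 * lam) * (1 - 2 * theta))).
  set (c3 := sg * (2 * PI / lam) ^ k * (PI / lam)).
  assert (HR : has_cint (fun t => Cmult (cpow t (Cminus nu (RtoC 1)))
      (RtoC (Series (fun n => divsum_sin k theta (S n) * exp (- t - lam * INR (S n) / t)))))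
     (Cplus (Cplus (Cmult (RtoC c1) (CGamma nu)) (Cmult (RtoC c2) (CGamma (Cplus (RtoC 1) nu)))) (Cmult (RtoC c3) T3))).
  { assert (hnu1 : 0 < Re (Cplus (RtoC 1) nu)) by (simpl; unfold Re in hnu; lra).
    pose proof (has_cint_plus _ _ _ _ (has_cint_plus _ _ _ _
      (has_cint_scal (RtoC c1) _ _ (has_cint_Gamma nu hnu)) (has_cint_scal (RtoC c2) _ _ (has_cint_Gamma _ hnu1)))
      (has_cint_scal (RtoC c3) _ _ HO)) as G.
    revert G. apply has_cint_ext. intros t Ht.
    assert (Hu : 0 < lam / t) by (apply Rdiv_lt_0_compat; auto).
    rewrite (Series_ext (fun n => divsum_sin k theta (S n) * exp (- t - lam * INR (S n) / t)) (fun n => exp (- t) * (divsum_sin k theta (S n) * exp (- (lam / t) * (INR n + 1))))).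
    2:{ intros n. rewrite S_INR. replace (- t - lam * (INR n + 1) / t) with (- t + - (lam / t) * (INR n + 1)) by (field; lra).
        rewrite exp_plus. ring. }
    rewrite (Series_scal_l (exp (- t))), (Series_divsum_sin_transform k theta (lam / t) hk Hth Hu).
    replace (4 * PI ^ 2 / (lam / t)) with (kap * t) by (unfold kap; field; lra).
    set (G := Series _). fold sg dl.
    replace (sg / (2 * PI) ^ k * (- / (4 * PI) * (INR (fact k) * HurwitzDiff k theta))) with c1 by reflexivity.
    replace (dl * (PI / (2 * (lam / t)) * (1 - 2 * theta))) with (c2 * t) by (unfold c2; field; lra).
    replace (sg * (2 * PI / (lam / t)) ^ k * (PI / (lam / t)) * G) with (c3 * t ^ S k * G).
    2:{ unfold c3. replace (2 * PI / (lam / t)) with (2 * PI / lam * t) by (field; lra). rewrite Rpow_mult_distr. simpl. field. lra. }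
    replace (Cminus (Cplus (RtoC 1) nu) (RtoC 1)) with (Cplus (Cminus nu (RtoC 1)) (RtoC 1)) by ring.
    replace (Cminus (Cplus nu (RtoC (INR k + 1))) (RtoC 1)) with (Cplus (Cminus nu (RtoC 1)) (RtoC (INR (S k)))) by (rewrite S_INR; ring).
    rewrite !cpow_plus, cpow_1, cpow_nat by auto.
    rewrite !RtoC_mult, !RtoC_plus, !RtoC_mult. ring. }
  pose proof (has_cint_unique _ _ _ HL HR) as E.
  set (S0 := CSeries (fun n0 => _)).
  (* Each term of [l] carries the factor 2 lam^(nu/2) of the Bessel integral; removing it cancels
     the power lam^(nu/2) in front and leaves half of [lam ^ S k]. *)
  assert (ES : Cmult (cpow lam (Cplus (Cmult nu (RtoC (/ 2))) (RtoC (INR k + 1)))) S0 =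
     Cmult (RtoC (/ 2 * lam ^ S k)) (CSeries l)).
  { assert (ES0 : S0 = Cmult (Cmult (RtoC (/ 2)) (cpow lam (Copp (Cmult nu (RtoC (/ 2)))))) (CSeries l)).
    { rewrite <- CSeries_scal by auto. unfold S0. apply CSeries_ext. intros n. cbv zeta. unfold l.
      assert (Hn : 0 < INR (S n)) by (apply lt_0_INR; lia).
      rewrite (cpow_mult lam (INR (S n))) by auto.
      replace (2 * sqrt (lam * INR (S n))) with (a * sqrt (INR (S n) * x)).
      2:{ replace (lam * INR (S n)) with ((a / 2) ^ 2 * (INR (S n) * x)) by (unfold lam; field).
          rewrite (sqrt_mult ((a / 2) ^ 2)), sqrt_pow2 by first [lra | apply pow2_ge_0 | left; apply Rmult_lt_0_compat; lra].
          field. }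
      set (B := BesselK _ _). set (sg' := RtoC (divsum_sin _ _ _)). set (N := cpow (INR (S n)) _).
      replace (Cmult (Cmult (RtoC (/ 2)) (cpow lam (Copp (Cmult nu (RtoC (/ 2))))))
         (Cmult (Cmult (Cmult (RtoC 2) (Cmult (cpow lam (Cmult nu (RtoC (/ 2)))) N)) B) sg')) with
        (Cmult (Cmult (Cmult (RtoC (/ 2)) (RtoC 2)) (Cmult (cpow lam (Cmult nu (RtoC (/ 2)))) (cpow lam (Copp (Cmult nu (RtoC (/ 2)))))))
           (Cmult (Cmult N B) sg')) by ring.
      rewrite cpow_opp, <- RtoC_mult. replace (/ 2 * 2) with 1 by field. ring. }
    rewrite ES0, <- (S_INR k), cpow_plus, cpow_nat, RtoC_mult by auto.
    replace (Cmult (Cmult (cpow lam (Cmult nu (RtoC (/ 2)))) (RtoC (lam ^ S k)))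
      (Cmult (Cmult (RtoC (/ 2)) (cpow lam (Copp (Cmult nu (RtoC (/ 2)))))) (CSeries l))) with
      (Cmult (Cmult (cpow lam (Cmult nu (RtoC (/ 2)))) (cpow lam (Copp (Cmult nu (RtoC (/ 2))))))
        (Cmult (Cmult (RtoC (/ 2)) (RtoC (lam ^ S k))) (CSeries l))) by ring.
    rewrite cpow_opp. ring. }
  rewrite ES, E.
  assert (Hp : 0 < (2 * PI) ^ k) by (apply pow_lt; lra).
  assert (Hl : 0 < lam ^ k) by (apply pow_lt; lra).
  rewrite !HurwitzZeta_0 by lra.
  assert (K1 : / 2 * lam ^ S k * c1 = - (sg * a ^ (2 * k + 2) * INR (fact k)) / (2 ^ (2 * k + 4) * (2 * PI) ^ (k + 1)) * (HurwitzDiff k theta * x ^ (k + 1))).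
  { unfold c1. 
    assert (Q1 : lam ^ S k * 2 ^ (2 * k + 2) = a ^ (2 * k + 2) * x ^ (k + 1)).
    { replace (2 * k + 2)%nat with (2 * S k)%nat by lia. replace (k + 1)%nat with (S k) by lia.
      rewrite !pow_mult, <- !Rpow_mult_distr. f_equal. unfold lam. field. }
    replace (2 * k + 4)%nat with (2 * k + 2 + 2)%nat by lia. rewrite (pow_add 2 (2 * k + 2)), (pow_add (2 * PI) k 1).
    assert (Q2 : 0 < 2 ^ (2 * k + 2)) by (apply pow_lt; lra).
    replace (- (sg * a ^ (2 * k + 2) * INR (fact k)) / (2 ^ (2 * k + 2) * 2 ^ 2 * ((2 * PI) ^ k * (2 * PI) ^ 1)) * (HurwitzDiff k theta * x ^ (k + 1)))
     with (- (sg * (a ^ (2 * k + 2) * x ^ (k + 1)) * INR (fact k)) / (2 ^ (2 * k + 2) * 2 ^ 2 * ((2 * PI) ^ k * (2 * PI) ^ 1)) * HurwitzDiff k theta)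
     by (unfold Rdiv; ring).
    rewrite <- Q1. simpl (2 ^ 2). simpl ((2 * PI) ^ 1). field. repeat split; lra. }
  (* The difference of the zeta values at 0 is [1 - 2 * theta]. For [k = 0] the powers of [lam]
     cancel, and otherwise [dl] is 0. *)
  assert (K2 : / 2 * lam ^ S k * c2 = dl * PI / 4 * (/ 2 - theta - (/ 2 - (1 - theta)))).
  { unfold c2, dl. destruct k as [|k']; simpl; field; lra. }
  assert (K3 : / 2 * lam ^ S k * c3 = sg / 4 * (2 * PI) ^ (k + 1)).
  { unfold c3. unfold Rdiv at 1. rewrite Rpow_mult_distr, pow_inv, pow_add. simpl. field. lra. }
  rewrite !Cmult_plus_distr_l, !Cmult_assoc, <- !RtoC_mult, K1, K2, K3.
  rewrite !RtoC_mult. ring.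
Qed.
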